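(* There exists an absolute constant $C>0$ such that for every $k$ and every $k$-vertex graph $H$ without isolated vertices there is a constant $c=c(H)$ (depending only on $H$) such that for every integer $n\ge 2^{Ck}$ we have $$r(nH)=(2|H|-\alpha(H))\,n+c.$$
   Context: All graphs are finite and simple. $|H|$ denotes the number of vertices of $H$ and $\alpha(H)$ the largest size of an independent set in $H$. $nH$ denotes the graph consisting of $n$ vertex-disjoint copies of $H$. For a graph $G$, the Ramsey number $r(G)$ is the smallest integer $N$ such that every $2$-colouring of the edges of the complete graph on $N$ vertices contains a monochromatic copy of $G$ (as a not necessarily induced subgraph). *)

(* Defs.v *)
From HB Require Import structures.
From mathcomp Require Import all_boot all_order all_algebra.
From mathcomp Require Import reals exp.

Set Implicit Arguments.
Unset Strict Implicit.
Unset Printing Implicit Defensive.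

Record sgraph := SGraph {
  vertex :> finType;
  adj : rel vertex;
  adj_sym : symmetric adj;
  adj_irrefl : irreflexive adj }.

Definition no_isolated (G : sgraph) : Prop :=
  forall x : G, exists y : G, adj x y.

Definition independent (G : sgraph) (S : {set G}) : bool :=
  [forall x in S, forall y in S, ~~ adj x y].

Definition alpha (G : sgraph) : nat :=
  \max_(S : {set G} | independent S) #|S|.

Section Copies.
Variables (n : nat) (G : sgraph).

Definition copies_adj : rel ('I_n * G)%type :=
  fun u v => (u.1 == v.1) && adj u.2 v.2.

Lemma copies_sym : symmetric copies_adj.
Proof. by move=> u v; rewrite /copies_adj eq_sym adj_sym. Qed.

Lemma copies_irrefl : irreflexive copies_adj.
Proof. by move=> u; rewrite /copies_adj adj_irrefl andbF. Qed.

Definition copies : sgraph := SGraph copies_sym copies_irrefl.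

End Copies.

(* An edge of the complete graph on 'I_N is a two-element set of vertices; the
   values of a colouring on sets of any other size are never used. *)
Definition colouring (N : nat) := {ffun {set 'I_N} -> bool}.

Definition mono_copy (G : sgraph) (N : nat) (col : colouring N) (b : bool)
    (f : {ffun G -> 'I_N}) : bool :=
  injectiveb f && [forall x, forall y, adj x y ==> (col [set f x; f y] == b)].

Definition arrows (N : nat) (G : sgraph) : bool :=
  [forall col : colouring N, exists b : bool, exists f, @mono_copy G N col b f].

Lemma ramsey_clique (T : finType) (col : {set T} -> bool) (s t : nat)
    (A : {set T}) :
  2 ^ (s + t) <= #|A| ->
  exists b : bool, exists2 S : {set T}, #|S| = (if b then s else t) &
    {in S &, forall x y, x != y -> col [set x; y] = b}.
Proof.
move=> hA.
suff [b [S [_ cS hS]]] : exists b : bool, exists S : {set T}, [/\ S \subset A,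
    #|S| = (if b then s else t) &
    {in S &, forall x y, x != y -> col [set x; y] = b}].
  by exists b, S.
move: {2}(s + t) (erefl (s + t)) hA => m.
elim: m s t A => [|m IH] s t A Em hA.
  exists true, set0; rewrite sub0set cards0; split=> //; first by case: s Em {hA}.
  by move=> x y; rewrite inE.
case: s Em hA => [|s] Em hA.
  exists true, set0; rewrite sub0set cards0; split=> //.
  by move=> x y; rewrite inE.
case: t Em hA => [|t] Em hA.
  exists false, set0; rewrite sub0set cards0; split=> //.
  by move=> x y; rewrite inE.
have /card_gt0P[x xA] : 0 < #|A| by apply: leq_trans hA; rewrite expn_gt0.
pose B b := [set y in A :\ x | col [set x; y] == b].
have BA b : B b \subset A by apply/subsetP=> y; rewrite !inE => /andP[/andP[]].
have ext b (S : {set T}) : S \subset B b ->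
    {in S &, forall x y, x != y -> col [set x; y] = b} ->
    [/\ x |: S \subset A, #|x |: S| = #|S|.+1 &
      {in x |: S &, forall x y, x != y -> col [set x; y] = b}].
  move=> sSB hS; split.
  - by rewrite subUset sub1set xA (subset_trans sSB).
  - rewrite cardsU1; case: (boolP (x \in S)) => // /(subsetP sSB).
    by rewrite !inE eqxx.
  - have hx y : y \in S -> col [set x; y] = b.
      by move/(subsetP sSB); rewrite !inE => /andP[_ /eqP].
    move=> y z /setU1P[->|yS] /setU1P[->|zS]; rewrite ?eqxx //.
    + by move=> _; apply: hx.
    + by move=> _; rewrite setUC; apply: hx.
    + exact: hS.
have cB : #|A :\ x| = #|B true| + #|B false|.
  rewrite -(cardsID [set y | col [set x; y]] (A :\ x)); congr (_ + _).
    by apply: eq_card => y; rewrite !inE eqb_id.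
  by apply: eq_card => y; rewrite !inE eqbF_neg andbC.
have hAx : #|A| = (#|A :\ x|).+1 by rewrite (cardsD1 x A) xA.
have hm : 2 ^ m <= #|B true| \/ 2 ^ m <= #|B false|.
  case: (leqP (2 ^ m) #|B true|) => [|lt1]; first by left.
  case: (leqP (2 ^ m) #|B false|) => [|lt2]; first by right.
  exfalso; move: hA; rewrite hAx cB Em expnS mul2n -addnn -ltnS => h.
  by have := leq_ltn_trans (leq_add lt1 lt2) h; rewrite addSn addnS ltnn.
have E1 : s + t.+1 = m by move: Em; rewrite addSn => -[].
have E2 : s.+1 + t = m by rewrite addSn -addnS.
case: hm => hB.
  have [|b [S [SB cS hS]]] := IH s t.+1 (B true) E1; first by rewrite E1.
  case: b cS hS => cS hS.
    by have [? c ?] := ext _ _ SB hS; exists true, (x |: S); rewrite c cS.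
  by exists false, S; rewrite (subset_trans SB).
have [|b [S [SB cS hS]]] := IH s.+1 t (B false) E2; first by rewrite E2.
case: b cS hS => cS hS.
  by exists true, S; rewrite (subset_trans SB).
by have [? c ?] := ext _ _ SB hS; exists false, (x |: S); rewrite c cS.
Qed.

Lemma ramsey_exists (G : sgraph) : exists N, arrows N G.
Proof.
exists (2 ^ (#|G| + #|G|)); apply/forallP => col.
have [|b [S cS hS]] := @ramsey_clique _ col #|G| #|G| setT.
  by rewrite cardsT card_ord.
have {}cS : #|G| = #|S| by rewrite cS; case: (b).
apply/existsP; exists b; apply/existsP.
exists [ffun x : G => enum_val (cast_ord cS (enum_rank x))].
have inj : injective (fun x : G => enum_val (cast_ord cS (enum_rank x))).
  by move=> x y /enum_val_inj/cast_ord_inj/enum_rank_inj.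
apply/andP; split.
  by apply/injectiveP => x y; rewrite !ffunE => /inj.
apply/forallP => x; apply/forallP => y; apply/implyP => xy.
rewrite !ffunE; apply/eqP/hS; [exact: enum_valP | exact: enum_valP |].
by apply/negP => /eqP/inj exy; move: xy; rewrite exy adj_irrefl.
Qed.

Definition ramsey (G : sgraph) : nat := ex_minn (ramsey_exists G).

(* Main.v *)
(* Write [k = |H|], [d = |H| - alpha(H)] and [f(n) = r(nH) - (k + d) n]; the
   claim is that [f] is constant from [n = 2^(60k)] on.

   [f(n+1) <= f(n)]: a large coloured set without [n+1] disjoint copies of [H] of
   one colour contains a tie, a set of [k + d] vertices containing a copy of [H]
   in each colour; remove it and use the definition of [r(nH)].

   [f(n+1) >= f(n)]: an extremal colouring for [nH] has few disjoint sets that are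
   more economical than ties. After removing them, the rest [V] is rigid: for one
   of the colours, [c], all but a bounded number of [kn] vertices form a set [A]
   in which every vertex has boundedly many neighbours of the other colour. Let
   [E] be the few outside vertices with many [c]-neighbours in [A], and [B] the
   remaining vertices. A [c]-sparse spot [S] of [B] with no [c]-clique of size [k]
   allows [B], apart from a small set [Low] of vertices [c]-joined to most of [S],
   to be tiled by [~~ c]-cliques of size [d] without any loss. Therefore [k + d]
   vertices can be added to an idealised colouring: [A], [E] and [k] new vertices
   form a [c]-clique, joined in [~~ c] to everything else; [B] without [Low] and
   [d] new vertices form a [~~ c]-clique, joined in [c] to [Low]. A monochromatic
   [(n+1)H] in it would, after re-embedding into the tilings above, give a
   monochromatic [nH] in the original colouring. *)

Require Import Defs.
From HB Require Import structures.
From mathcomp Require Import all_boot all_order all_algebra.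
From mathcomp Require Import reals exp.
From mathcomp Require Import boolp zify.

Set Implicit Arguments.
Unset Strict Implicit.
Unset Printing Implicit Defensive.

(* [lia] is slowed down by boolean hypotheses and tries to expand powers. *)
Ltac plia :=
  repeat match goal with
  | h : ?P |- _ => lazymatch type of P with Prop =>
      lazymatch P with
      | is_true (leq _ _) => fail
      | @eq nat _ _ => fail
      | _ => clear h
      end end
  end;
  repeat match goal with
  | h : context [expn ?x ?y] |- _ =>
      let v := fresh "v" in set v := expn x y in *; clearbody v
  | |- context [expn ?x ?y] =>
      let v := fresh "v" in set v := expn x y in *; clearbody v
  end; lia.

(** The step from [n] to [n + 1] must be exact, so bounded errors of greedy Ramsey arguments cannot
    be tolerated in it. They are harmless only for rigidity: a set that does better than [k + d]
    vertices per copy in each colour saves a whole vertex, and slightly more than [2 ^ (3 * k)]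
    disjoint savings beat the additive error in the bound [r(nH) <= (k + d) n + 2 ^ (3k)]. In the
    extension the quotients of the sizes of [A] with [E] by [k], and of [B] without [Low] by [d],
    must be attained by actual tilings, even after a bounded set is deleted. In [A] a reserved
    clique is enough; in [B] absorbers are built, each round halving the set of vertices not yet
    served. The spot is cut down to at most [2 ^ (50k)] vertices, so that the number of rounds is
    linear in [k] and the threshold stays singly exponential. [H] may be disconnected, so one copy
    can spread over parts with no edge of its colour between them; this is why copies are
    re-embedded vertex by vertex and counted part by part. The absence of isolated vertices gives
    [alpha H < #|H|], hence [d > 0]. *)

Lemma subset_of_card (T : finType) (X : {set T}) j :
  j <= #|X| -> exists2 Y : {set T}, Y \subset X & #|Y| = j.
Proof.
move=> jX; exists [set x in take j (enum X)].
  by apply/subsetP => x; rewrite inE => /mem_take; rewrite mem_enum.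
rewrite cardsE; have /card_uniqP -> : uniq (take j (enum X)).
  by rewrite take_uniq // enum_uniq.
by rewrite size_takel // -cardE.
Qed.

(** * Cliques in two-coloured complete graphs *)

Section Coloured.
Variables (T : finType) (col : T -> T -> bool).
Hypothesis col_sym : symmetric col.
Implicit Types (S X Y Z Q R : {set T}) (c b : bool).

Definition clique c S := {in S &, forall x y, x != y -> col x y = c}.
Definition joined c X Y := {in X & Y, forall x y, col x y = c}.
Definition nbr c x := [set y | (y != x) && (col x y == c)].
Definition kclique c s S := clique c S /\ #|S| = s.
Definition cfree c s X := forall S, S \subset X -> ~ kclique c s S.

Lemma cliqueS c X Y : X \subset Y -> clique c Y -> clique c X.
Proof. by move=> /subsetP XY cY x y /XY xY /XY yY; apply: cY. Qed.

Lemma clique0 c : clique c set0.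
Proof. by move=> x y; rewrite inE. Qed.

Lemma clique1 c x : clique c [set x].
Proof. by move=> y z; rewrite !inE => /eqP-> /eqP->; rewrite eqxx. Qed.

Lemma cliqueU c X Y : clique c X -> clique c Y -> joined c X Y ->
  clique c (X :|: Y).
Proof.
move=> cX cY cXY x y /setUP[xX|xY] /setUP[yX|yY] xy.
- exact: cX.
- exact: cXY.
- by rewrite col_sym; apply: cXY.
- exact: cY.
Qed.

Lemma joinedS c X Y X' Y' : X' \subset X -> Y' \subset Y -> joined c X Y ->
  joined c X' Y'.
Proof. by move=> /subsetP XX /subsetP YY h x y /XX ? /YY ?; apply: h. Qed.

Lemma joinedC c X Y : joined c X Y -> joined c Y X.
Proof. by move=> h x y xY yX; rewrite col_sym; apply: h. Qed.

Lemma joined_nbr c x Y : Y \subset nbr c x -> joined c [set x] Y.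
Proof.
move=> /subsetP h y z /set1P-> /h; rewrite inE => /andP[_ /eqP->] //.
Qed.

Lemma cliqueU1 c x S : S \subset nbr c x -> clique c S -> clique c (x |: S).
Proof. by move=> h cS; apply: cliqueU => //; [exact: clique1|exact: joined_nbr]. Qed.

Lemma nbr_notin c x S : S \subset nbr c x -> x \notin S.
Proof. by move=> /subsetP h; apply/negP => /h; rewrite inE eqxx. Qed.

Lemma kcliqueU1 c s x S : S \subset nbr c x -> kclique c s S ->
  kclique c s.+1 (x |: S).
Proof.
move=> h [cS eS]; split; first exact: cliqueU1.
by rewrite cardsU1 (nbr_notin h) eS.
Qed.

Lemma mem_nbr c x y : (y \in nbr c x) = (y != x) && (col x y == c).
Proof. by rewrite inE. Qed.

Lemma cardsD_nbr c x X :
  #|X :\ x| = #|X :&: nbr c x| + #|X :&: nbr (~~ c) x|.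
Proof.
rewrite -(cardsID (nbr c x) (X :\ x)); congr (_ + _); apply: eq_card => y;
  rewrite !inE; case: eqP => //= _; rewrite ?andbT ?andbF //.
by case: (y \in X); case: (col x y); case: c.
Qed.

Lemma card_nbr_ge c x X :
  #|X| <= (#|X :&: nbr c x| + #|X :&: nbr (~~ c) x|).+1.
Proof. by rewrite -cardsD_nbr (cardsD1 x X); case: (x \in X). Qed.

Lemma cfreeS c s X Y : X \subset Y -> cfree c s Y -> cfree c s X.
Proof. by move=> XY fY S SX; apply: fY; apply: subset_trans XY. Qed.

Lemma cfree_le c s t X : s <= t -> cfree c s X -> cfree c t X.
Proof.
move=> st fX S SX [cS eS].
have [|Y YS eY] := @subset_of_card _ S s; first by rewrite eS.
by apply: (fX Y); [exact: subset_trans SX|split=> //; exact: cliqueS cS].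
Qed.

Lemma disjUl X Y Z : [disjoint X :|: Y & Z] = [disjoint X & Z] && [disjoint Y & Z].
Proof. by rewrite -!setI_eq0 setIUl setU_eq0. Qed.

Lemma disjUr X Y Z : [disjoint Z & X :|: Y] = [disjoint Z & X] && [disjoint Z & Y].
Proof. by rewrite -!setI_eq0 setIUr setU_eq0. Qed.

Lemma disjDl X Y : [disjoint X :\: Y & Y].
Proof. by have := subxx (X :\: Y); rewrite subsetD => /andP[]. Qed.

Lemma disjDr X Y : [disjoint Y & X :\: Y].
Proof. by rewrite disjoint_sym disjDl. Qed.

Lemma cardsU_le X Y : #|X :|: Y| <= #|X| + #|Y|.
Proof. by rewrite leq_card_setU. Qed.

Lemma cardsU_disj X Y : [disjoint X & Y] -> #|X :|: Y| = #|X| + #|Y|.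
Proof. by move=> h; rewrite cardsU disjoint_setI0 // cards0 subn0. Qed.

Lemma cardsD_sub X Y : Y \subset X -> #|X :\: Y| = #|X| - #|Y|.
Proof. by move=> h; rewrite cardsD (setIidPr h). Qed.

(* The Erdos-Szekeres argument, keeping track of a large set of common
   neighbours. *)
Lemma clique_common_nbr c s t h X : 0 < h -> 2 ^ (s + t) * h <= #|X| -> cfree c s X ->
  exists S Y : {set T}, [/\ S \subset X, Y \subset X, kclique (~~ c) t S, h <= #|Y| &
    [disjoint S & Y] /\ joined (~~ c) S Y].
Proof.
move=> h0; move En : (s + t) => n.
elim: n s t X En => [|n IH] s t X En hX fX.
  case: s t En fX => [|//] [|//] _ fX.
  by case: (fX set0); [exact: sub0set|split; [exact: clique0|exact: cards0]].
case: s En fX => [|s] En fX.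
  by case: (fX set0); [exact: sub0set|split; [exact: clique0|exact: cards0]].
case: t En => [|t] En.
  exists set0, X; split=> //; first exact: sub0set.
  - by split; [exact: clique0|exact: cards0].
  - by apply: leq_trans hX; rewrite leq_pmull // expn_gt0.
  - split; first by rewrite disjoints_subset sub0set.
    by move=> x y; rewrite inE.
have /card_gt0P[x xX] : 0 < #|X|.
  by apply: leq_trans hX; rewrite muln_gt0 h0 expn_gt0.
have := card_nbr_ge c x X; rewrite expnS in hX.
have p0 : 0 < 2 ^ n * h by rewrite muln_gt0 h0 expn_gt0.
have {p0} : 2 ^ n * h <= #|X :&: nbr c x| \/ 2 ^ n * h <= #|X :&: nbr (~~ c) x|
     \/ #|X :&: nbr c x| + #|X :&: nbr (~~ c) x| < 2 * 2 ^ n * h - 1.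
  by move: p0 (leqP (2 ^ n * h) #|X :&: nbr c x|)
    (leqP (2 ^ n * h) #|X :&: nbr (~~ c) x|); rewrite -mulnA; lia.
move=> [hN|[hN|hN]] hh; last by lia.
- have [||S [Y [SX YX kS hY [dS jS]]]] := IH s t.+1 _ _ hN.
  + by lia.
  + move=> S SX kS; apply: (fX (x |: S)).
      by rewrite subUset sub1set xX (subset_trans SX) // subsetIl.
    by apply: kcliqueU1 => //; apply: subset_trans SX _; apply: subsetIr.
  by exists S, Y; split=> //; [exact: subset_trans SX (subsetIl _ _)
    |exact: subset_trans YX (subsetIl _ _)].
- have [||S [Y [SX YX kS hY [dS jS]]]] := IH s.+1 t _ _ hN.
  + by lia.
  + exact: cfreeS (subsetIl _ _) fX.
  have SN := subset_trans SX (subsetIr _ _).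
  have YN := subset_trans YX (subsetIr _ _).
  exists (x |: S), Y; split=> //.
  + by rewrite subUset sub1set xX (subset_trans SX) // subsetIl.
  + exact: subset_trans YX (subsetIl _ _).
  + exact: kcliqueU1.
  + split; first by rewrite disjUl disjoints1 (nbr_notin YN).
    by move=> y z /setU1P[->|yS] zY; [apply: (joined_nbr YN); rewrite ?set11|exact: jS].
Qed.

Lemma ramsey_sub c s t X : 2 ^ (s + t) <= #|X| -> cfree c s X ->
  exists2 S : {set T}, S \subset X & kclique (~~ c) t S.
Proof.
move=> hX fX; have [|||S [Y [? _ ? _ _]]] := @clique_common_nbr c s t 1 X => //.
  by rewrite muln1.
by exists S.
Qed.

Inductive part (P : {set T} -> Prop) : nat -> {set T} -> Prop :=
| part0 : part P 0 set0
| partS n X S : P S -> [disjoint S & X] -> part P n X -> part P n.+1 (S :|: X).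

Lemma part1 (P : {set T} -> Prop) S : P S -> part P 1 S.
Proof.
move=> PS; rewrite -[S]setU0; apply: partS => //; last exact: part0.
by rewrite -setI_eq0 setI0.
Qed.

Lemma part_cat (P : {set T} -> Prop) n m X Y : part P n X -> part P m Y ->
  [disjoint X & Y] -> part P (n + m) (X :|: Y).
Proof.
move=> pX pY; elim: pX => [|{}n {}X S PS dS pX IH]; first by rewrite set0U.
rewrite disjUl => /andP[dSY dXY]; rewrite addSn -setUA; apply: partS => //.
  by rewrite disjUr dS.
exact: IH.
Qed.

Lemma part_card (P : {set T} -> Prop) s n X :
  (forall S, P S -> #|S| = s) -> part P n X -> #|X| = n * s.
Proof.
move=> hP; elim=> [|{}n {}X S PS dS pX IH]; first by rewrite cards0.
by rewrite cardsU disjoint_setI0 // cards0 subn0 hP // IH mulSn.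
Qed.

Lemma part_take (P : {set T} -> Prop) n m X : part P n X -> m <= n ->
  exists2 Y : {set T}, Y \subset X & part P m Y.
Proof.
move=> pX; elim: pX m => [|{}n {}X S PS dS pX IH] m.
  by rewrite leqn0 => /eqP->; exists set0 => //; exact: part0.
case: m => [_|m /IH [Y YX pY]]; first by exists set0; [exact: sub0set|exact: part0].
exists (S :|: Y); first exact: setUS.
apply: partS => //; exact: disjointWr dS.
Qed.

Lemma part_mem (P : {set T} -> Prop) n X x : part P n X -> x \in X ->
  exists S, [/\ P S, x \in S & S \subset X].
Proof.
elim=> [|{}n {}X S PS dS pX IH]; first by rewrite inE.
case/setUP=> [xS|/IH[S' [PS' xS' SX']]].
  by exists S; split=> //; apply: subsetUl.
by exists S'; split=> //; apply: subset_trans SX' (subsetUr _ _).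
Qed.

Lemma part_max (P : {set T} -> Prop) X : (forall S, P S -> S != set0) ->
  exists n Y, [/\ Y \subset X, part P n Y &
    forall S, S \subset X :\: Y -> ~ P S].
Proof.
move=> P0; move En : #|X| => n; elim/ltn_ind: n X En => n IH X En.
have [[S SX PS]|h] := EM (exists2 S : {set T}, S \subset X & P S); last first.
  exists 0, set0; split; [exact: sub0set|exact: part0|].
  by move=> S; rewrite setD0 => SX PS; apply: h; exists S.
have lt : #|X :\: S| < n.
  rewrite cardsD (setIidPr SX) En; have := P0 _ PS; rewrite -card_gt0.
  by have := subset_leq_card SX; lia.
have [q [Y [YX pY mY]]] := IH _ lt _ erefl.
have dSY : [disjoint S & Y].
  by rewrite disjoint_sym; move: YX; rewrite subsetD => /andP[].
exists q.+1, (S :|: Y); split.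
- by rewrite subUset SX (subset_trans YX) // subsetDl.
- exact: partS.
- by move=> S' h; apply: mY; rewrite setDDl.
Qed.

Lemma part_clique c t q S : clique c S -> #|S| = q * t ->
  part (kclique c t) q S.
Proof.
elim: q S => [|q IH] S cS eS.
  have /eqP-> : S == set0 by rewrite -cards_eq0 eS.
  exact: part0.
have [|Y YS eY] := @subset_of_card _ S t; first by rewrite eS mulSn leq_addr.
have -> : S = Y :|: (S :\: Y) by rewrite setDE setUIr setUCr setIT (setUidPr YS).
apply: partS.
- by split=> //; apply: cliqueS cS.
- by rewrite -setI_eq0 setIDA setIC -setIDA setDv setI0.
- apply: IH; first by apply: cliqueS cS; apply: subsetDl.
  by rewrite cardsD (setIidPr YS) eS eY mulSn addKn.
Qed.

(** A maximal packing leaves no further tile, so by Ramsey's bound it leaves fewer than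
    [2 ^ (s + t)] vertices. *)
Lemma greedy c s t X : 0 < t -> cfree c s X ->
  exists q Y, [/\ Y \subset X, part (kclique (~~ c) t) q Y & #|X :\: Y| < 2 ^ (s + t)].
Proof.
move=> t0 fX; have [|q [Y [YX pY mY]]] := @part_max (kclique (~~ c) t) X.
  by move=> S [_ eS]; rewrite -card_gt0 eS.
exists q, Y; split=> //; rewrite ltnNge; apply/negP => h.
have [S SX kS] := ramsey_sub h (cfreeS (subsetDl _ _) fX).
by apply: mY kS.
Qed.

Definition homogeneous Q R := {in Q, forall q, exists b, {in R, forall r, col q r = b}}.
Definition side b Q R := [set q in Q | [forall r in R, col q r == b]].

Lemma side_sub b Q R : side b Q R \subset Q.
Proof. by apply/subsetP => x; rewrite inE => /andP[]. Qed.

Lemma side_joined b Q R : joined b (side b Q R) R.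
Proof. by move=> x y; rewrite inE => /andP[_ /forall_inP h] /h/eqP. Qed.

(** Only an inequality: for empty [R] both sides are all of [Q]. *)
Lemma card_side c Q R : homogeneous Q R -> #|Q| <= #|side c Q R| + #|side (~~ c) Q R|.
Proof.
move=> hQ; rewrite (leq_trans _ (leq_card_setU _ _)) //; apply: subset_leq_card.
apply/subsetP => q qQ; have [b hb] := hQ q qQ; rewrite !inE qQ /=.
case: (eqVneq b c) => [<-|bc]; apply/orP; [left|right].
  by apply/forall_inP => r /hb->.
by apply/forall_inP => r /hb->; case: (b) bc; case: (c).
Qed.

Lemma homogS Q Q' R : Q' \subset Q -> homogeneous Q R -> homogeneous Q' R.
Proof. by move=> /subsetP QQ h q /QQ/h. Qed.

Lemma homog_class Q h X : 2 ^ #|Q| * h <= #|X| ->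
  exists2 Y : {set T}, Y \subset X & h <= #|Y| /\ homogeneous Q Y.
Proof.
have [->|h0] := posnP h; first by move=> _; exists set0; rewrite ?sub0set ?cards0;
  split=> // q _; exists true => r; rewrite inE.
(* Vertices are classified by their colour pattern towards [Q]; there are at most [2 ^ #|Q|]
   classes. *)
pose typ x : {set T} := [set q in Q | col q x].
have typQ x : typ x \in powerset Q.
  by rewrite inE; apply/subsetP => q; rewrite inE => /andP[].
move=> hX.
have [A hA] : exists A, h <= #|[set x in X | typ x == A]|.
  apply: contrapT => hn.
  have {}hn A : #|[set x in X | typ x == A]| <= h.-1.
    by have := hn; case: (leqP h #|[set x in X | typ x == A]|) => [hA []|]; [exists A|lia].
  have : #|X| <= 2 ^ #|Q| * h.-1; last first.
    have : 0 < 2 ^ #|Q| by rewrite expn_gt0.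
    by move: hX h0; move: (2 ^ #|Q|) #|X| => u v; nia.
  rewrite -card_powerset -sum_nat_const -sum1_card.
  rewrite (partition_big typ (mem (powerset Q))) //=.
  apply: leq_sum => A _; apply: leq_trans (hn A).
  by rewrite -sum1dep_card; apply/eq_leq/eq_bigl => x; rewrite ?inE.
exists [set x in X | typ x == A]; first by apply/subsetP => x; rewrite inE => /andP[].
split=> // q qQ; exists (q \in A) => r; rewrite inE => /andP[_ /eqP<-].
by rewrite inE qQ.
Qed.

Lemma homog_clique c s Q X : 2 ^ (#|Q| + (s + s)) <= #|X| -> cfree c s X ->
  exists R, [/\ R \subset X, kclique (~~ c) s R & homogeneous Q R].
Proof.
rewrite expnD => /homog_class[Y YX [hY hQ]] fX.
have [R RY kR] := ramsey_sub hY (cfreeS YX fX).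
exists R; split=> //; first exact: subset_trans YX.
by move=> q /hQ[b hb]; exists b => r /(subsetP RY)/hb.
Qed.

(** Greedy choice: a chosen vertex discards itself and fewer than [D] others, hence at most [D]
    vertices. *)
Lemma sparse_clique c D s X : 0 < D ->
  {in X, forall x, #|X :&: nbr (~~ c) x| < D} ->
  s * D <= #|X| -> exists2 S : {set T}, S \subset X & kclique c s S.
Proof.
move=> D0; elim: s X => [|s IH] X hD hX.
  by exists set0; [exact: sub0set|split; [exact: clique0|exact: cards0]].
have /card_gt0P[x xX] : 0 < #|X| by apply: leq_trans hX; rewrite muln_gt0 D0.
have [||S SX kS] := IH (X :&: nbr c x).
- move=> y /setIP[yX _]; apply: leq_ltn_trans (hD y yX).
  by apply: subset_leq_card; apply: setSI; apply: subsetIl.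
- by have := hD x xX; have := card_nbr_ge c x X; move: hX; rewrite mulSn; lia.
exists (x |: S); last by apply: kcliqueU1 => //; apply: subset_trans SX (subsetIr _ _).
by rewrite subUset sub1set xX (subset_trans SX) // subsetIl.
Qed.

End Coloured.

Lemma inj_into (A B : finType) (b0 : B) (I : {set A}) (X : {set B}) :
  #|I| <= #|X| ->
  exists2 g : A -> B, {in I, forall x, g x \in X} & {in I &, injective g}.
Proof.
move=> IX; exists (fun x => nth b0 (enum X) (index x (enum I))).
  move=> x xI; rewrite -mem_enum mem_nth // -cardE (leq_trans _ IX) //.
  by rewrite cardE index_mem mem_enum.
move=> x y xI yI /eqP; rewrite nth_uniq ?enum_uniq -?cardE ?(leq_trans _ IX) //.
- move=> /eqP e; rewrite -(@nth_index _ x x (enum I)) ?mem_enum // e.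
  by rewrite nth_index ?mem_enum.
- by rewrite cardE index_mem mem_enum.
- by rewrite cardE index_mem mem_enum.
Qed.

(** * Disjoint monochromatic copies *)

Section Graph.
Variable H : sgraph.
Local Notation k := #|H|.
Local Notation a := (alpha H).

Lemma alpha_ex : exists2 I : {set H}, independent I & #|I| = a.
Proof.
have h0 : independent (set0 : {set H}).
  by apply/forall_inP => x; rewrite inE.
have [I hI e] := @eq_bigmax_cond _ [pred S : {set H} | independent S] (fun S => #|S|)
  ltac:(by apply/card_gt0P; exists set0; rewrite inE).
by exists I => //; rewrite /alpha e.
Qed.

Lemma alpha_max (I : {set H}) : independent I -> #|I| <= a.
Proof. by move=> hI; apply: (@leq_bigmax_cond _ _ (fun S : {set H} => #|S|)). Qed.

Lemma independent1 (x : H) : independent [set x].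
Proof.
apply/forall_inP => y /set1P->; apply/forall_inP => z /set1P->.
by rewrite adj_irrefl.
Qed.

Lemma alpha_gt0 : 0 < k -> 0 < a.
Proof.
by case/card_gt0P => x _; rewrite (leq_trans _ (alpha_max (independent1 x))) ?cards1.
Qed.

Lemma alpha_lt : 0 < k -> no_isolated H -> a < k.
Proof.
case/card_gt0P => x _ hH; have [I hI <-] := alpha_ex.
rewrite ltn_neqAle max_card andbT; apply/negP => /eqP e.
have IT : I = setT by apply/eqP; rewrite eqEcard subsetT cardsT e /=.
have [y xy] := hH x; move/forall_inP/(_ x): hI; rewrite IT inE => /(_ isT).
by move/forall_inP/(_ y); rewrite inE xy => /(_ isT).
Qed.

Section Col.
Variables (T : finType) (col : T -> T -> bool).
Hypothesis col_sym : symmetric col.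
Implicit Types (S X Y Z Q R : {set T}) (c b : bool).
Local Notation clique := (@clique T col).
Local Notation joined := (@joined T col).
Local Notation kclique := (@kclique T col).
Local Notation cfree := (@cfree T col).

Definition has_copies c n X := exists f : 'I_n -> H -> T,
  [/\ forall i j x y, f i x = f j y -> i = j /\ x = y,
      forall i x, f i x \in X &
      forall i x y, adj x y -> col (f i x) (f i y) = c].

Lemma hcS c n X Y : X \subset Y -> has_copies c n X -> has_copies c n Y.
Proof.
by move=> /subsetP XY [f [fi fX fe]]; exists f; split=> // i x; apply: XY.
Qed.

Lemma hc_le c m n X : m <= n -> has_copies c n X -> has_copies c m X.
Proof.
move=> mn [f [fi fX fe]]; exists (fun i => f (widen_ord mn i)); split=> //.
  by move=> i j x y /fi[/(congr1 val)/= ij ->]; split=> //; apply: val_inj.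
by move=> i x y; apply: fe.
Qed.

Lemma hc0 c X : has_copies c 0 X.
Proof.
have h (i : 'I_0) : False by case: i.
by exists (fun i => False_rect _ (h i)); split=> i; case: (h i).
Qed.

Lemma hc_cat c n m X Y : has_copies c n X -> has_copies c m Y -> [disjoint X & Y] ->
  has_copies c (n + m) (X :|: Y).
Proof.
move=> [f [fi fX fe]] [g [gi gY ge]] dXY.
exists (fun i => match split i with inl i => f i | inr j => g j end).
have nXY x y z z' : f x y = g z z' -> False.
  by move=> e; have := disjointFr dXY (fX x y); rewrite e gY.
split.
- move=> i j x y; have := splitK i; have := splitK j.
  case: (split i) => i'; case: (split j) => j' <- <-.
  + by case/fi => -> ->.
  + by move/nXY.
  + by move/esym/nXY.
  + by case/gi => -> ->.
- by move=> i x; case: (split i) => j; rewrite inE ?fX ?gY ?orbT.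
- by move=> i x y xy; case: (split i) => j; [apply: fe|apply: ge].
Qed.

Lemma hc_add c n m X Y Z : has_copies c n X -> has_copies c m Y -> [disjoint X & Y] ->
  X \subset Z -> Y \subset Z -> has_copies c (n + m) Z.
Proof.
move=> hX hY dXY XZ YZ; apply: hcS (hc_cat hX hY dXY).
by rewrite subUset XZ.
Qed.

Lemma hc_part c q (P : {set T} -> Prop) n X : part P n X ->
  (forall S, S \subset X -> P S -> has_copies c q S) -> has_copies c (n * q) X.
Proof.
elim=> [|{}n {}X S PS dS pX IH] hP; first exact: hc0.
rewrite mulSn; apply: hc_cat => //; first by apply: hP => //; apply: subsetUl.
by apply: IH => S' SX; apply: hP; apply: subset_trans SX (subsetUr _ _).
Qed.

(** No edge of [H] lies inside [I], so the colours inside [X] do not matter and a clique on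
    [k - #|I|] vertices suffices. *)
Lemma hc_join c (I : {set H}) X Y : 0 < k -> independent I -> #|I| <= #|X| ->
  k - #|I| <= #|Y| -> clique c Y -> joined c X Y -> [disjoint X & Y] ->
  has_copies c 1 (X :|: Y).
Proof.
move=> k0 hI IX IY cY jXY dXY.
have [t0 _] : exists t0, t0 \in X :|: Y.
  apply/set0Pn; rewrite -card_gt0 cardsU disjoint_setI0 // cards0 subn0.
  by lia.
have [f fX fi] := inj_into t0 IX.
have [|g gY gi] := @inj_into _ _ t0 (~: I) Y.
  by rewrite cardsCs setCK.
pose h x := if x \in I then f x else g x.
have hX x : x \in I -> h x \in X by move=> xI; rewrite /h xI fX.
have hY x : x \notin I -> h x \in Y.
  by move=> xI; rewrite /h (negbTE xI) gY // inE.
have hi x y : h x = h y -> x = y.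
  have := hX x; have := hX y; have := hY x; have := hY y.
  case: (boolP (x \in I)) => xI; case: (boolP (y \in I)) => yI.
  - by rewrite /h xI yI => _ _ _ _; apply: fi.
  - move=> /(_ isT) h1 _ _ /(_ isT) h2 e.
    by have := disjointFr dXY h2; rewrite e h1.
  - move=> _ /(_ isT) h1 /(_ isT) h2 _ e.
    by have := disjointFr dXY h2; rewrite -e h1.
  - by rewrite /h (negbTE xI) (negbTE yI) => _ _ _ _; apply: gi; rewrite inE.
exists (fun _ => h); split.
- by move=> i j x y /hi->; rewrite !ord1.
- by move=> i x; rewrite inE; case: (boolP (x \in I)) => [/hX->|/hY->]; rewrite ?orbT.
- move=> _ x y xy; case: (boolP (x \in I)) => xI; case: (boolP (y \in I)) => yI.
  + by move/forall_inP/(_ x xI)/forall_inP/(_ y yI): hI; rewrite xy.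
  + by apply: jXY; [exact: hX|exact: hY].
  + by rewrite col_sym; apply: jXY; [exact: hX|exact: hY].
  + apply: cY; [exact: hY|exact: hY|].
    by apply/negP => /eqP/hi e; move: xy; rewrite e adj_irrefl.
Qed.

Hypothesis k0 : 0 < k.
Hypothesis noiso : no_isolated H.
Local Notation d := (k - a).

Lemma d_gt0 : 0 < d. Proof. by have := alpha_lt k0 noiso; lia. Qed.
Lemma kE : k = a + d. Proof. by have := alpha_lt k0 noiso; lia. Qed.
Lemma a_gt0 : 0 < a. Proof. exact: alpha_gt0. Qed.

Lemma hc_clique c S : clique c S -> k <= #|S| -> has_copies c 1 S.
Proof.
move=> cS kS; rewrite -[S]set0U; apply: (@hc_join c set0) => //.
- by apply/forall_inP => x; rewrite inE.
- by rewrite cards0.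
- by rewrite cards0 subn0.
- by move=> x y; rewrite inE.
- by rewrite disjoints_subset sub0set.
Qed.

Lemma hc_alpha c X Y : a <= #|X| -> d <= #|Y| -> clique c Y -> joined c X Y ->
  [disjoint X & Y] -> has_copies c 1 (X :|: Y).
Proof. by have [I hI <-] := alpha_ex; apply: hc_join. Qed.

Lemma hc_one c X Y : 1 <= #|X| -> k.-1 <= #|Y| -> clique c Y -> joined c X Y ->
  [disjoint X & Y] -> has_copies c 1 (X :|: Y).
Proof.
case/card_gt0P: (k0) => x _ hX hY; apply: (@hc_join _ [set x]) => //.
- exact: independent1.
- by rewrite cards1.
- by rewrite cards1; lia.
Qed.

(** Compare a [true]-clique [Q] of a maximal packing with a homogeneous [false]-clique [R] outside
    it. If [a] vertices of [Q] see [R] in [false], then [Q] with [d] vertices of [R] is a tie;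
    otherwise [d] vertices of [Q] see [R] in [true], and [R] with these is one. *)
Lemma copies_or_tie n X : k * n + 2 ^ (3 * k) <= #|X| ->
  (exists c, has_copies c n X) \/
  (exists S, [/\ S \subset X, #|S| = k + d & forall c, has_copies c 1 S]).
Proof.
move=> hX.
have [|q [Y [YX pY mY]]] := @part_max _ (kclique true k) X.
  by move=> S [_ eS]; rewrite -card_gt0 eS.
have cY : #|Y| = q * k by apply: part_card pY => S [].
have fW : cfree true k (X :\: Y) by [].
have [nq|qn] := leqP n q.
  left; exists true; apply: hcS YX _; apply: (hc_le nq).
  rewrite -[q]muln1; apply: hc_part pY _ => S _ [cS eS].
  by apply: hc_clique; rewrite ?eS.
have hW : 2 ^ (3 * k) <= #|X :\: Y|.
  rewrite cardsD (setIidPr YX) cY; have : q * k <= k * n by nia.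
  by lia.
(* With an empty packing there is no [true]-clique of size [k], and [false]-cliques alone cover
   almost all of [X]. *)
case: q pY cY qn => [|q] pY cY qn.
  left; exists false; have {}fW : cfree true k X.
    move/eqP: cY; rewrite cards_eq0 => /eqP Y0; by rewrite Y0 setD0 in fW.
  have [q [Z [ZX pZ lZ]]] := greedy col_sym k0 fW.
  have cZ : #|Z| = q * k by apply: part_card pZ => S [].
  have nq : n <= q.
    have h : 2 ^ (k + k) <= 2 ^ (3 * k) by rewrite leq_exp2l //; lia.
    move: lZ; rewrite cardsD (setIidPr ZX) cZ => lZ.
    rewrite -(leq_pmul2l k0); lia.
  apply: hcS ZX _; apply: (hc_le nq); rewrite -[q]muln1.
  by apply: hc_part pZ _ => S _ [cS eS]; apply: hc_clique; rewrite ?eS.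
right; have [Q QY pQ] := part_take pY (ltn0Sn q).
have [cQ eQ] : kclique true k Q.
  inversion pQ as [|n0 X0 S0 PS dS pX e1 e2]; subst.
  by inversion pX; subst; rewrite setU0.
have [|R [RW [cR eR] hQR]] := homog_clique col_sym (Q := Q) (X := X :\: Y) (s := k) (c := true) _ fW.
  by apply: leq_trans hW; rewrite leq_exp2l // eQ; lia.
have := card_side true hQR; rewrite eQ [~~ true]/= => hs.
have dQR : [disjoint Q & R].
  move: RW; rewrite subsetD => /andP[_]; rewrite disjoint_sym.
  exact: disjointWl.
have RX : R \subset X by apply: subset_trans RW (subsetDl _ _).
have QX : Q \subset X by apply: subset_trans QY YX.
have [ha|ha] := leqP a #|side col false Q R|.
  have [|R' RR eR'] := @subset_of_card _ R d; first by rewrite eR leq_subr.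
  exists (Q :|: R'); split.
  - by rewrite subUset QX (subset_trans RR).
  - by rewrite cardsU disjoint_setI0 ?cards0 ?subn0 ?eQ ?eR' //; apply: disjointWr dQR.
  - case; first by apply: hcS (subsetUl _ _) _; apply: hc_clique; rewrite ?eQ.
    apply: (@hcS _ _ (side col false Q R :|: R')); first by apply: setSU; apply: side_sub.
    apply: hc_alpha => //; first by rewrite eR'.
    + exact: cliqueS cR.
    + by apply: joinedS (@side_joined _ col false Q R).
    + by apply: disjointW dQR => //; apply: side_sub.
have [|D DS eD] := @subset_of_card _ (side col true Q R) d; first by have := kE; lia.
have DQ := subset_trans DS (side_sub _ _ _ _).
exists (R :|: D); split.
- by rewrite subUset RX (subset_trans DQ).
- rewrite cardsU disjoint_setI0 ?cards0 ?subn0 ?eR ?eD //.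
  by rewrite disjoint_sym; apply: disjointWl dQR.
- case; last by apply: hcS (subsetUl _ _) _; apply: hc_clique; rewrite ?eR.
  apply: hc_alpha.
  + by rewrite eR; have := kE; lia.
  + by rewrite eD.
  + by apply: cliqueS cQ.
  + by apply: joinedC => //; apply: joinedS (@side_joined _ col true Q R).
  + by rewrite disjoint_sym; apply: disjointWl dQR.
Qed.

(** Ties are removed one at a time; each supplies a copy in whichever colour wins in the rest. *)
Lemma hc_large n X : (k + d) * n + 2 ^ (3 * k) <= #|X| -> exists c, has_copies c n X.
Proof.
elim: n X => [|n IH] X hX; first by exists true; apply: hc0.
have [|//|[S [SX eS hS]]] := @copies_or_tie n.+1 X.
  by apply: leq_trans hX; rewrite leq_add2r leq_mul2r leq_addr orbT.
have [|c hcn] := IH (X :\: S).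
  by rewrite cardsD (setIidPr SX) eS; move: hX; rewrite mulnS; lia.
exists c; rewrite -addn1; apply: (hc_add hcn (hS c)) => //; last exact: subsetDl.
exact: disjDl.
Qed.

(* The union of two ties has [2 (k + d)] vertices and contains two copies in each
   colour; an economical set does better than such unions of ties. *)
Definition economical S := exists p, [/\ 0 < p, p <= k, #|S| < (k + d) * p & forall c, has_copies c p S].

(** These [2 (k + d) - 1] vertices carry two copies in each colour. In [c] they are [A1], and [A2]
    with [B]. In [~~ c], [d] vertices of [B] serve [a] vertices of [A1], and the other [k - 1] serve
    one further vertex of [A1]. *)
Lemma economical_cross c A1 A2 B : 1 < k -> kclique c k A1 -> kclique c d A2 ->
  kclique (~~ c) (k + d).-1 B -> joined (~~ c) A1 B -> joined c A2 B ->
  [disjoint A1 & A2] -> [disjoint A1 & B] -> [disjoint A2 & B] ->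
  economical (A1 :|: A2 :|: B).
Proof.
move=> k1 [c1 e1] [c2 e2] [cB eB] j1 j2 d12 d1 d2.
have d0 := d_gt0; have kE := kE; have a0 := a_gt0.
exists 2; split=> //.
  rewrite (leq_ltn_trans (leq_card_setU _ _)) // eB.
  by have := cardsU_le A1 A2; rewrite e1 e2; lia.
have hcc : has_copies c 2 (A1 :|: A2 :|: B).
  apply: (@hc_add c 1 1 A1 (B :|: A2)).
  - by apply: hc_clique; rewrite ?e1.
  - apply: hc_alpha; rewrite ?eB ?e2 //; first by lia.
    + exact: joinedC.
    + by rewrite disjoint_sym.
  - by rewrite disjUr d1.
  - by rewrite -setUA subsetUl.
  - by rewrite -setUA setUC subsetUr.
have hcn : has_copies (~~ c) 2 (A1 :|: A2 :|: B).
  have [|I IA eI] := @subset_of_card _ A1 a; first by rewrite e1; lia.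
  have [|J JB eJ] := @subset_of_card _ B d; first by rewrite eB; lia.
  apply: (@hc_add _ 1 1 (I :|: J) (A1 :\: I :|: B :\: J)).
  - apply: hc_alpha; rewrite ?eI ?eJ //.
    + exact: cliqueS cB.
    + exact: joinedS j1.
    + exact: disjointW d1.
  - apply: hc_one.
    + by rewrite cardsD (setIidPr IA) e1 eI; lia.
    + by rewrite cardsD (setIidPr JB) eB eJ; lia.
    + by apply: cliqueS cB; apply: subsetDl.
    + by apply: joinedS j1; apply: subsetDl.
    + by apply: disjointW d1; apply: subsetDl.
  - rewrite disjUl !disjUr; apply/andP; split; apply/andP; split.
    + exact: disjDr.
    + by apply: disjointW d1 => //; apply: subsetDl.
    + by rewrite disjoint_sym; apply: disjointW d1 => //; apply: subsetDl.
    + exact: disjDr.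
  - by rewrite subUset (subset_trans IA) ?(subset_trans JB) ?subsetUr // -setUA subsetUl.
  - rewrite subUset (subset_trans (subsetDl _ _)) ?(subset_trans (subsetDl _ _)) //.
      by rewrite subsetUr.
    by rewrite -setUA subsetUl.
by move: hcc hcn; case: (c) => ? ? [].
Qed.

(** Again [2 (k + d) - 1] vertices. In [c] the copies are [A] and [R]. In [~~ c], [A] without [x]
    uses [d] vertices of [B], and [R] uses the other [d - 1] with [x] in place of the missing
    one. *)
Lemma economical_star c x (A R B : {set T}) : 1 < k -> x \in A -> kclique c k A -> kclique c k R ->
  kclique (~~ c) (d + d).-1 B -> joined (~~ c) [set x] R ->
  joined (~~ c) A B -> joined (~~ c) R B ->
  [disjoint A & R] -> [disjoint A & B] -> [disjoint R & B] ->
  economical (A :|: R :|: B).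
Proof.
move=> k1 xA [c1 e1] [c2 e2] [cB eB] jx j1 j2 d12 d1 d2.
have d0 := d_gt0; have kE := kE; have a0 := a_gt0.
exists 2; split=> //.
  rewrite (leq_ltn_trans (leq_card_setU _ _)) // eB.
  by have := cardsU_le A R; rewrite e1 e2; lia.
have hcc : has_copies c 2 (A :|: R :|: B).
  apply: (@hc_add c 1 1 A R) => //.
  - by apply: hc_clique; rewrite ?e1.
  - by apply: hc_clique; rewrite ?e2.
  - by rewrite -setUA subsetUl.
  - by rewrite -setUA setUCA subsetUl.
have hcn : has_copies (~~ c) 2 (A :|: R :|: B).
  have [|J JB eJ] := @subset_of_card _ B d; first by rewrite eB; lia.
  have xB : x \notin B by rewrite (disjointFr d1).
  have xR : x \notin R by rewrite (disjointFr d12).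
  apply: (@hc_add _ 1 1 (A :\ x :|: J) (R :|: (x |: (B :\: J)))).
  - apply: hc_alpha.
    + by move: e1; rewrite (cardsD1 x A) xA; lia.
    + by rewrite eJ.
    + exact: cliqueS cB.
    + by apply: joinedS j1 => //; apply: subsetDl.
    + by apply: disjointW d1 => //; apply: subsetDl.
  - apply: hc_alpha.
    + by rewrite e2; lia.
    + have xJ : x \notin B :\: J by rewrite inE (negbTE xB) andbF.
      by rewrite cardsU1 xJ cardsD_sub // eB eJ /=; lia.
    + apply: cliqueU => //; first exact: clique1.
        by apply: cliqueS cB; apply: subsetDl.
      by apply: joinedS j1; [rewrite sub1set|apply: subsetDl].
    + move=> y z yR /setU1P[->|]; first by rewrite col_sym; apply: jx; rewrite ?set11.
      by move=> zB; apply: j2 => //; move: zB; rewrite inE => /andP[].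
    + rewrite disjoint_sym disjUl disjoints1 xR /=.
      by rewrite disjoint_sym; apply: disjointWr d2; apply: subsetDl.
  - rewrite disjUl !disjUr; apply/andP; split; apply/andP; split.
    + by apply: disjointWl d12; apply: subsetDl.
    + apply/andP; split; first by rewrite disjoint_sym disjoints1 !inE eqxx.
      by apply: disjointW d1; apply: subsetDl.
    + by rewrite disjoint_sym; apply: disjointWr d2.
    + apply/andP; split.
        by rewrite disjoint_sym disjoints1; apply: contra xB; apply: (subsetP JB).
      exact: disjDr.
  - rewrite subUset (subset_trans (subsetDl _ _)) ?(subset_trans JB) ?subsetUr //.
    by rewrite -setUA subsetUl.
  - rewrite subUset -setUA setUCA subsetUl /= subUset sub1set !inE xA orbT /=.
    by rewrite (subset_trans (subsetDl _ _)) // setUA subsetUr.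
by move: hcc hcn; case: (c) => ? ? [].
Qed.

Lemma economical_part q X : part economical q X -> exists p,
  [/\ q <= p, p <= k * q, #|X| + q <= (k + d) * p & forall c, has_copies c p X].
Proof.
elim=> [|{}q {}X S [p [p0 pk lS hS]] dS pX [p' [h1 h2 h3 h4]]].
  by exists 0; rewrite cards0 muln0; split=> // c; apply: hc0.
exists (p + p'); split; first by lia.
- by rewrite mulnS; lia.
- by have := cardsU_le S X; rewrite mulnDr; lia.
- by move=> c; apply: hc_cat.
Qed.

(* Only boundedly many disjoint economical sets exist: otherwise the vertices that
   they save would suffice for [n] monochromatic copies. *)
Lemma economical_free n : (forall c, ~ has_copies c n setT) -> k * (2 ^ (3 * k) + 3) <= n ->
  (k + d) * n <= #|T| + 2 ->
  exists V : {set T}, (forall S, S \subset V -> ~ economical S) /\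
    (k + d) * n <= #|V| + 2 + (k + d) * (k * (2 ^ (3 * k) + 3)).
Proof.
move=> nh hn hT; set K := 2 ^ (3 * k) + 3 in hn *.
have [|q [Y [YX pY mY]]] := @part_max _ economical [set: T].
  by move=> S [p [p0 _ _ /(_ true)[f [_ fS _]]]]; apply/set0Pn;
    case/card_gt0P: (k0) => x _; exists (f (Ordinal p0) x).
exists (setT :\: Y); split; first by move=> S; apply: mY.
(* [K] disjoint economical sets save [K] vertices, which pays for the [2 ^ (3 * k)] lost in
   [hc_large] and for the 2 by which [T] may fall short of [(k + d) * n]. *)
have [Kq|qK] := leqP K q.
  have [Z ZY pZ] := part_take pY Kq.
  have [p [h1 h2 h3 h4]] := economical_part pZ.
  have pn : p <= n by apply: leq_trans h2 hn.
  have [|c hcn] := @hc_large (n - p) (setT :\: Z).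
    rewrite cardsD (setIidPr (subsetT _)) cardsT mulnBr.
    have := leq_mul (leqnn (k + d)) pn; rewrite /K in h1 h3; lia.
  case: (nh c); rewrite -(subnK pn); apply: (hc_add hcn (h4 c)); rewrite ?subsetT //.
  exact: disjDl.
have [p [h1 h2 h3 h4]] := economical_part pY.
rewrite cardsD (setIidPr (subsetT _)) cardsT.
have : (k + d) * p <= (k + d) * (k * K).
  by rewrite leq_mul2l (leq_trans h2) ?orbT // leq_mul2l (ltnW qK) orbT.
by lia.
Qed.

End Col.
End Graph.

(** * Extremal colourings contain a near-clique *)

Section Struct.
Variable H : sgraph.
Local Notation k := #|H|.
Local Notation a := (alpha H).
Local Notation d := (#|H| - alpha H).
Hypothesis k1 : 1 < k.
Hypothesis noiso : no_isolated H.
Variables (T : finType) (col : T -> T -> bool).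
Hypothesis col_sym : symmetric col.
Implicit Types (S X Y Z Q R A B V W : {set T}) (c b : bool).
Local Notation clique := (@clique T col).
Local Notation joined := (@joined T col).
Local Notation kclique := (@kclique T col).
Local Notation cfree := (@cfree T col).
Local Notation nbr := (@nbr T col).
Local Notation homogeneous := (@homogeneous T col).
Local Notation side := (@side T col).
Local Notation hc := (@has_copies H T col).
Local Notation economical := (@economical H T col).
(** The size of the cliques in homogeneous pairs: without fewer than [k] and fewer than [d]
    exceptional vertices, such a clique keeps [k + d - 1], and it splits into four [k]-cliques. *)
Local Notation m := (4 * #|H|).

Let k0 : 0 < k. Proof. exact: ltnW. Qed.
Let d0 : 0 < d. Proof. exact: d_gt0. Qed.
Let kad : k = a + d. Proof. exact: kE. Qed.
Let a0 : 0 < a. Proof. exact: a_gt0. Qed.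

Lemma side_disj c Q1 Q2 R : R != set0 ->
  [disjoint side (~~ c) Q1 R & side c Q2 R].
Proof.
case/set0Pn => r rR; rewrite -setI_eq0; apply/eqP/setP => x.
rewrite !inE; apply/negP => /andP[/andP[_ /forall_inP/(_ r rR)/eqP h1]].
by move=> /andP[_ /forall_inP/(_ r rR)/eqP h2]; move: h1; rewrite h2; case: (c).
Qed.

Lemma card_setD_large X W : 2 ^ (5 * m) <= #|W| -> #|X| <= m + m ->
  2 ^ (4 * m) <= #|W :\: X|.
Proof.
move=> hW hX; rewrite cardsD.
have := subset_leq_card (subsetIr W X).
have := ltn_expl m (isT : 1 < 2); move: hW; have -> : 5 * m = 4 * m + m by plia.
rewrite expnD; have : 2 <= 2 ^ (4 * m) by rewrite -{1}(expn1 2) leq_exp2l //; plia.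
by move: (2 ^ (4 * m)) (2 ^ m) => u v; nia.
Qed.

(** * Homogeneous pairs of cliques in a set without economical subsets *)

Section Uneconomical.
Variable V : {set T}.
Hypothesis noecon : forall S, S \subset V -> ~ economical S.

(** The two sides and [k + d - 1] vertices of [R] would form the configuration of
    [economical_cross]. [Q1] and [Q2] may coincide, as their opposite sides towards a nonempty [R]
    are disjoint. *)
Lemma no_cross c Q1 Q2 R : Q1 \subset V -> Q2 \subset V -> R \subset V ->
  clique c Q1 -> clique c Q2 -> clique (~~ c) R -> (k + d).-1 <= #|R| ->
  [disjoint Q1 & R] -> [disjoint Q2 & R] ->
  k <= #|side (~~ c) Q1 R| -> d <= #|side c Q2 R| -> False.
Proof.
move=> Q1V Q2V RV c1 c2 cR eR d1 d2 /subset_of_card[A1 A1s e1] /subset_of_card[A2 A2s e2].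
have [B BR eB] := subset_of_card eR.
have A1Q := subset_trans A1s (side_sub _ _ _ _).
have A2Q := subset_trans A2s (side_sub _ _ _ _).
apply: (@noecon (A1 :|: A2 :|: B)).
  by rewrite !subUset (subset_trans A1Q) // (subset_trans A2Q) // (subset_trans BR).
apply: (@economical_cross _ _ _ col_sym k0 noiso c) => //.
- by split=> //; apply: cliqueS c1.
- by split=> //; apply: cliqueS c2.
- by split=> //; apply: cliqueS cR.
- by apply: joinedS (@side_joined _ col (~~ c) Q1 R).
- by apply: joinedS (@side_joined _ col c Q2 R).
- apply: disjointW A1s A2s _; apply: side_disj.
  by rewrite -card_gt0; plia.
- exact: disjointW d1.
- exact: disjointW d2.
Qed.

(** At least [k + d - 1] vertices of [Q] see [R1] in [c] and [R2] in [~~ c]; with the colours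
    exchanged they take the place of [R] in [no_cross]. So the majority colour at [Q] does not
    depend on the opposite clique. *)
Lemma no_cross_homog c Q R1 R2 : Q \subset V -> R1 \subset V -> R2 \subset V ->
  clique c Q -> m <= #|Q| -> clique (~~ c) R1 -> clique (~~ c) R2 ->
  k <= #|R1| -> k <= #|R2| -> homogeneous Q R1 -> homogeneous Q R2 ->
  [disjoint Q & R1] -> [disjoint Q & R2] ->
  #|side (~~ c) Q R1| < k -> #|side c Q R2| < d -> False.
Proof.
move=> QV R1V R2V cQ mQ c1 c2 e1 e2 h1 h2 d1 d2 s1 s2.
pose B := side c Q R1 :&: side (~~ c) Q R2.
have BQ : B \subset Q by apply: subset_trans (subsetIl _ _) (side_sub _ _ _ _).
have eB : (k + d).-1 <= #|B|.
  have := card_side c h1; have := card_side c h2.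
  have := cardsUI (side c Q R1) (side (~~ c) Q R2); rewrite -/B.
  have : #|side c Q R1 :|: side (~~ c) Q R2| <= #|Q|.
    by apply: subset_leq_card; rewrite subUset !side_sub.
  plia.
apply: (@no_cross (~~ c) R1 R2 B) => //.
- exact: subset_trans QV.
- by rewrite negbK; apply: cliqueS cQ.
- by rewrite disjoint_sym; apply: disjointWl d1.
- by rewrite disjoint_sym; apply: disjointWl d2.
- apply: leq_trans e1 _; apply: subset_leq_card; apply/subsetP => x xR.
  rewrite negbK inE xR; apply/forall_inP => y /setIP[yB _].
  by rewrite col_sym; apply/eqP; apply: (@side_joined _ col c Q R1).
- apply: leq_trans (leq_trans (leq_subr _ _) e2) _.
  apply: subset_leq_card; apply/subsetP => x xR.
  rewrite inE xR; apply/forall_inP => y /setIP[_ yB].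
  by rewrite col_sym; apply/eqP; apply: (@side_joined _ col (~~ c) Q R2).
Qed.

(* In a homogeneous pair of a [c]-clique [Q] and an opposite clique [R] in [W],
   [sparse_side c c d W] says that most edges have the colour of [R], and
   [sparse_side c (~~ c) k W] that most have the colour of [Q]. *)
Definition sparse_side c b s W := forall Q R, Q \subset V -> kclique c m Q ->
  R \subset W -> kclique (~~ c) m R -> [disjoint Q & R] -> homogeneous Q R ->
  #|side b Q R| < s.

Lemma sparse_side_or c W : W \subset V -> cfree c m W -> 2 ^ (5 * m) <= #|W| ->
  sparse_side c c d W \/ sparse_side c (~~ c) k W.
Proof.
move=> WV fW hW.
have [|h] := EM (sparse_side c (~~ c) k W); [by right|left].
have [Q1 [R1 [[Q1V [c1 e1] R1W [cR1 eR1] [d1 h1]] s1]]] : exists Q1 R1,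
    [/\ Q1 \subset V, kclique c m Q1, R1 \subset W, kclique (~~ c) m R1 &
     [disjoint Q1 & R1] /\ homogeneous Q1 R1] /\ k <= #|side (~~ c) Q1 R1|.
  apply: contrapT => hn; apply: h => Q R ? ? ? ? ? ?; rewrite ltnNge.
  by apply/negP => h; apply: hn; exists Q, R.
have R1V := subset_trans R1W WV.
have b1 : #|side c Q1 R1| < d.
  by rewrite ltnNge; apply/negP; apply: (@no_cross c Q1 Q1 R1) => //; plia.
move=> Q R QV [cQ eQ] RW [cR eR] dQR hQR; rewrite ltnNge; apply/negP => bQ.
have RV := subset_trans RW WV.
(* A clique [R'] homogeneous towards [Q] and [Q1] at once carries the majority colour of the pair
   [Q1], [R1] over to [Q]. *)
have [||R' [R'W [cR' eR'] hR']] :=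
    @homog_clique _ _ col_sym c m (Q :|: Q1) (W :\: (Q :|: Q1)).
- have hu : #|Q :|: Q1| <= m + m by rewrite -{1}eQ -e1 cardsU_le.
  by apply: leq_trans (card_setD_large hW hu); rewrite leq_exp2l //; plia.
- by apply: cfreeS fW; apply: subsetDl.
have R'V : R' \subset V by rewrite (subset_trans R'W) // (subset_trans _ WV) // subsetDl.
have dR' : [disjoint Q :|: Q1 & R'].
  by rewrite disjoint_sym; apply: disjointWl (disjDl W _).
move: dR'; rewrite disjUl => /andP[dQ dQ1].
have hQ : homogeneous Q R' by apply: homogS hR'; apply: subsetUl.
have hQ1 : homogeneous Q1 R' by apply: homogS hR'; apply: subsetUr.
have g1 : k <= #|side (~~ c) Q1 R'|.
  rewrite leqNgt; apply/negP => lt.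
  by apply: (@no_cross_homog c Q1 R' R1) => //; plia.
have bQ' : #|side c Q R'| < d.
  by rewrite ltnNge; apply/negP; apply: (@no_cross c Q1 Q R') => //; plia.
have gQ : #|side (~~ c) Q R| < k.
  by rewrite ltnNge; apply/negP => gQ; apply: (@no_cross c Q Q R) => //; plia.
by apply: (@no_cross_homog c Q R R') => //; plia.
Qed.

(** Homogeneity is directed, so one pair is not enough: [R] is chosen for a clique [Q] of [W'], then
    a second clique [Q2] of [W'] for [R]. The part of [R] that sees [Q2] in [~~ c] still has [d]
    vertices of [Q] joined to it in [c], against [no_cross]. *)
Lemma sparse_side_not_both c W W' : W \subset V -> W' \subset V -> cfree c m W ->
  cfree (~~ c) m W' -> 2 ^ (5 * m) <= #|W| -> 2 ^ (5 * m) <= #|W'| ->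
  sparse_side c (~~ c) k W -> sparse_side (~~ c) c k W' -> False.
Proof.
move=> WV W'V fW fW' hW hW' g g'.
have [|Q QW'] := @ramsey_sub _ _ col_sym _ m m _ _ fW'.
  by apply: leq_trans hW'; rewrite leq_exp2l //; plia.
rewrite negbK => -[cQ eQ].
have QV := subset_trans QW' W'V.
have [||R [RW [cR eR] hQR]] := @homog_clique _ _ col_sym c m Q (W :\: Q).
- apply: leq_trans (@card_setD_large Q W hW _); last by plia.
  by rewrite leq_exp2l // eQ; plia.
- by apply: cfreeS fW; apply: subsetDl.
have RV : R \subset V by rewrite (subset_trans RW) // (subset_trans _ WV) // subsetDl.
have dQR : [disjoint Q & R] by rewrite disjoint_sym; apply: disjointWl (disjDl W _).
have s1 : #|side (~~ c) Q R| < k.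
  by apply: g => //; apply: subset_trans RW (subsetDl _ _).
have [||Q2 [Q2W [cQ2 eQ2] hRQ]] := @homog_clique _ _ col_sym (~~ c) m R (W' :\: (R :|: Q)).
- apply: leq_trans (@card_setD_large (R :|: Q) W' hW' _).
    by rewrite leq_exp2l // eR; plia.
  by rewrite -{1}eR -eQ cardsU_le.
- by apply: cfreeS fW'; apply: subsetDl.
rewrite negbK in cQ2.
have Q2V : Q2 \subset V by rewrite (subset_trans Q2W) // (subset_trans _ W'V) // subsetDl.
have : [disjoint R :|: Q & Q2] by rewrite disjoint_sym; apply: disjointWl (disjDl W' _).
rewrite disjUl => /andP[dRQ2 dQQ2].
have s2 : #|side c R Q2| < k.
  have := g' R Q2 RV _ (subset_trans Q2W (subsetDl _ _)).
  by rewrite negbK; apply.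
have h1 := card_side c hQR; have h2 := card_side c hRQ.
pose B := side (~~ c) R Q2.
have BR : B \subset R := side_sub _ _ _ _.
apply: (@no_cross c Q2 Q B) => //.
- exact: subset_trans RV.
- exact: cliqueS cR.
- by rewrite /B; plia.
- by rewrite disjoint_sym; apply: disjointWl dRQ2.
- by apply: disjointWr dQR.
- have : m <= #|side (~~ c) Q2 B|; last by plia.
  rewrite -eQ2; apply: subset_leq_card; apply/subsetP => x xQ.
  rewrite inE xQ; apply/forall_inP => y yB.
  by rewrite col_sym; apply/eqP; apply: (@side_joined _ col (~~ c) R Q2).
- have : #|side c Q R| <= #|side c Q B|; last by plia.
  apply: subset_leq_card; apply/subsetP => x; rewrite !inE => /andP[->] /=.
  by move/forall_inP => h; apply/forall_inP => y yB; apply: h; apply: (subsetP BR).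
Qed.

Lemma max_pack c n : ~ hc c n setT -> k * n + 2 ^ (6 * m) <= #|V| ->
  exists A g, [/\ A \subset V, part (kclique c m) g A, cfree c m (V :\: A),
    #|A| <= k * n & 2 ^ (6 * m) <= #|V :\: A|].
Proof.
move=> nh hV.
have [|g [A [AV pA mA]]] := @part_max _ (kclique c m) V.
  by move=> S [_ eS]; rewrite -card_gt0 eS; plia.
have cA : #|A| = g * m by apply: part_card pA => S [].
have lA : #|A| <= k * n.
  rewrite leqNgt; apply/negP => lt; apply: nh.
  have /hc_le : n <= g * 4 by rewrite leqNgt; apply/negP; move: lt; rewrite cA; nia.
  apply; apply: hcS (subsetT A) _; apply: hc_part pA _ => S _ [cS eS].
  rewrite -[4]muln1; apply: (@hc_part _ _ _ _ _ (kclique c k)).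
    by apply: part_clique => //; rewrite eS.
  by move=> S' _ [cS' eS']; apply: hc_clique => //; rewrite eS'.
exists A, g; split=> //.
by rewrite cardsD_sub //; plia.
Qed.

Lemma sparse_side_ex n : (forall c, ~ hc c n setT) -> k * n + 2 ^ (6 * m) <= #|V| ->
  exists c A g, [/\ A \subset V, part (kclique c m) g A, cfree c m (V :\: A),
    2 ^ (6 * m) <= #|V :\: A| & #|A| <= k * n /\ sparse_side c c d (V :\: A)].
Proof.
move=> nh hV.
have [A [g [AV pA fW lA hW]]] := max_pack (nh true) hV.
have [A' [g' [AV' pA' fW' lA' hW']]] := max_pack (nh false) hV.
have e56 : 2 ^ (5 * m) <= 2 ^ (6 * m) by rewrite leq_exp2l //; plia.
have [|h] := sparse_side_or (subsetDl _ _) fW (leq_trans e56 hW).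
  by move=> h; exists true, A, g.
have [|h'] := sparse_side_or (subsetDl _ _) fW' (leq_trans e56 hW').
  by move=> h'; exists false, A', g'.
by case: (sparse_side_not_both (subsetDl _ _) (subsetDl _ _) fW fW' (leq_trans e56 hW) (leq_trans e56 hW') h h').
Qed.

(** * A clique packing joined to the remainder mostly in the opposite colour *)

Section SparseSide.
Variables (c : bool) (A W : {set T}).
Hypothesis AV : A \subset V.
Hypothesis WV : W \subset V.
Hypothesis dAW : [disjoint A & W].
Hypothesis fW : cfree c m W.
Hypothesis sparseW : sparse_side c c d W.

(** At most [d - 1] vertices of [S] see [R] in [c], and [k - 1 - (d - 1) = a]. Hence a [k]-clique
    that has given up one vertex still carries a [~~ c]-copy with [d] vertices of [W]. *)
Lemma sparse_tie S (G X : {set T}) : S \subset A -> kclique c m S -> G \subset S -> k.-1 <= #|G| ->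
  X \subset W -> 2 ^ (3 * m) <= #|X| ->
  exists R I : {set T}, [/\ R \subset X, kclique (~~ c) d R, I \subset G, #|I| = a &
    joined (~~ c) I R].
Proof.
move=> SA [cS eS] GS kG XW hX.
have [||R [RX [cR eR] hR]] := @homog_clique _ _ col_sym c m S X.
- by apply: leq_trans hX; rewrite leq_exp2l // eS; plia.
- exact: cfreeS fW.
have dSR : [disjoint S & R] by apply: disjointW dAW => //; apply: subset_trans XW.
have b : #|side c S R| < d.
  apply: sparseW => //; first exact: subset_trans AV.
  exact: subset_trans XW.
have := card_side c (homogS GS hR).
have : #|side c G R| <= #|side c S R|.
  apply: subset_leq_card; apply/subsetP => x; rewrite !inE => /andP[/(subsetP GS)->].
  by [].
move=> h1 h2; have [|I IG eI] := @subset_of_card _ (side (~~ c) G R) a; first by plia.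
have [|R' RR eR'] := @subset_of_card _ R d; first by rewrite eR; plia.
exists R', I; split=> //.
- exact: subset_trans RX.
- by split=> //; apply: cliqueS cR.
- by apply: subset_trans IG (side_sub _ _ _ _).
- by apply: joinedS (@side_joined _ col (~~ c) G R).
Qed.

Lemma match_pieces (P : {set T} -> Prop) g e q r X : part P g X -> [disjoint X & W] ->
  (forall S Y, P S -> S \subset X -> Y \subset W -> e + r <= #|Y| ->
     exists2 Z : {set T}, Z \subset Y & #|Z| = e /\ hc (~~ c) q (S :|: Z)) ->
  forall Y, Y \subset W -> g * e + r <= #|Y| ->
     exists2 Z : {set T}, Z \subset Y & #|Z| = g * e /\ hc (~~ c) (g * q) (X :|: Z).
Proof.
elim=> [|{}g {}X S PS dS pX IH] dX h Y YW hY.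
  by exists set0; [exact: sub0set|split; [exact: cards0|exact: hc0]].
move: dX; rewrite disjUl => /andP[dSW dXW].
have [|Z ZY [eZ hZ]] := h S Y PS (subsetUl _ _) YW; first by plia.
have [|||Z' Z'Y [eZ' hZ']] := IH dXW _ (Y :\: Z).
- move=> S' Y' PS' S'X; apply: h => //; exact: subset_trans S'X (subsetUr _ _).
- exact: subset_trans (subsetDl _ _) YW.
- by rewrite cardsD_sub // eZ; plia.
have dZ : [disjoint Z & Z'].
  by rewrite disjoint_sym; apply: disjointWl Z'Y (disjDl _ _).
have Z'Y' := subset_trans Z'Y (subsetDl _ _).
exists (Z :|: Z'); first by rewrite subUset ZY.
split; first by rewrite cardsU_disj // eZ eZ'; plia.
rewrite mulSn setUACA; apply: hc_cat => //.
rewrite disjUl !disjUr dS dZ /=; apply/andP; split.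
  by apply: disjointWr dSW; apply: subset_trans YW.
rewrite andbT disjoint_sym; apply: disjointWr dXW; exact: subset_trans YW.
Qed.

Lemma sparse_hc g Y : part (kclique c m) g A -> Y \subset W ->
  g * (4 * d) + 2 ^ (3 * m) <= #|Y| ->
  exists2 Z : {set T}, Z \subset Y & #|Z| = g * (4 * d) /\ hc (~~ c) (g * 4) (A :|: Z).
Proof.
move=> pA YW hY; refine (@match_pieces _ g (4 * d) 4 (2 ^ (3 * m)) A pA dAW _ Y YW hY) => S X kS SA XW hX.
have [cS eS] := kS.
apply: (@match_pieces (kclique c k) 4 d 1 (2 ^ (3 * m)) S (part_clique cS eS)
  (disjointWl SA dAW) _ X XW hX).
move=> G Y' [_ eG] GS YW' hY'.
have [||R [I [RY [cR eR] IG eI jI]]] := @sparse_tie S G Y' SA kS GS _ YW'.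
- by rewrite eG leq_pred.
- by plia.
exists R => //; split=> //; apply: hcS (setSU R IG) _.
apply: hc_alpha => //; rewrite ?eI ?eR //.
apply: disjointW dAW; last exact: subset_trans YW'.
by apply: subset_trans IG (subset_trans GS SA).
Qed.

(** Each [k]-clique of [A] makes a [~~ c]-copy with [d] vertices of [W], and the rest of [W] is
    tiled by [~~ c]-cliques of size [k]. Since fewer than [n] copies arise in all, counting vertices
    bounds [d * (n - g * 4)] by [K + 2 ^ (4 * m)]. *)
Lemma sparse_large n g K : (forall c, ~ hc c n setT) -> part (kclique c m) g A ->
  W = V :\: A -> (k + d) * n <= #|V| + K ->
  k * n <= #|A| + k * (K + 2 ^ (4 * m)).
Proof.
move=> nh pA eW hV.
have cA : #|A| = g * m by apply: part_card pA => S [].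
have gn : g * 4 <= n.
  rewrite leqNgt; apply/negP => lt; apply: (nh c); apply: hc_le (ltnW lt) _.
  apply: hcS (subsetT A) _; apply: hc_part pA _ => S _ [cS eS].
  rewrite -[4]muln1; apply: (@hc_part _ _ _ _ _ (kclique c k)).
    by apply: part_clique => //; rewrite eS.
  by move=> S' _ [cS' eS']; apply: hc_clique => //; rewrite eS'.
have cW : #|V| = #|A| + #|W|.
  by rewrite eW cardsD_sub // subnKC // subset_leq_card.
have e34 : 2 ^ (3 * m) <= 2 ^ (4 * m) by rewrite leq_exp2l //; plia.
have [h|h] := leqP (g * (4 * d) + 2 ^ (3 * m)) #|W|; last first.
  have : g * (4 * d) <= d * n by nia.
  rewrite mulnDl in hV.
  have : K + 2 ^ (4 * m) <= k * (K + 2 ^ (4 * m)) by rewrite leq_pmull.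
  plia.
have [Z ZW [eZ hZ]] := sparse_hc pA (subxx W) h.
have [q [Y [YW pY lY]]] := greedy col_sym k0 (cfreeS (subsetDl W Z) fW).
have cY : #|Y| = q * k by apply: part_card pY => S [].
have lt : g * 4 + q < n.
  rewrite ltnNge; apply/negP => le; apply: (nh (~~ c)); apply: hc_le le _.
  apply: hcS (subsetT (A :|: Z :|: Y)) _; apply: hc_cat => //.
    rewrite -[q]muln1; apply: hc_part pY _ => S _ [cS eS].
    by apply: hc_clique; rewrite ?eS.
  rewrite disjUl; apply/andP; split.
    by apply: disjointWr dAW; apply: subset_trans YW (subsetDl _ _).
  by rewrite disjoint_sym; apply: disjointWl YW (disjDl _ _).
have : #|W| = g * (4 * d) + q * k + #|W :\: Z :\: Y|.
  by rewrite (cardsD_sub YW) (cardsD_sub ZW) eZ cY; move: (subset_leq_card YW);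
    rewrite (cardsD_sub ZW) eZ cY; move: (subset_leq_card ZW); rewrite eZ; plia.
have e4 : 2 ^ (m + k) <= 2 ^ (4 * m) by rewrite leq_exp2l //; plia.
move=> eW'; have {}lY : #|W :\: Z :\: Y| <= 2 ^ (4 * m) by plia.
move: hV; rewrite cW cA eW'.
move: #|W :\: Z :\: Y| (2 ^ (4 * m)) lY => u v uv hV.
have : d * (n - g * 4) <= K + v.
  have : k * (g * 4) + d * (g * 4) + k * (n - g * 4) = k * n + d * (g * 4) by nia.
  have : q * k <= k * (n - g * 4) by nia.
  nia.
move=> h2; have : n - g * 4 <= K + v by nia.
nia.
Qed.

(* A [~~ c]-clique inside [X] meets every [c]-clique of the packing at most once,
   so each of its vertices extends to a [c]-clique of size [k], whose [k - 1] new
   vertices still form a tie with [d] vertices of [W]. *)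
Lemma sparse_transversal g X : part (kclique c m) g X -> X \subset A ->
  forall Q' Q'' Y, Q'' \subset Q' -> Q' \subset X -> clique (~~ c) Q' ->
    Y \subset W -> d * #|Q''| + 2 ^ (3 * m) <= #|Y| ->
  exists G Z : {set T}, [/\ Q' \subset G, G \subset X, #|G| = k * #|Q'| /\ hc c #|Q'| G,
    Z \subset Y /\ #|Z| = d * #|Q''| & hc (~~ c) #|Q''| ((G :\: Q') :|: Z)].
Proof.
elim=> [|{}g {}X S [cS eS] dS pX IH] XA Q' Q'' Y QQ QX cQ YW hY.
  move: QX QQ; rewrite subset0 => /eqP->; rewrite subset0 => /eqP->.
  exists set0, set0; rewrite !sub0set cards0 !muln0; split=> //.
  - by split=> //; exact: hc0.
  - exact: hc0.
move: XA; rewrite subUset => /andP[SA XA].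
have [e0|/set0Pn[q]] := eqVneq (Q' :&: S) set0.
  have QX' : Q' \subset X.
    apply/subsetP => x xQ; have /setUP[xS|//] := subsetP QX _ xQ.
    have : x \in Q' :&: S by rewrite inE xQ.
    by rewrite e0 inE.
  have [G [Z [QG GX hG hZ hn]]] := IH XA Q' Q'' Y QQ QX' cQ YW hY.
  by exists G, Z; split=> //; apply: subset_trans GX (subsetUr _ _).
case/setIP=> qQ qS.
have QX' : Q' :\ q \subset X.
  apply/subsetP => x; rewrite !inE => /andP[xq xQ].
  have /setUP[xS|//] := subsetP QX _ xQ.
  have := cQ x q xQ qQ xq; rewrite (cS x q xS qS xq).
  by case: (c).
have [G0 G0S eG0] : exists2 G0 : {set T}, G0 \subset S :\ q & #|G0| = k.-1.
  by apply: subset_of_card; move: eS; rewrite (cardsD1 q S) qS; plia.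
have qG0 : q \notin G0 by apply/negP => /(subsetP G0S); rewrite !inE eqxx.
have G0S' := subset_trans G0S (subsetDl _ _).
have eQ' : #|Q'| = (#|Q' :\ q|).+1 by rewrite (cardsD1 q Q') qQ.
have QQ1 : Q'' :\ q \subset Q' :\ q by apply: setSD.
have [|G [Z [QG GX [eG hG] [ZY eZ] hn]]] :=
    IH XA (Q' :\ q) (Q'' :\ q) Y QQ1 QX' (cliqueS (subsetDl _ _) cQ) YW.
  have : #|Q'' :\ q| <= #|Q''| by apply: subset_leq_card; apply: subsetDl.
  by move=> h; apply: leq_trans hY; rewrite leq_add2r leq_mul2l h orbT.
have dGS : [disjoint q |: G0 & G].
  by apply: disjointW dS => //; rewrite subUset sub1set qS.
have qG : q \notin G by apply: contraFN (disjointFr dS qS); apply: (subsetP GX).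
have cS0 : kclique c k (q |: G0).
  split; last by rewrite cardsU1 qG0 eG0; plia.
  by apply: cliqueS cS; rewrite subUset sub1set qS.
have eD : (q |: G0 :|: G) :\: Q' = G0 :|: (G :\: (Q' :\ q)).
  apply/setP => x; rewrite !inE; case: eqP => [->|_] /=.
    by rewrite qQ (negbTE qG0) (negbTE qG).
  case: (boolP (x \in G0)) => //= xG; rewrite andbT; apply/negP => xQ.
  have xS := subsetP G0S' _ xG.
  have xq : x != q by apply: contraNneq qG0 => <-.
  by have := cQ x q xQ qQ xq; rewrite (cS x q xS qS xq); case: (c).
have dG0G : [disjoint G0 & G] by apply: disjointWl dGS; apply: subsetUr.
have hG' : hc c #|Q'| (q |: G0 :|: G).
  rewrite eQ' -add1n; apply: hc_cat => //; case: cS0 => ? e.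
  by apply: hc_clique; rewrite ?e.
have eG' : #|q |: G0 :|: G| = k * #|Q'|.
  by rewrite cardsU_disj // eG (proj2 cS0) eQ'; plia.
have sG : Q' \subset q |: G0 :|: G.
  apply/subsetP => x xQ; rewrite !inE; case: (eqVneq x q) => //= xq.
  by rewrite (subsetP QG) ?orbT // !inE xq.
have sX : q |: G0 :|: G \subset S :|: X.
  by apply: setUSS => //; rewrite subUset sub1set qS.
have [qQ''|qQ''] := boolP (q \in Q''); last first.
  have e : Q'' :\ q = Q'' by apply/setDidPl; rewrite disjoint_sym disjoints1.
  rewrite e in eZ hn.
  exists (q |: G0 :|: G), Z; split=> //.
  apply: hcS hn; rewrite eD; apply: setSU; exact: subsetUr.
have eQ'' : #|Q''| = (#|Q'' :\ q|).+1 by rewrite (cardsD1 q Q'') qQ''.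
have [||R [I [RZ [cR eR] IG eI jI]]] :=
    @sparse_tie S G0 (Y :\: Z) SA (conj cS eS) G0S' _ (subset_trans (subsetDl _ _) YW).
- by rewrite eG0.
- by rewrite cardsD_sub // eZ; move: hY; rewrite eQ''; plia.
have RY := subset_trans RZ (subsetDl _ _).
have dZR : [disjoint Z & R] by rewrite disjoint_sym; apply: disjointWl RZ (disjDl _ _).
exists (q |: G0 :|: G), (R :|: Z); split=> //.
  split; first by rewrite subUset RY.
  by rewrite cardsU_disj 1?disjoint_sym // eR eZ eQ''; plia.
rewrite eQ'' -add1n eD setUACA; apply: hc_cat => //.
  apply: hcS (setSU R IG) _; apply: hc_alpha => //; rewrite ?eI ?eR //.
  by apply: disjointW dAW; [exact: subset_trans IG (subset_trans G0S' SA)|exact: subset_trans YW].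
have dAR : forall X0, X0 \subset A -> [disjoint X0 & R].
  by move=> X0 h; apply: disjointW dAW => //; apply: subset_trans YW.
rewrite disjUl !disjUr; apply/andP; split; apply/andP; split.
- by apply: disjointWr dG0G; apply: subsetDl.
- apply: disjointW dAW; first exact: subset_trans SA.
  exact: subset_trans YW.
- rewrite disjoint_sym; apply: dAR; apply: subset_trans (subsetDl _ _) _.
  exact: subset_trans XA.
- by rewrite disjoint_sym.
Qed.

(** A clique [Q] would give [k] copies in each colour: in [c] on the [k * k] vertices of [G], in
    [~~ c] on [Q] itself and on [k - 1] pieces of the rest. Those pieces need only [d * k.-1]
    vertices of [W], a saving of [d]. This is the case for which [economical] admits [p] up to
    [k]. *)
Lemma sparse_no_clique g : part (kclique c m) g A -> 2 ^ (5 * m) <= #|W| ->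
  cfree (~~ c) k A.
Proof.
move=> pA hW Q QA [cQ eQ].
have [q qQ] : exists q, q \in Q by apply/set0Pn; rewrite -card_gt0 eQ.
have e1 : #|Q :\ q| = k.-1 by move: eQ; rewrite (cardsD1 q Q) qQ; plia.
have [|G [Z [QG GA [eG hG] [ZW eZ] hn]]] :=
    @sparse_transversal _ _ pA (subxx A) Q (Q :\ q) W (subsetDl _ _) QA cQ (subxx W).
  apply: leq_trans hW; rewrite e1.
  have -> : 5 * m = 3 * m + 2 * m by plia.
  rewrite (expnD 2 (3 * m)); have := ltn_expl (2 * m) (isT : 1 < 2).
  have : d * k.-1 <= 2 ^ (3 * m).
    apply: (@leq_trans (2 ^ k * 2 ^ k)).
      by apply: leq_mul; apply: leq_trans (ltnW (ltn_expl k (isT : 1 < 2))); rewrite ?leq_subr ?leq_pred.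
    by rewrite -expnD leq_exp2l //; lia.
  by move: (2 ^ (3 * m)) (2 ^ (2 * m)) => u v; nia.
have dGZ : [disjoint G & Z] by apply: disjointW dAW.
apply: (@noecon (G :|: Z)).
  by rewrite subUset (subset_trans GA) // (subset_trans ZW).
exists k; split=> //.
  by rewrite cardsU_disj // eG eZ e1 eQ; nia.
have h1 : hc c k (G :|: Z) by apply: hcS (subsetUl _ _) _; rewrite -eQ.
have h2 : hc (~~ c) k (G :|: Z).
  have -> : k = 1 + k.-1 by plia.
  apply: (@hc_add _ _ _ _ _ _ Q ((G :\: Q) :|: Z)).
  - by apply: hc_clique; rewrite ?eQ.
  - by rewrite -e1.
  - by rewrite disjUr disjDr /=; apply: disjointWl dGZ.
  - exact: subset_trans QG (subsetUl _ _).
  - by apply: setSU; apply: subsetDl.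
by move: h1 h2; case: (c) => ? ? [].
Qed.

(** Otherwise [x] would be the centre of the configuration of [economical_star], with one clique
    from the packing clique of [x], one from its [~~ c]-neighbours in [A], and the opposite clique
    from those in [W]. *)
Lemma sparse_degree g x : part (kclique c m) g A -> cfree (~~ c) k A ->
  x \in A -> 2 ^ (5 * m) <= #|W :&: nbr (~~ c) x| ->
  #|A :&: nbr (~~ c) x| < 2 ^ (2 * m).
Proof.
move=> pA fA xA hW; rewrite ltnNge; apply/negP => hA.
have [||R RA] := @ramsey_sub _ _ col_sym (~~ c) m m (A :&: nbr (~~ c) x).
- by apply: leq_trans hA; rewrite leq_exp2l //; plia.
- by apply: (cfree_le (s := k)); [plia|apply: cfreeS fA; apply: subsetIl].
rewrite negbK => -[cR eR].
have [S [[cS eS] xS SA]] := part_mem pA xA.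
have RA' := subset_trans RA (subsetIl _ _).
have Rx := subset_trans RA (subsetIr _ _).
have dRS : [disjoint R & S].
  rewrite -setI_eq0; apply/eqP/setP => y; rewrite in_setI in_set0.
  apply/negP => /andP[/(subsetP Rx)]; rewrite mem_nbr => /andP[yx /eqP e] yS.
  by move: e; rewrite (cS x y xS yS) 1?eq_sym //; case: (c).
have [||B [BW [cB eB] hB]] := @homog_clique _ _ col_sym c m (S :|: R) (W :&: nbr (~~ c) x).
- apply: leq_trans hW; rewrite leq_exp2l //.
  by have := cardsU_le S R; rewrite eS eR; plia.
- by apply: cfreeS fW; apply: subsetIl.
have BW' := subset_trans BW (subsetIl _ _).
have Bx := subset_trans BW (subsetIr _ _).
have hS : homogeneous S B by apply: homogS hB; apply: subsetUl.
have hR : homogeneous R B by apply: homogS hB; apply: subsetUr.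
have dSB : [disjoint S & B] by apply: disjointW dAW.
have dRB : [disjoint R & B] by apply: disjointW dAW.
have sS : #|side c S B| < d by apply: sparseW => //; apply: subset_trans AV.
have sR : #|side c R B| < d by apply: sparseW => //; apply: subset_trans AV.
have xs : x \in side (~~ c) S B.
  rewrite inE xS; apply/forall_inP => y /(subsetP Bx).
  by rewrite mem_nbr => /andP[].
have := card_side c hS; have := card_side c hR; rewrite eS eR => h1 h2.
have [|R' R's eR'] := @subset_of_card _ (side (~~ c) R B) k; first by plia.
have [|S0 S0s eS0] := @subset_of_card _ (side (~~ c) S B :\ x) k.-1.
  by move: h2; rewrite (cardsD1 x (side (~~ c) S B)) xs; plia.
have [|B' B's eB'] := @subset_of_card _ B (d + d).-1; first by rewrite eB; plia.
have S0S : S0 \subset side (~~ c) S B by apply: subset_trans S0s (subsetDl _ _).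
have S1S : x |: S0 \subset side (~~ c) S B by rewrite subUset sub1set xs.
have S1 := subset_trans S1S (side_sub _ _ _ _).
have R1 := subset_trans R's (side_sub _ _ _ _).
apply: (@noecon ((x |: S0) :|: R' :|: B')).
  have AWV : A :|: W \subset V by rewrite subUset AV.
  apply: subset_trans AWV; apply: setUSS; last exact: subset_trans B's BW'.
  by rewrite subUset (subset_trans S1 SA) (subset_trans R1).
apply: (@economical_star _ _ _ col_sym k0 noiso c x) => //.
- exact: setU11.
- split; first by apply: cliqueS cS.
  rewrite cardsU1 eS0 (_ : x \notin S0); first by plia.
  by apply/negP => /(subsetP S0s); rewrite !inE eqxx.
- by split=> //; apply: cliqueS cR.
- by split=> //; apply: cliqueS cB.
- by apply: joined_nbr; apply: subset_trans R1 Rx.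
- by apply: joinedS (@side_joined _ col (~~ c) S B).
- by apply: joinedS (@side_joined _ col (~~ c) R B).
- by rewrite disjoint_sym; apply: disjointW dRS.
- by apply: disjointW dSB.
- by apply: disjointW dRB.
Qed.

(** Many such vertices would contain a [c]-clique [Q] of size [m]. A [~~ c]-clique of [W] outside
    all their [~~ c]-neighbourhoods is then joined to [Q] entirely in [c], against [sparseW]. *)
Lemma sparse_exceptional : cfree (~~ c) k A -> 2 ^ (6 * m) <= #|W| ->
  #|[set x in A | #|W :&: nbr (~~ c) x| < 2 ^ (5 * m)]| < 2 ^ (2 * m).
Proof.
move=> fA hW; rewrite ltnNge; apply/negP => hX.
set X := [set x in A | _] in hX.
have XA : X \subset A by apply/subsetP => x; rewrite inE => /andP[].
have [||Q QX] := @ramsey_sub _ _ col_sym (~~ c) m m X.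
- by apply: leq_trans hX; rewrite leq_exp2l //; plia.
- by apply: (cfree_le (s := k)); [plia|exact: cfreeS fA].
rewrite negbK => -[cQ eQ].
have QA := subset_trans QX XA.
pose Y := W :\: \bigcup_(q in Q) nbr (~~ c) q.
have hY : 2 ^ (4 * m) <= #|Y|.
  have : #|W| <= #|Y| + #|Q| * 2 ^ (5 * m).
    rewrite -(cardsID (\bigcup_(q in Q) nbr (~~ c) q) W) addnC leq_add2l.
    rewrite big_distrr /=.
    apply: (@leq_trans (\sum_(q in Q) #|W :&: nbr (~~ c) q|)).
      elim/big_rec2: _ => [|q u Z _ h]; first by rewrite cards0.
      by apply: leq_trans (cardsU_le _ _) _; rewrite leq_add2l.
    rewrite -sum_nat_const; apply: leq_sum => q /(subsetP QX).
    by rewrite inE => /andP[_ /ltnW].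
  rewrite eQ => h.
  have e6 : 2 ^ (6 * m) = 2 ^ (5 * m) * 2 ^ m by rewrite -expnD; congr (2 ^ _); plia.
  have e45 : 2 ^ (4 * m) <= 2 ^ (5 * m) by rewrite leq_exp2l //; plia.
  have := ltn_expl m (isT : 1 < 2).
  by move: hW h e45; rewrite e6; move: (2 ^ (4 * m)) (2 ^ (5 * m)) (2 ^ m) => u v w; nia.
have YW : Y \subset W := subsetDl _ _.
have [||R [RY [cR eR] hR]] := @homog_clique _ _ col_sym c m Q Y.
- by apply: leq_trans hY; rewrite leq_exp2l // eQ; plia.
- exact: cfreeS fW.
have [r rR] : exists r, r \in R by apply/set0Pn; rewrite -card_gt0 eR; plia.
have s : #|side c Q R| < d.
  apply: sparseW => //; [exact: subset_trans AV|exact: subset_trans YW|].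
  by apply: disjointW dAW => //; apply: subset_trans YW.
have := card_side c hR; rewrite eQ.
have -> : side (~~ c) Q R = set0.
  apply/setP => q; rewrite in_set0 inE; apply/negP => /andP[qQ /forall_inP/(_ r rR)] e.
  have := subsetP RY r rR; rewrite inE => /andP[/negP nr rW]; apply: nr.
  apply/bigcupP; exists q => //; rewrite mem_nbr e andbT.
  apply/negP => /eqP rq; have := disjointFr dAW (subsetP QA q qQ).
  by rewrite -rq rW.
by rewrite cards0; plia.
Qed.

End SparseSide.

Lemma near_clique_structure n K : (forall c, ~ hc c n setT) -> k * n + 2 ^ (6 * m) <= #|V| ->
  (k + d) * n <= #|V| + K ->
  exists c A, k * n <= #|A| + k * (K + 2 ^ (4 * m)) + 2 ^ (2 * m) /\
    {in A, forall x, #|A :&: nbr (~~ c) x| < 2 ^ (2 * m)}.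
Proof.
move=> nh hV hK.
have [c [A [g [AV pA fW hW [_ sparseW]]]]] := sparse_side_ex nh hV.
have dAW := disjDr V A.
have WV := subsetDl V A.
have e56 : 2 ^ (5 * m) <= 2 ^ (6 * m) by rewrite leq_exp2l //; plia.
have hA := sparse_large AV WV dAW fW sparseW nh pA erefl hK.
have fA := sparse_no_clique AV WV dAW fW sparseW pA (leq_trans e56 hW).
have hX := sparse_exceptional AV WV dAW fW sparseW fA hW.
set X := [set x in A | _] in hX.
have XA : X \subset A by apply/subsetP => x; rewrite inE => /andP[].
exists c, (A :\: X); split; first by rewrite cardsD_sub //; plia.
move=> x /setDP[xA]; rewrite inE xA /= -leqNgt => h.
apply: leq_ltn_trans (sparse_degree AV WV dAW fW sparseW pA fA xA h).
by apply: subset_leq_card; apply: setSI; apply: subsetDl.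
Qed.

End Uneconomical.
End Struct.

(** * Perfect tilings by cliques *)

Lemma stationary (f : nat -> nat) b : {homo f : x y / x <= y} ->
  (forall i, f i <= b) -> exists2 i, i <= b & f i = f i.+1.
Proof.
move=> hf fb; apply: contrapT => h.
have {}h i : i <= b -> f i < f i.+1.
  move=> ib; rewrite ltn_neqAle hf // andbT; apply/negP => /eqP e.
  by apply: h; exists i.
have : forall i, i <= b.+1 -> i <= f i.
  elim=> [//|i IH] ib; apply: leq_ltn_trans (h i ib); apply: IH; exact: ltnW.
by move=> /(_ b.+1 (leqnn _)); have := fb b.+1; lia.
Qed.

Section Tiling.
Variables (T : finType) (col : T -> T -> bool).
Hypothesis col_sym : symmetric col.
Implicit Types (S X Y Z Q R F M U W : {set T}) (c b : bool).
Local Notation joined := (@joined T col).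
Local Notation kclique := (@kclique T col).
Local Notation cfree := (@cfree T col).
Local Notation nbr := (@nbr T col).

(** While some vertex has more than a sixteenth of the set as [~~ c]-neighbours, pass to these. Each
    pass lowers the clique bound by one, so there are at most [s]. *)
Lemma dense_spot c s h X : cfree (~~ c) s X -> 16 ^ s * h <= #|X| ->
  exists S : {set T}, [/\ S \subset X, h <= #|S| &
    {in S, forall x, 16 * #|S :&: nbr (~~ c) x| <= #|S|}].
Proof.
elim: s X => [|s IH] X fX hX.
  by case: (fX set0); [exact: sub0set|split; [exact: clique0|exact: cards0]].
have [h1|h1] := EM {in X, forall x, 16 * #|X :&: nbr (~~ c) x| <= #|X|}.
  by exists X; split=> //; apply: leq_trans hX; rewrite leq_pmull // expn_gt0.
have [x xX hx] : exists2 x, x \in X & #|X| < 16 * #|X :&: nbr (~~ c) x|.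
  apply: contrapT => h2; apply: h1 => x xX; rewrite leqNgt; apply/negP => h3.
  by apply: h2; exists x.
have [||S [SX hS dS]] := IH (X :&: nbr (~~ c) x).
- move=> S SX kS; apply: (fX (x |: S)).
    by rewrite subUset sub1set xX (subset_trans SX) // subsetIl.
  by apply: kcliqueU1 => //; apply: subset_trans SX (subsetIr _ _).
- by move: hX hx; rewrite expnS -mulnA; plia.
by exists S; split=> //; apply: subset_trans SX (subsetIl _ _).
Qed.

Variables (c : bool) (d : nat).
Hypothesis d0 : 0 < d.

(** [c] is the colour of the tiles in this section; the perfect tiling is later used with [c] the
    colour opposite to that of the near-clique. *)
Definition packs q U := exists2 Y : {set T}, Y \subset U & part (kclique c d) q Y.
Definition packing_number U := \max_(q < #|U|.+1 | `[< packs q U >]) q.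

Lemma packs_le q U : packs q U -> q * d <= #|U|.
Proof.
case=> Y YU pY; rewrite -(@part_card _ _ d _ _ _ pY); last by move=> S [].
exact: subset_leq_card.
Qed.

Lemma packing_number_max q U : packs q U -> q <= packing_number U.
Proof.
move=> h; have qU : q < #|U|.+1 by have := packs_le h; nia.
by apply: (@leq_bigmax_cond _ _ (fun i : 'I__ => nat_of_ord i) (Ordinal qU)); apply/asboolP.
Qed.

Lemma packs_packing_number U : packs (packing_number U) U.
Proof.
have p0 : packs 0 U by exists set0; [exact: sub0set|exact: part0].
have [|i /asboolP hi e] := @eq_bigmax_cond _ [pred q : 'I_(#|U|.+1) | `[< packs q U >]]
  (fun q => nat_of_ord q).
  by apply/card_gt0P; exists ord0; apply/asboolP.
by rewrite /packing_number e.
Qed.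

Lemma packs_le_n q q' U : q' <= q -> packs q U -> packs q' U.
Proof.
move=> qq [Y YU pY]; have [Z ZY pZ] := part_take pY qq.
by exists Z => //; apply: subset_trans YU.
Qed.

(** * Absorption inside a sparse spot *)

Section Spot.
Variables (s : nat) (S : {set T}).
Hypothesis fS : cfree (~~ c) s S.
Hypothesis sparse : {in S, forall x, 16 * #|S :&: nbr (~~ c) x| <= #|S|}.

Let unatt (Rem : {set T}) M := [set v in Rem | #|M :&: nbr c v| < d.-1].

(** Suppose every clique of a packing of [X] failed for more than half of [Rem]. A failure costs [d]
    neighbours in [~~ c]; summed over the packing, this exceeds the sixteenth of [S] per vertex that
    [sparse] allows. *)
Lemma absorber_choice (Rem X : {set T}) : Rem \subset S -> X \subset S -> #|S| <= 2 * #|X| ->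
  8 * 2 ^ (s + (d + d)) <= #|S| ->
  exists M : {set T}, [/\ M \subset X, kclique c (d + d).-1 M & 2 * #|unatt Rem M| <= #|Rem|].
Proof.
move=> RS XS hX hS.
have [|q [Y [YX pY lY]]] := @greedy _ _ col_sym (~~ c) s (d + d).-1 X _ (cfreeS XS fS).
  by plia.
rewrite negbK in pY.
have cY : #|Y| = q * (d + d).-1 by apply: part_card pY => M [].
have {}lY : #|X| < #|Y| + 2 ^ (s + (d + d)).
  have e : 2 ^ (s + (d + d).-1) <= 2 ^ (s + (d + d)) by rewrite leq_exp2l //; plia.
  by move: lY; rewrite cardsD_sub //; plia.
apply: contrapT => hn.
pose r Z := \sum_(v in Rem) #|Z :&: nbr (~~ c) v|.
have rU Z Z' : [disjoint Z & Z'] -> r (Z :|: Z') = r Z + r Z'.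
  move=> dZ; rewrite /r -big_split /=; apply: eq_bigr => v _.
  rewrite setIUl cardsU_disj //.
  by apply: disjointW dZ; apply: subsetIl.
have h1 M : M \subset Y -> kclique c (d + d).-1 M -> d * #|Rem| < 2 * r M.
  move=> MY kM; have [lt|le] := ltnP #|Rem| (2 * #|unatt Rem M|); last first.
    by case: hn; exists M; split=> //; apply: subset_trans MY YX.
  have h2 : d * #|unatt Rem M| <= r M.
    rewrite mulnC -sum_nat_const /r.
    apply: (@leq_trans (\sum_(v in unatt Rem M) #|M :&: nbr (~~ c) v|)).
      apply: leq_sum => v; rewrite inE => /andP[_ hv].
      by have := card_nbr_ge col c v M; rewrite (proj2 kM); plia.
    rewrite [leqRHS](big_setID (unatt Rem M)) /= (setIidPr _) ?leq_addr //.
    by apply/subsetP => v; rewrite inE => /andP[].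
  apply: (@leq_trans (d * (2 * #|unatt Rem M|))); last by plia.
  by rewrite ltn_pmul2l.
have h2 : q * (d * #|Rem|).+1 <= 2 * r Y.
  elim: pY h1 {cY lY YX} => [|{}q {}Y M kM dM pY IH] h1.
    by rewrite mul0n.
  rewrite rU // mulSn mulnDr; apply: leq_add; first by apply: h1 => //; apply: subsetUl.
  by apply: IH => M' MY; apply: h1; apply: subset_trans MY (subsetUr _ _).
have h3 : 16 * r Y <= #|Rem| * #|S|.
  rewrite /r big_distrr /= -sum_nat_const; apply: leq_sum => v vR.
  apply: leq_trans (sparse (subsetP RS _ vR)); rewrite leq_mul2l /=.
  by apply: subset_leq_card; apply: setSI; apply: subset_trans YX XS.
have h4 : 8 * (q * (d * #|Rem|).+1) <= #|Rem| * #|S| by plia.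
have h5 : #|S| < 8 * (q * d).
  have : q * (d + d).-1 <= 2 * (q * d) by nia.
  have : 0 < 2 ^ (s + (d + d)) by rewrite expn_gt0.
  by move: lY hX hS; rewrite cY; plia.
have q0 : 0 < q by move: h5; case: (q); rewrite ?mul0n ?muln0.
by clear -h4 h5 q0; nia.
Qed.

(* Each [w] of [W] is joined to [Y], so [Y] and [w] form a tile, and so do two
   halves of [w |: M] for a [(2d - 1)]-clique [M] of neighbours of [w]. When [v]
   has [d - 1] neighbours in [M] it forms a tile with them, and the rest of [M]
   is another one: the tiles of [Y], [M], [w] and [v] are then one more than
   those of [w |: M]. Averaging over disjoint [M] gives one that misses at most
   half of the vertices [v] still to be served, whence [#|Rem| < 2 ^ g]. *)
Lemma absorbers g (W F Rem U Y : {set T}) : #|W| = g -> W \subset U -> U \subset S ->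
  joined c Y W -> kclique c d.-1 Y -> Y \subset F -> [disjoint F & W] ->
  Rem \subset S -> #|Rem| < 2 ^ g ->
  4 * (#|S :\: U| + #|F| + 2 * d * g + 1) <= #|S| -> 8 * 2 ^ (s + (d + d)) <= #|S| ->
  exists Z : {set T}, [/\ Z \subset U, [disjoint F & Z], #|Z| = 2 * d * g,
     part (kclique c d) (2 * g) Z &
     forall v, v \in Rem -> v \notin Z -> v \notin Y ->
       part (kclique c d) (2 * g).+1 (v |: (Y :|: Z))].
Proof.
elim: g W F Rem => [|g IH] W F Rem eW WU US jY [cY eY] YF dFW RS hR hS hS2.
  exists set0; split=> //; first exact: sub0set.
  - by rewrite -setI_eq0 setI0.
  - by rewrite cards0 muln0.
  - exact: part0.
  - by move=> v vR; move: hR; rewrite (cardsD1 v Rem) vR.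
have [w wW] : exists w, w \in W by apply/set0Pn; rewrite -card_gt0 eW.
have wU := subsetP WU w wW; have wS := subsetP US w wU.
pose X := (S :&: nbr c w) :\: ((S :\: U) :|: (F :|: W)).
have XS : X \subset S by rewrite /X; apply: subset_trans (subsetDl _ _) (subsetIl _ _).
have hX : #|S| <= 2 * #|X|.
  have h1 := card_nbr_ge col c w S; have h2 := sparse wS.
  have h3 : #|S :&: nbr c w| <= #|X| + #|(S :\: U) :|: (F :|: W)|.
    rewrite -(cardsID ((S :\: U) :|: (F :|: W)) (S :&: nbr c w)) addnC leq_add2l.
    by apply: subset_leq_card; apply: subsetIr.
  have h4 := cardsU_le (S :\: U) (F :|: W); have h5 := cardsU_le F W.
  rewrite eW in h5; have h6 : g.+1 <= 2 * d * g.+1 by rewrite leq_pmull // muln_gt0.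
  by clear IH eW eY jY cY dFW; plia.
have [M [MX [cM eM] hM]] := absorber_choice RS XS hX hS2.
have [MN MU MF MW] : [/\ M \subset nbr c w, M \subset U, [disjoint F & M] & [disjoint W & M]].
  have h x : x \in M -> [/\ x \in nbr c w, x \in U, x \notin F & x \notin W].
    move/(subsetP MX); rewrite /X !inE => /andP[]; rewrite !negb_or negb_and negbK.
    by move=> /andP[h1 /andP[h2 h3]] /andP[h4 ->]; move: h1; rewrite h4 orbF.
  split.
  - by apply/subsetP => x /h[].
  - by apply/subsetP => x /h[].
  - by rewrite -setI_eq0; apply/eqP/setP => x; rewrite in_setI in_set0; apply/negP => /andP[xF /h[_ _]]; rewrite xF.
  - by rewrite -setI_eq0; apply/eqP/setP => x; rewrite in_setI in_set0; apply/negP => /andP[xF /h[_ _ _]]; rewrite xF.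
have wF : w \notin F by rewrite (disjointFl dFW).
have wM : w \notin M by apply: nbr_notin MN.
have kwM : kclique c (2 * d) (w |: M).
  have := kcliqueU1 col_sym MN (conj cM eM); congr kclique; plia.
have pwM : part (kclique c d) 2 (w |: M) by apply: part_clique; case: kwM.
have eW' : #|W :\ w| = g by move: eW; rewrite (cardsD1 w W) wW; plia.
have dFwM : [disjoint F & w |: M] by rewrite disjUr MF disjoint_sym disjoints1 wF.
have RemS : unatt Rem M \subset S.
  by apply: subset_trans RS; apply/subsetP => v; rewrite inE => /andP[].
have [||||||Z [ZU dZ eZ pZ aZ]] :=
    IH (W :\ w) (F :|: (w |: M)) (unatt Rem M) eW' _ US _ (conj cY eY) _ _ RemS _ _ hS2.
- exact: subset_trans (subsetDl _ _) WU.
- by apply: joinedS jY; rewrite ?subsetDl.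
- exact: subset_trans YF (subsetUl _ _).
- rewrite disjUl (disjointWr (subsetDl _ _) dFW) /= disjUl disjoints1 !inE eqxx /=.
  by rewrite disjoint_sym; apply: disjointWl MW; apply: subsetDl.
- by move: hR; rewrite expnS; plia.
- rewrite (cardsU_disj dFwM) (proj2 kwM); move: hS; rewrite mulnS; clear; plia.
move: dZ; rewrite disjUl => /andP[dFZ dMZ].
have dYM : [disjoint Y & w |: M] by apply: disjointWl dFwM.
have dYZ : [disjoint Y & Z] by apply: disjointWl dFZ.
exists (Z :|: (w |: M)); split.
- by rewrite !subUset ZU sub1set wU.
- by rewrite disjUr dFZ.
- by rewrite cardsU_disj 1?disjoint_sym // eZ (proj2 kwM); plia.
- by rewrite mulnS addnC; apply: part_cat; rewrite // disjoint_sym.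
move=> v vR; rewrite inE negb_or => /andP[vZ vM] vY.
(* If [M] does not serve [v], the recursive absorber does, and [w |: M] keeps its own two tiles. *)
have [vu|vu] := boolP (v \in unatt Rem M).
  have -> : v |: (Y :|: (Z :|: (w |: M))) = (v |: (Y :|: Z)) :|: (w |: M).
    by rewrite -!setUA.
  have -> : (2 * g.+1).+1 = (2 * g).+1 + 2 by plia.
  apply: part_cat => //; first exact: aZ.
  by rewrite disjUl disjoints1 vM disjUl dYM /= disjoint_sym.
move: vu; rewrite inE vR /= -leqNgt => /subset_of_card[M1 M1s eM1].
have M1M := subset_trans M1s (subsetIl _ _).
have M1v := subset_trans M1s (subsetIr _ _).
have p1 : part (kclique c d) 1 (v |: M1).
  apply: part1; have := kcliqueU1 col_sym M1v (conj (cliqueS M1M cM) eM1).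
  by rewrite prednK.
have p2 : part (kclique c d) 1 (M :\: M1).
  apply: part1; split; first by apply: cliqueS cM; apply: subsetDl.
  by rewrite cardsD_sub // eM eM1; plia.
have p3 : part (kclique c d) 1 (w |: Y).
  apply: part1; split.
    apply: cliqueU => //; first exact: clique1.
    by move=> y z /set1P-> zY; rewrite col_sym; apply: jY.
  rewrite cardsU1 eY (_ : w \notin Y); first by plia.
  by apply: contra wF; apply: (subsetP YF).
have -> : v |: (Y :|: (Z :|: (w |: M))) =
    ((v |: M1) :|: (M :\: M1)) :|: ((w |: Y) :|: Z).
  apply/setP => x; rewrite !inE; have := subsetP M1M x.
  case: (x == v); case: (x == w) => //; case: (x \in M1) => [/(_ isT)->|] //=;
  case: (x \in M); case: (x \in Y); case: (x \in Z) => //.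
have -> : (2 * g.+1).+1 = (1 + 1) + (1 + 2 * g) by plia.
have vM' : v \notin M by apply: contra vM => ?; rewrite inE orbC; apply/orP; left.
have vw : v != w by apply: contraNneq vM => ->; apply: setU11.
have dYM' : [disjoint Y & M] by apply: disjointWr dYM; apply: subsetUr.
have dMZ' : [disjoint M & Z] by apply: disjointWl dMZ; apply: subsetUr.
have wZ : w \notin Z by move: dMZ; rewrite disjUl disjoints1 => /andP[].
have q1 : part (kclique c d) (1 + 1) ((v |: M1) :|: (M :\: M1)).
  apply: part_cat => //.
  by rewrite disjUl disjDr andbT disjoints1 inE negb_and vM' orbT.
have q2 : part (kclique c d) (1 + 2 * g) ((w |: Y) :|: Z).
  by apply: part_cat => //; rewrite disjUl disjoints1 wZ.
apply: part_cat q1 q2 _.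
have h X1 : X1 \subset M -> [disjoint X1 & (w |: Y) :|: Z].
  move=> X1M; apply: disjointWl X1M _; rewrite !disjUr dMZ' andbT.
  by rewrite disjoint_sym disjoints1 wM disjoint_sym.
rewrite disjUl (h _ (subsetDl _ _)) andbT disjUl (h _ M1M) andbT.
by rewrite disjoints1 !inE !negb_or vw vY.
Qed.

(* [D i] is the largest number of vertices that an optimal packing leaves
   uncovered in a subset missing [q + i * w] vertices of [S]. It is bounded, so it
   is constant at some step; there, an absorber inside the worst subset would
   cover [d] more vertices if [D i >= d]. *)
Lemma perfect_tiling q g : #|S| < 2 ^ g -> 0 < g ->
  8 * (2 ^ (s + (d + d)) * g + q + (2 ^ (s + d)).+2 * (d + 2 * d * g)) <= #|S| ->
  forall U, U \subset S -> #|S :\: U| <= q -> packs (#|U| %/ d) U.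
Proof.
move=> hg g0 hS.
pose w := d + 2 * d * g; pose qq i := q + i * w.
pose D i := \max_(U in powerset S | #|S :\: U| <= qq i) (#|U| - packing_number U * d).
have D_ge i U : U \subset S -> #|S :\: U| <= qq i -> #|U| - packing_number U * d <= D i.
  move=> US hU; apply: (@leq_bigmax_cond _ _ (fun U => #|U| - packing_number U * d)).
  by rewrite powersetE US.
have D_ex i : exists U : {set T}, [/\ U \subset S, #|S :\: U| <= qq i & D i = #|U| - packing_number U * d].
  have [|U] := @eq_bigmax_cond _ [pred U : {set T} | (U \in powerset S) && (#|S :\: U| <= qq i)]
      (fun U => #|U| - packing_number U * d).
    by apply/card_gt0P; exists S; rewrite !inE subxx setDv cards0.
  by rewrite !inE => /andP[US hU] e; exists U; split.
have D_le i : D i <= 2 ^ (s + d).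
  have [U [US _ ->]] := D_ex i.
  have [p [Y [YU pY lY]]] := @greedy _ _ col_sym (~~ c) s d U d0 (cfreeS US fS).
  rewrite negbK in pY.
  have cY : #|Y| = p * d by apply: part_card pY => M [].
  have : p <= packing_number U by apply: packing_number_max; exists Y.
  move: lY; rewrite cardsD_sub // cY => lY hp.
  have : p * d <= packing_number U * d by rewrite leq_mul2r hp orbT.
  by plia.
have D_homo : {homo D : x y / x <= y}.
  move=> x y xy; have [U [US hU ->]] := D_ex x; apply: D_ge => //.
  by apply: leq_trans hU _; rewrite leq_add2l leq_mul2r xy orbT.
have [i ib eD] := stationary D_homo D_le.
suff Dd : D i < d.
  move=> U US hU; apply: (packs_le_n _ (packs_packing_number U)).
  have : #|U| - packing_number U * d <= D i by apply: D_ge => //; apply: leq_trans hU _; apply: leq_addr.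
  move=> h; rewrite -ltnS ltn_divLR // mulSn; have := leq_ltn_trans h Dd.
  by have := packs_le (packs_packing_number U); plia.
rewrite ltnNge; apply/negP => dD.
have [U [US hU eU]] := D_ex i.
have hq : qq i.+1 + w <= q + (2 ^ (s + d)).+2 * w.
  by rewrite /qq -addnA leq_add2l -mulSnr leq_mul2r; apply/orP; right.
have hq1 : qq i.+1 = qq i + w by rewrite /qq mulSn; plia.
have cU : #|S| = #|U| + #|S :\: U|.
  by rewrite cardsD_sub // subnKC // subset_leq_card.
have e2 : 2 ^ (s + d.-1) <= 2 ^ (s + (d + d)) by rewrite leq_exp2l //; plia.
(* [Y] is one vertex short of a tile and has [g] completions, one for each halving of the set to be
   served. *)
have [|Y [W0 [YU W0U]]] := @clique_common_nbr _ _ col_sym (~~ c) s d.-1 g U g0 _ (cfreeS US fS).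
  apply: (@leq_trans (2 ^ (s + (d + d)) * g)); first by rewrite leq_mul2r e2 orbT.
  rewrite -/w in hS; move: hS; clear -hq hq1 cU hU; move: (2 ^ (s + (d + d)) * g) => u.
  by move: ((2 ^ (s + d)).+2 * w) hq => v; plia.
rewrite negbK => -[cY eY] gW0 [dYW jYW].
have [W WW0 eW] := subset_of_card gW0.
have e8 : 2 ^ (s + (d + d)) <= 2 ^ (s + (d + d)) * g by rewrite leq_pmulr.
have [|||||Z [ZU dZ eZ pZ aZ]] := @absorbers g W Y S U Y eW _ US _ (conj cY eY) (subxx _) _ (subxx _) hg.
- exact: subset_trans W0U.
- by apply: joinedS jYW.
- by apply: disjointWr dYW.
- rewrite eY -/w in hS *; have : d.-1 + 2 * d * g + 1 = w by rewrite /w; plia.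
  move: hS; clear -hq hq1 cU hU; move: (2 ^ (s + (d + d)) * g) => u.
  by move: ((2 ^ (s + d)).+2 * w) hq => v; plia.
- by rewrite -/w in hS; move: hS e8; clear; move: (2 ^ (s + (d + d))) ((2 ^ (s + d)).+2 * w) => u v; plia.
pose U' := U :\: (Y :|: Z).
have YZU : Y :|: Z \subset U by rewrite subUset YU.
have eYZ : #|Y :|: Z| = d.-1 + 2 * d * g by rewrite cardsU_disj // eY eZ.
have hU' : #|S :\: U'| <= qq i.+1.
  have -> : S :\: U' = (S :\: U) :|: (Y :|: Z).
    rewrite /U' setDDr; congr (_ :|: _); apply/setIidPr.
    exact: subset_trans YZU US.
  apply: leq_trans (cardsU_le _ _) _; rewrite eYZ hq1 leq_add // /w.
  by rewrite leq_add2r leq_pred.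
have U'S : U' \subset S := subset_trans (subsetDl _ _) US.
have := D_ge _ _ U'S hU'; rewrite -eD => hD.
have cU' : #|U| = #|U'| + (d.-1 + 2 * d * g).
  by rewrite /U' cardsD_sub // eYZ subnK // -eYZ subset_leq_card.
have [Y0 Y0U' pY0] := packs_packing_number U'.
have cY0 : #|Y0| = packing_number U' * d by apply: part_card pY0 => M [].
have dU' : [disjoint U' & Y :|: Z] := disjDl _ _.
have n1 : packing_number U' + 2 * g <= packing_number U.
  apply: packing_number_max; exists (Y0 :|: Z).
    by rewrite subUset ZU (subset_trans Y0U') // subsetDl.
  apply: part_cat => //; apply: disjointW dU' => //; exact: subsetUr.
have h1 : (packing_number U' + 2 * g) * d <= packing_number U * d by rewrite leq_mul2r n1 orbT.
have hle := packs_le (packs_packing_number U); have hle' := packs_le (packs_packing_number U').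
(* At least [d] vertices of [U] are uncovered, [Z] consists of whole tiles and [Y] takes only
   [d - 1] vertices, so an uncovered vertex remains. *)
have [v vU'] : exists v, v \in U' :\: Y0.
  apply/set0Pn; rewrite -card_gt0 cardsD_sub // cY0 subn_gt0.
  move: h1; rewrite mulnDl; have -> : 2 * g * d = 2 * d * g by plia.
  by move: dD cU'; rewrite eU; clear -d0; move: (2 * d * g) (packing_number U * d) (packing_number U' * d) => x y z; plia.
move: vU'; rewrite inE => /andP[vY0 vU'].
move: (vU'); rewrite inE inE negb_or => /andP[/andP[vY vZ] vU].
have n2 : packing_number U' + (2 * g).+1 <= packing_number U.
  apply: packing_number_max; exists (Y0 :|: (v |: (Y :|: Z))).
    by rewrite !subUset YU ZU sub1set vU (subset_trans Y0U') // subsetDl.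
  apply: part_cat => //; first by apply: aZ => //; apply: (subsetP US).
  rewrite disjoint_sym disjUl disjoints1 vY0 /= disjoint_sym.
  by apply: disjointWl dU'.
(* [U] has [d - 1 + 2 * d * g] vertices more than [U'], but its packing covers at least
   [d + 2 * d * g] more. So [U'] leaves more uncovered than [D i] permits. *)
have h2 : (packing_number U' + (2 * g).+1) * d <= packing_number U * d by rewrite leq_mul2r n2 orbT.
move: h2 hD; rewrite eU mulnDl mulSn; have -> : 2 * g * d = 2 * d * g by plia.
by clear -cU' d0 hle hle'; move: (2 * d * g) (packing_number U * d) (packing_number U' * d) cU' hle hle' => x y z; plia.
Qed.

End Spot.
End Tiling.

(** * Attaching exceptional vertices and tiling a near-clique *)

Section Attach.
Variables (T : finType) (col : T -> T -> bool).
Hypothesis col_sym : symmetric col.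
Implicit Types (S X Y Z Q R E L : {set T}) (c b : bool).
Local Notation clique := (@clique T col).
Local Notation kclique := (@kclique T col).
Local Notation nbr := (@nbr T col).

(** [r] is a size that forces a clique on [t - 1] vertices; the term [t * #|E|] makes up for the
    vertices of [Y] spent on other members of [E]. *)
Lemma attach_cliques c t r E Y : 0 < t -> [disjoint E & Y] ->
  (forall X, X \subset Y -> r <= #|X| -> exists2 S : {set T}, S \subset X & kclique c t.-1 S) ->
  {in E, forall x, t * #|E| + r <= #|Y :&: nbr c x|} ->
  exists2 Z : {set T}, Z \subset Y &
    #|Z| = t.-1 * #|E| /\ part (kclique c t) #|E| (E :|: Z).
Proof.
move=> t0; move En : #|E| => n; elim: n E Y En => [|n IH] E Y En dEY hr hE.
  exists set0; first exact: sub0set.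
  have /eqP-> : E == set0 by rewrite -cards_eq0 En.
  by rewrite setU0 cards0 muln0; split=> //; exact: part0.
have [x xE] : exists x, x \in E by apply/set0Pn; rewrite -card_gt0 En.
have [|S SX [cS eS]] := hr (Y :&: nbr c x) (subsetIl _ _).
  by apply: leq_trans (hE x xE); apply: leq_addl.
have SY := subset_trans SX (subsetIl _ _).
have Sx := subset_trans SX (subsetIr _ _).
have EnX : #|E :\ x| = n by move: En; rewrite (cardsD1 x) xE; plia.
have [|||Z ZY [eZ pZ]] := IH (E :\ x) (Y :\: S) EnX.
- by apply: disjointW dEY; apply: subsetDl.
- by move=> X XY; apply: hr; apply: subset_trans XY (subsetDl _ _).
- move=> y /setD1P[_ yE]; have := hE y yE.
  have : #|Y :&: nbr c y| <= #|(Y :\: S) :&: nbr c y| + #|S|.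
    apply: leq_trans (cardsU_le _ _); apply: subset_leq_card.
    apply/subsetP => z; rewrite in_setI in_setU in_setI in_setD => /andP[-> ->].
    by rewrite !andbT orNb.
  by rewrite eS mulnS; plia.
have ZY' := subset_trans ZY (subsetDl _ _).
have dSZ : [disjoint S & Z] by rewrite disjoint_sym; apply: disjointWl ZY (disjDl _ _).
have xY : x \notin Y by rewrite (disjointFr dEY).
exists (S :|: Z); first by rewrite subUset SY.
split; first by rewrite cardsU_disj // eS eZ; plia.
have -> : E :|: (S :|: Z) = (x |: S) :|: (E :\ x :|: Z).
  by rewrite setUACA setD1K.
apply: partS => //.
  by have := kcliqueU1 col_sym Sx (conj cS eS); rewrite prednK.
rewrite disjUl !disjUr dSZ andbT !disjoints1 !inE eqxx /=.
apply/andP; split; first by apply: contra xY; apply: (subsetP ZY').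
by rewrite disjoint_sym; apply: disjointW dEY => //; apply: subsetDl.
Qed.

Section Near.
Variables (c : bool) (t D : nat) (A : {set T}).
Hypothesis t0 : 0 < t.
Hypothesis D0 : 0 < D.
Hypothesis hD : {in A, forall x, #|A :&: nbr (~~ c) x| < D}.

Lemma near_clique s X : X \subset A -> s * D <= #|X| ->
  exists2 S : {set T}, S \subset X & kclique c s S.
Proof.
move=> XA; apply: sparse_clique => // x xX.
by apply: leq_ltn_trans (hD (subsetP XA x xX)); apply/subset_leq_card/setSI.
Qed.

(* A clique [Z] set aside at the beginning absorbs the vertices left over by
   the greedy tiling. *)
Lemma near_tiling E Y : Y \subset A -> [disjoint E & A] ->
  {in E, forall x, t * #|E| + t * D <= #|Y :&: nbr c x|} ->
  t * #|E| + (t * (t * D) + t + D) * D <= #|Y| ->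
  packs col c t ((#|Y| + #|E|) %/ t) (Y :|: E).
Proof.
move=> YA dEA hE hY.
have dEY : [disjoint E & Y] by apply: disjointWr dEA.
have [|Y1 Y1Y [eY1 p1]] := @attach_cliques c t (t * D) E Y t0 dEY _ hE.
  move=> X XY hX; apply: near_clique; first exact: subset_trans YA.
  by apply: leq_trans hX; rewrite leq_mul2r leq_pred orbT.
(* Fewer than [t * D] vertices will be left over, each with fewer than [D] neighbours of the wrong
   colour in [Z]; this size leaves enough good neighbours to attach them all. *)
set z := t * (t * D) + t + D in hY.
have [||Z ZY [cZ eZ]] := @near_clique z (Y :\: Y1).
- exact: subset_trans (subsetDl _ _) YA.
- rewrite cardsD_sub // eY1; have : t.-1 * #|E| <= t * #|E| by rewrite leq_mul2r leq_pred orbT.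
  by plia.
have [|q [P [PY pP mP]]] := @part_max _ (kclique c t) (Y :\: Y1 :\: Z).
  by move=> S [_ eS]; rewrite -card_gt0 eS.
set L := Y :\: Y1 :\: Z :\: P in mP.
have LY : L \subset Y :\: Y1 :\: Z := subsetDl _ _.
have LA : L \subset A.
  by apply: subset_trans LY (subset_trans (subsetDl _ _) (subset_trans (subsetDl _ _) YA)).
have hL : #|L| < t * D.
  rewrite ltnNge; apply/negP => h; have [S SL kS] := near_clique LA h.
  exact: (mP S).
have dLZ : [disjoint L & Z] by apply: disjointWl LY (disjDl _ _).
have ZA : Z \subset A by apply: subset_trans ZY (subset_trans (subsetDl _ _) YA).
have [||Z1 Z1Z [eZ1 p2]] := @attach_cliques c t t L Z t0 dLZ.
- move=> X XZ hX; have [|S SX eS] := @subset_of_card _ X t.-1.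
    by apply: leq_trans hX; apply: leq_pred.
  exists S => //; split=> //; apply: cliqueS cZ; exact: subset_trans XZ.
- move=> x xL; have h1 := hD (subsetP LA x xL).
  have h2 : #|Z :&: nbr (~~ c) x| <= #|A :&: nbr (~~ c) x|.
    by apply/subset_leq_card/setSI.
  have h3 := card_nbr_ge col c x Z.
  have h4 : t * #|L| <= t * (t * D) by rewrite leq_mul2l (ltnW hL) orbT.
  by move: h3; rewrite eZ /z; plia.
(* The rest of [Z] is still a clique and loses fewer than [t] vertices; all other pieces are tiled
   exactly, so the full quotient is reached. *)
pose r := (#|Z :\: Z1|) %/ t.
have [|Z2 Z2Z eZ2] := @subset_of_card _ (Z :\: Z1) (r * t).
  exact: leq_trunc_div.
have p3 : part (kclique c t) r Z2.
  apply: part_clique => //; apply: cliqueS cZ.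
  exact: subset_trans Z2Z (subsetDl _ _).
have cP : #|P| = q * t by apply: part_card pP => S [].
have PY' : P \subset Y :\: Y1 := subset_trans PY (subsetDl _ _).
have eq : (#|Y| + #|E|) %/ t = #|E| + (q + (#|L| + r)).
  have h1 : #|Y| = #|Y1| + (#|Z| + (#|P| + #|L|)).
    have := cardsD_sub Y1Y; have := cardsD_sub ZY; have := cardsD_sub PY.
    have := subset_leq_card Y1Y; have := subset_leq_card ZY.
    by have := subset_leq_card PY; rewrite /L; plia.
  have h2 : #|Z| = #|Z1| + #|Z :\: Z1|.
    by rewrite cardsD_sub // subnKC // subset_leq_card.
  have -> : #|Y| + #|E| = (#|E| + (q + #|L|)) * t + #|Z :\: Z1|.
    by move: t0 h1 h2; rewrite eY1 eZ1 cP; clear; case: t => // u _; rewrite /=; nia.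
  by rewrite divnMDl // -!addnA.
have sZ : Z \subset Y := subset_trans ZY (subsetDl _ _).
have Z2Z' : Z2 \subset Z := subset_trans Z2Z (subsetDl _ _).
have YZ : P :|: ((L :|: Z1) :|: Z2) \subset Y :\: Y1.
  rewrite !subUset PY' (subset_trans LY (subsetDl _ _)) (subset_trans Z1Z ZY) /=.
  exact: subset_trans Z2Z' ZY.
rewrite eq; exists ((E :|: Y1) :|: (P :|: ((L :|: Z1) :|: Z2))).
  rewrite subUset; apply/andP; split; first by rewrite setUC setSU.
  by apply: subset_trans YZ (subset_trans (subsetDl _ _) (subsetUl _ _)).
have dLP : [disjoint P & L] by apply: disjDr.
have dPZ : [disjoint P & Z] by apply: disjointWl PY (disjDl _ _).
apply: part_cat => //; last first.
  rewrite disjUl; apply/andP; split.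
    by apply: disjointWr dEY; apply: subset_trans YZ (subsetDl _ _).
  by rewrite disjoint_sym; apply: disjointWl YZ (disjDl _ _).
apply: part_cat => //; last first.
  rewrite !disjUr dLP (disjointWr Z1Z dPZ) /=; exact: disjointWr dPZ.
apply: part_cat => //; rewrite disjUl (disjointWr Z2Z' dLZ) /=.
by rewrite disjoint_sym; apply: disjointWl Z2Z (disjDl _ _).
Qed.

End Near.
End Attach.

(** * Extending the colouring by [k + d] vertices *)

Section Complete.
Variable T : finType.
Definition neq_rel : rel T := fun x y => x != y.
Lemma neq_sym : symmetric neq_rel.
Proof. by move=> x y; rewrite /neq_rel eq_sym. Qed.
Lemma neq_irrefl : irreflexive neq_rel.
Proof. by move=> x; rewrite /neq_rel eqxx. Qed.
Definition complete := SGraph neq_sym neq_irrefl.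
End Complete.

Section Extend.
Variable H : sgraph.
Local Notation k := #|H|.
Local Notation a := (alpha H).
Local Notation d := (#|H| - alpha H).
Hypothesis k1 : 1 < k.
Hypothesis noiso : no_isolated H.
Variables (T : finType) (col : T -> T -> bool).
Hypothesis col_sym : symmetric col.
Implicit Types (S X Y Z Q R A B V W : {set T}) (b : bool).
Local Notation joined := (@joined T col).
Local Notation kclique := (@kclique T col).
Local Notation nbr := (@nbr T col).
Local Notation hc := (@has_copies H T col).
Local Notation packs := (@packs T col).

(** [K1] bounds the deficit of [A] and the number of [c]-copies that are moved, [K2] the size of
    [Low] and so the number of [~~ c]-copies meeting it, [D1] the [c]-degrees from [B] into [A]. *)
Variables (c : bool) (A E S Low : {set T}) (n K1 K2 D1 : nat).
Local Notation B := (~: (A :|: E)).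
Hypothesis nh : forall b, ~ hc b n setT.
Hypothesis dAE : [disjoint E & A].
Hypothesis SB : S \subset B.
Hypothesis LB : Low \subset B.
Hypothesis dSL : [disjoint S & Low].
Hypothesis cardA : k * n <= #|A| + K1.
Hypothesis K1n : K1 <= n.
Hypothesis n0 : 0 < n.
Hypothesis tileA : forall X, X \subset A -> #|X| <= k * K1 ->
  packs c k ((#|A :\: X| + #|E|) %/ k) (A :\: X :|: E).
Hypothesis cliqueA : forall j, j <= k * K1 ->
  exists2 Z : {set T}, Z \subset A & kclique c j Z.
Variable Sred : {set T}.
Hypothesis SredS : Sred \subset S.
Hypothesis cardSred : k * K1 <= #|Sred|.
Hypothesis joinSred : joined c Low Sred.
Hypothesis cardLow : #|Low| <= K2.
Hypothesis tileB : forall X, X \subset S -> #|X| <= k * K2 ->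
  packs (~~ c) d (#|B :\: Low :\: X| %/ d) (B :\: Low :\: X).
Hypothesis cliquesS : packs (~~ c) k K2 S.
Hypothesis degB : forall v, v \in B -> #|A :&: nbr c v| <= D1.
Hypothesis cardn : K1 + (k * K2 + k * K2 * D1 + k * D1) <= n.

Let k0 : 0 < k. Proof. exact: ltnW. Qed.
Let d0 : 0 < d. Proof. exact: d_gt0. Qed.
Let kad : k = a + d. Proof. exact: kE. Qed.
Let a0 : 0 < a. Proof. exact: a_gt0. Qed.

Definition ext : finType := (T + ('I_k + 'I_d))%type.
Definition inA (u : ext) := match u with
  | inl t => t \in A :|: E | inr (inl _) => true | inr (inr _) => false end.
Definition inL (u : ext) := match u with inl t => t \in Low | inr _ => false end.
Definition colL (u v : ext) := match u, v with
  | inl s, inl t => col s t | _, _ => c end.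
(* The new vertices ['I_k] are treated like [A] and [E], and ['I_d] like [B]
   outside [Low]; only the edges inside [Low] keep their colour. *)
Definition ext_col (u v : ext) :=
  if inA u || inA v then (if inA u && inA v then c else ~~ c)
  else if inL u || inL v then (if inL u && inL v then colL u v else c)
  else ~~ c.

Lemma ext_col_sym : symmetric ext_col.
Proof.
move=> u v; have e : colL u v = colL v u by case: u => [x|x]; case: v => [y|y] //=.
by rewrite /ext_col e (orbC (inA u)) (andbC (inA u)) (orbC (inL u)) (andbC (inL u)).
Qed.

Lemma card_ext : #|ext| = #|T| + (k + d).
Proof. by rewrite !card_sum !card_ord. Qed.

Let dAS : [disjoint A & S].
Proof.
rewrite disjoint_sym; move: SB; rewrite subsetC => h.
rewrite disjoints_subset; apply: subset_trans SB _.
by rewrite setCS subsetUl.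
Qed.

Let dAL : [disjoint A & Low].
Proof.
by rewrite disjoint_sym disjoints_subset; apply: subset_trans LB _; rewrite setCS subsetUl.
Qed.

Section Copies.
Variables (N : nat) (F : 'I_N -> H -> ext).
Hypothesis Finj : forall i j x y, F i x = F j y -> i = j /\ x = y.
Variables (I : {set 'I_N}) (t0 : T).

Definition pA := [set p : 'I_N * H | (p.1 \in I) && inA (F p.1 p.2)].
Definition pB := [set p : 'I_N * H | (p.1 \in I) && ~~ (inA (F p.1 p.2) || inL (F p.1 p.2))].

(** Vertices in [Low] stay in place, because the edges inside [Low] keep their colour. The default
    [t0] never occurs, as [inL] holds only for old vertices. *)
Definition reemb (gA gB : 'I_N * H -> T) i x :=
  if inA (F i x) then gA (i, x) else
  if inL (F i x) then (if F i x is inl t then t else t0) else gB (i, x).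

Lemma reembP b (gA gB : 'I_N * H -> T) (XA XB : {set T}) :
  {in pA, forall p, gA p \in XA} -> {in pA &, injective gA} ->
  {in pB, forall p, gB p \in XB} -> {in pB &, injective gB} ->
  XA \subset A -> XB \subset S ->
  (forall i x y, i \in I -> adj x y -> col (reemb gA gB i x) (reemb gA gB i y) = b) ->
  hc b #|I| (XA :|: (Low :|: XB)).
Proof.
move=> hA iA hB iB XAA XBS he.
have dAL' : [disjoint XA & Low] by apply: disjointWl dAL.
have dAB' : [disjoint XA & XB] by apply: disjointW dAS.
have dLB' : [disjoint Low & XB] by rewrite disjoint_sym; apply: disjointWl dSL.
exists (fun j => reemb gA gB (enum_val j)); split; last first.
- by move=> j x y; apply: he; apply: enum_valP.
- move=> j x; have jI := enum_valP j; rewrite /reemb !inE.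
  case: ifP => hx; first by rewrite hA // inE jI hx.
  case: ifP => hx'; last by rewrite hB ?orbT // inE jI hx hx'.
  by case: (F _ x) hx' => //= t ->; rewrite orbT.
move=> j j' x y; have jI := enum_valP j; have jI' := enum_valP j'.
have h u z : u \in I -> [\/ inA (F u z) /\ reemb gA gB u z = gA (u, z) /\ (u, z) \in pA,
   exists t, [/\ F u z = inl t, reemb gA gB u z = t & t \in Low] |
   (u, z) \in pB /\ reemb gA gB u z = gB (u, z)].
  move=> uI; rewrite /reemb; case: ifP => hz; first by apply: Or31; rewrite inE uI hz.
  case: ifP => hz'; last by apply: Or33; rewrite inE uI hz hz'.
  by apply: Or32; case: (F u z) hz' => //= t tL; exists t.
have fin u z u' z' : (u, z) = (u', z') -> u = enum_val j -> u' = enum_val j' -> z = x -> z' = y -> j = j' /\ x = y.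
  by move=> [-> ->] e1 e2 <- <-; split=> //; apply: enum_val_inj; rewrite -e1 -e2.
have nAL t : t \in XA -> t \in Low -> False by move=> h1 h2; have := disjointFr dAL' h1; rewrite h2.
have nAB t : t \in XA -> t \in XB -> False by move=> h1 h2; have := disjointFr dAB' h1; rewrite h2.
have nLB t : t \in Low -> t \in XB -> False by move=> h1 h2; have := disjointFr dLB' h1; rewrite h2.
case: (h _ x jI) => [[_ [-> px]]|[t [et -> tL]]|[px ->]];
case: (h _ y jI') => [[_ [-> py]]|[t' [et' -> tL']]|[py ->]].
- by move/(iA _ _ px py)/fin; apply.
- by move=> e; case: (nAL t') => //; rewrite -e hA.
- by move=> e; case: (nAB (gA (enum_val j, x))); rewrite ?hA // e hB.
- by move=> e; case: (nAL t) => //; rewrite e hA.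
- move=> e; have [|e1 ->] := @Finj (enum_val j) (enum_val j') x y.
    by rewrite et et' e.
  by split=> //; apply: enum_val_inj.
- by move=> e; case: (nLB t) => //; rewrite e hB.
- by move=> e; case: (nAB (gA (enum_val j', y))); rewrite ?hA // -e hB.
- by move=> e; case: (nLB t') => //; rewrite -e hB.
- by move/(iB _ _ px py)/fin; apply.
Qed.

Lemma card_fst (J : {set 'I_N}) : #|[set p : 'I_N * H | p.1 \in J]| = #|J| * k.
Proof.
rewrite -cardsT -cardsX; apply: eq_card => -[i x]; by rewrite !inE /= andbT.
Qed.

Lemma card_pA : #|pA| <= #|I| * k.
Proof.
rewrite -card_fst; apply: subset_leq_card; apply/subsetP => p.
by rewrite !inE => /andP[].
Qed.

Lemma card_pB : #|pB| <= #|I| * k.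
Proof.
rewrite -card_fst; apply: subset_leq_card; apply/subsetP => p.
by rewrite !inE => /andP[].
Qed.

Lemma F_inj2 : injective (fun p : 'I_N * H => F p.1 p.2).
Proof. by move=> [i x] [j y] /= /Finj[-> ->]. Qed.

End Copies.

Lemma card_inA : #|[set u | inA u]| = #|A| + #|E| + k.
Proof.
have -> : #|A| + #|E| = #|A :|: E|.
  by rewrite cardsU_disj // disjoint_sym.
rewrite -sum1_card big_sumType /= big_sumType /=.
rewrite [X in _ + (_ + X)]big_pred0 ?addn0; last by move=> i; rewrite inE.
congr (_ + _); first by rewrite -[RHS]sum1_card; apply: eq_bigl => t; rewrite inE.
transitivity #|'I_k|; last exact: card_ord.
by rewrite -[RHS]sum1_card; apply: eq_bigl => t; rewrite inE.
Qed.

Lemma card_inB : #|[set u | ~~ (inA u || inL u)]| = #|B :\: Low| + d.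
Proof.
rewrite -sum1_card big_sumType /= big_sumType /=.
rewrite [X in _ + (X + _)]big_pred0 ?add0n; last by move=> i; rewrite inE.
congr (_ + _); last first.
  transitivity #|'I_d|; last exact: card_ord.
  by rewrite -[RHS]sum1_card; apply: eq_bigl => t; rewrite inE.
rewrite -[RHS]sum1_card; apply: eq_bigl => t; rewrite !inE /= !inE.
by case: (t \in A); case: (t \in E); case: (t \in Low).
Qed.

Lemma packs_hc b q X : packs b k q X -> hc b q X.
Proof.
case=> Y YX pY; apply: hcS YX _; rewrite -[q]muln1; apply: hc_part pY _ => S' _ [cS eS].
by apply: hc_clique; rewrite ?eS.
Qed.

(** Up to [K1] of the copies that leave the clique on [A], [E] and ['I_k] are moved into [A], [Low]
    and [Sred]; what is left of [A], together with [E], is tiled by [c]-cliques. *)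
Lemma ext_red (F : 'I_n.+1 -> H -> ext) :
  (forall i j x y, F i x = F j y -> i = j /\ x = y) ->
  (forall i x y, adj x y -> ext_col (F i x) (F i y) = c) -> False.
Proof.
move=> Finj Fe.
have [h0 _] : exists h : H, true by case/card_gt0P: k0 => h _; exists h.
have [t0 _] : exists t : T, true.
  have h2 : 2 * n <= k * n by rewrite leq_mul2r k1 orbT.
  have : 0 < #|A| by plia.
  by case/card_gt0P => t _; exists t.
pose Z := [set i | [exists x, ~~ inA (F i x)]].
have [I IZ eI] : exists2 I : {set 'I_n.+1}, I \subset Z & #|I| = minn #|Z| K1.
  by apply: subset_of_card; apply: geq_minl.
have hpA := card_pA F I; have hpB := card_pB F I.
have IK : #|I| <= K1 by rewrite eI geq_minr.
have IkK : #|I| * k <= k * K1 by rewrite mulnC leq_mul2l IK orbT.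
have [XA XAA [cXA eXA]] := cliqueA (leq_trans hpA IkK).
have [|gA hA iA] := @inj_into _ _ t0 (pA F I) XA; first by rewrite eXA.
have [gB hB iB] := @inj_into _ _ t0 (pB F I) Sred (leq_trans hpB (leq_trans IkK cardSred)).
have h1 : hc c #|I| (XA :|: (Low :|: Sred)).
  apply: (@reembP _ F Finj I t0 c gA gB) => // i x y iI xy.
  have := Fe i x y xy; rewrite /ext_col /reemb.
  have mA z : inA (F i z) -> (i, z) \in pA F I by move=> h; rewrite inE iI h.
  have mB z : inA (F i z) = false -> inL (F i z) = false -> (i, z) \in pB F I.
    by move=> h h'; rewrite inE iI h h'.
  case hx: (inA (F i x)); case hy: (inA (F i y)) => /=.
  - move=> _; apply: cXA; [exact/hA/mA|exact/hA/mA|].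
    apply/negP => /eqP/(iA _ _ (mA _ hx) (mA _ hy)) [exy].
    by move: xy; rewrite exy adj_irrefl.
  - by case: (c).
  - by case: (c).
  case lx: (inL (F i x)); case ly: (inL (F i y)) => /=.
  - by case: (F i x) lx => //= s _; case: (F i y) ly.
  - move=> _; case: (F i x) lx => //= s sL; apply: joinSred => //.
    by apply: hB; apply: mB.
  - move=> _; rewrite col_sym; case: (F i y) ly => //= s sL; apply: joinSred => //.
    by apply: hB; apply: mB.
  - by case: (c).
have h2 := tileA XAA (leq_trans (eq_leq eXA) (leq_trans hpA IkK)).
have {}h2 := packs_hc h2.
have dis : [disjoint XA :|: (Low :|: Sred) & A :\: XA :|: E].
  rewrite disjUr; apply/andP; split.
    rewrite !disjUl disjDr /=; apply/andP; split.
      by rewrite disjoint_sym; apply: disjointWl dAL; apply: subsetDl.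
    by rewrite disjoint_sym; apply: disjointW dAS => //; apply: subsetDl.
  rewrite !disjUl; apply/and3P; split.
  - by rewrite disjoint_sym; apply: disjointWr dAE.
  - by rewrite disjoints_subset; apply: subset_trans LB _; rewrite setCS subsetUr.
  - rewrite disjoints_subset; apply: subset_trans SredS (subset_trans SB _).
    by rewrite setCS subsetUr.
apply: (nh (b := c)); apply: hc_le (hcS (subsetT _) (hc_cat h1 h2 dis)).
rewrite cardsD_sub // eXA -leq_subLR leq_divRL //.
have XAle : #|pA F I| <= #|A| by rewrite -eXA subset_leq_card.
(* If more than [K1] copies leave the clique, each of the [K1] chosen ones has a vertex outside it,
   which makes up for the deficit of [A]. Otherwise all of them are moved, and the [k] new vertices
   account for just one of the remaining copies. *)
have [ZK|KZ] := leqP #|Z| K1; last first.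
  have {}eI : #|I| = K1 by rewrite eI; apply/minn_idPr/ltnW.
  have : #|pA F I| + #|I| <= #|I| * k.
    rewrite -card_fst; pose w i := odflt h0 [pick x | ~~ inA (F i x)].
    have hw i : i \in I -> ~~ inA (F i (w i)).
      move/(subsetP IZ); rewrite inE => /existsP[x hx]; rewrite /w.
      by case: pickP => [//|/(_ x)]; rewrite hx.
    rewrite -(card_imset I (f := fun i => (i, w i))); last by move=> i j [].
    rewrite -cardsU_disj; last first.
      rewrite disjoint_sym disjoints_subset; apply/subsetP => p /imsetP[i iI ->].
      by rewrite !inE negb_and (hw i iI) orbT.
    apply: subset_leq_card; apply/subsetP => p /setUP[|/imsetP[i iI ->]]; rewrite !inE //.
    by case/andP.
  rewrite eI => h; have : (n - K1) * k + K1 * k = k * n by rewrite -mulnDl subnK // mulnC.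
  plia.
have {}eI : #|I| = #|Z| by rewrite eI; apply/minn_idPl.
have {}eI : I = Z by apply/eqP; rewrite eqEcard IZ eI leqnn.
rewrite eI in hpA hpB h1 h2 dis IK IkK XAle hA hB iA iB eXA *.
have : #|pA F Z| + #|~: Z| * k <= #|A| + #|E| + k.
  rewrite -card_inA -card_fst -cardsU_disj; last first.
    by rewrite disjoints_subset; apply/subsetP => p; rewrite !inE => /andP[->].
  rewrite -(card_imset _ (F_inj2 Finj)); apply: subset_leq_card.
  apply/subsetP => u /imsetP[p /setUP[|] + ->]; rewrite inE; first by rewrite inE => /andP[].
  rewrite !inE negb_exists => /forallP/(_ p.2); by rewrite negbK.
have := cardsC Z; rewrite card_ord => hZ h.
have [nZ|Zn] := leqP n #|Z|; first by rewrite (eqP nZ) mul0n.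
have : (n - #|Z|) * k + k <= #|~: Z| * k.
  by rewrite -mulSnr leq_mul2r; apply/orP; right; plia.
move: h XAle; move: ((n - #|Z|) * k) (#|~: Z| * k) => u v; plia.
Qed.

Lemma common_nbr X Y : X \subset B -> Y \subset A ->
  #|Y| <= #|[set y in Y | [forall x in X, col y x == ~~ c]]| + #|X| * D1.
Proof.
move=> XB YA.
rewrite -(cardsID [set y | [forall x in X, col y x == ~~ c]] Y).
have -> : Y :&: [set y | [forall x in X, col y x == ~~ c]] =
    [set y in Y | [forall x in X, col y x == ~~ c]].
  by apply/setP => y; rewrite !inE.
rewrite leq_add2l; apply: (@leq_trans #|\bigcup_(x in X) (A :&: nbr c x)|).
  apply: subset_leq_card; apply/subsetP => y /setDP[yY].
  rewrite inE => /forall_inPn[x xX hx]; apply/bigcupP; exists x => //.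
  rewrite !inE (subsetP YA _ yY) /=; apply/andP; split.
    apply: contraTneq (subsetP XB _ xX) => <-.
    by rewrite !inE (subsetP YA _ yY).
  by move: hx; rewrite col_sym; case: (col _ _); case: (c).
apply: (@leq_trans (\sum_(x in X) #|A :&: nbr c x|)).
  elim/big_rec2: _ => [|x u Z _ h]; first by rewrite cards0.
  by apply: leq_trans (cardsU_le _ _) _; rewrite leq_add2l.
rewrite -sum_nat_const; apply: leq_sum => x xX; apply: degB; exact: (subsetP XB).
Qed.

Lemma tiles_hc q X Y : part (kclique (~~ c) d) q X -> X \subset B -> Y \subset A ->
  a * q + k * D1 <= #|Y| -> hc (~~ c) q (X :|: Y).
Proof.
move=> pX; elim: pX Y => [|{}q {}X S' [cS eS] dS pX IH] Y XB YA hY; first exact: hc0.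
move: XB; rewrite subUset => /andP[S'B XB].
have := common_nbr S'B YA; rewrite eS => h.
have [|Y1 Y1s eY1] := @subset_of_card _ [set y in Y | [forall x in S', col y x == ~~ c]] a.
  have h' : d * D1 <= k * D1 by rewrite leq_mul2r leq_subr orbT.
  by rewrite mulnS in hY; plia.
have Y1Y : Y1 \subset Y by apply: subset_trans Y1s _; apply/subsetP => y; rewrite inE => /andP[].
have dBA W W' : W \subset B -> W' \subset A -> [disjoint W & W'].
  move=> WB W'A; rewrite disjoints_subset; apply: subset_trans WB _.
  by rewrite setCS; apply: subset_trans W'A (subsetUl _ _).
rewrite -add1n; apply: (@hc_add _ _ _ _ _ _ (Y1 :|: S') (X :|: (Y :\: Y1))).
- apply: hc_alpha => //; rewrite ?eY1 ?eS //.
    move=> y x /(subsetP Y1s); rewrite inE => /andP[_ /forall_inP hy] /hy/eqP //.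
  by rewrite disjoint_sym; apply: dBA => //; apply: subset_trans Y1Y YA.
- apply: IH => //; first exact: subset_trans (subsetDl _ _) YA.
  by rewrite cardsD_sub // eY1 mulnS in hY *; plia.
- rewrite disjUl !disjUr disjDr dS andbT /=; apply/andP; split.
    by rewrite disjoint_sym; apply: dBA => //; apply: subset_trans Y1Y YA.
  by apply: dBA => //; apply: subset_trans (subsetDl _ _) YA.
- by rewrite subUset -setUA subsetUl andbT !setUA (subset_trans Y1Y) // subsetUr.
- by rewrite setUSS ?subsetUr ?subsetDl.
Qed.

(** A [~~ c]-copy meets the [c]-clique on [A], [E] and ['I_k] in an independent set, so it has at
    least [d] vertices elsewhere. The few copies meeting [Low] are moved; the others are replaced by
    tiles of [B], each completed by [a] vertices of [A]. *)
Lemma ext_blue (F : 'I_n.+1 -> H -> ext) :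
  (forall i j x y, F i x = F j y -> i = j /\ x = y) ->
  (forall i x y, adj x y -> ext_col (F i x) (F i y) = ~~ c) -> False.
Proof.
move=> Finj Fe.
have [h0 _] : exists h : H, true by case/card_gt0P: k0 => h _; exists h.
have [t0 _] : exists t : T, true.
  have h2 : 2 * n <= k * n by rewrite leq_mul2r k1 orbT.
  have : 0 < #|A| by plia.
  by case/card_gt0P => t _; exists t.
pose Z := [set i | [exists x, inL (F i x)]].
have hZ : #|Z| <= #|Low|.
  pose w i := odflt h0 [pick x | inL (F i x)].
  have hw i : i \in Z -> inL (F i (w i)).
    rewrite inE => /existsP[x hx]; rewrite /w.
    by case: pickP => [//|/(_ x)]; rewrite hx.
  pose v i := if F i (w i) is inl t then t else t0.
  rewrite -(card_in_imset (D := Z) (f := v)).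
    apply: subset_leq_card; apply/subsetP => t /imsetP[i /hw iZ ->].
    by rewrite /v; case: (F i (w i)) iZ.
  move=> i j /hw iZ /hw jZ; rewrite /v.
  case ei: (F i (w i)) iZ => [s|//] _; case ej: (F j (w j)) jZ => [t|//] _ e.
  by have [] := @Finj i j (w i) (w j); rewrite ?ei ?ej ?e.
have indep i : #|[set x | inA (F i x)]| <= a.
  apply: alpha_max; apply/forall_inP => x; rewrite inE => hx.
  apply/forall_inP => y; rewrite inE => hy; apply/negP => /(Fe i).
  by rewrite /ext_col hx hy /=; case: (c).
have hpA := card_pA F Z; have hpB := card_pB F Z.
have ZK : #|Z| <= K2 := leq_trans hZ cardLow.
have ZkK : #|Z| * k <= k * K2 by rewrite mulnC leq_mul2l ZK orbT.
(* Every moved copy receives its own [~~ c]-clique in [S], labelled by the vertices of [H]; a copy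
   of [complete H] is such a labelling. *)
have [h [hi hS hcl]] : @has_copies (complete H) T col (~~ c) #|Z| S.
  case: (cliquesS) => Y YS pY; apply: hcS YS _; apply: hc_le ZK _.
  rewrite -[K2]muln1; apply: hc_part pY _ => S' _ [cS eS].
  by apply: hc_clique => //; rewrite eS.
pose gB (p : 'I_n.+1 * H) :=
  if [pick j : 'I_#|Z| | enum_val j == p.1] is Some j then h j p.2 else t0.
have gBE i x : i \in Z -> exists2 j, gB (i, x) = h j x & enum_val j = i.
  move=> iZ; rewrite /gB; case: pickP => [j /eqP e|/(_ (enum_rank_in iZ i))].
    by exists j.
  by rewrite enum_rankK_in ?eqxx.
have iB : {in pB F Z &, injective gB}.
  move=> [i x] [j y]; rewrite inE => /andP[iZ _]; rewrite inE => /andP[jZ _].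
  have [i' ei hi'] := gBE i x iZ; have [j' ej hj'] := gBE j y jZ.
  by rewrite ei ej => /hi[ij ->]; rewrite -hi' -hj' ij.
pose XB := gB @: pB F Z.
have hB : {in pB F Z, forall p, gB p \in XB} by move=> p hp; apply: imset_f.
have XBS : XB \subset S.
  apply/subsetP => t /imsetP[[i x]]; rewrite inE => /andP[iZ _] ->.
  by have [j -> _] := gBE i x iZ; apply: hS.
have eXB : #|XB| = #|pB F Z| by apply: card_in_imset.
have XBB := subset_trans XBS SB.
have LXB : Low :|: XB \subset B by rewrite subUset LB.
have h2n : 2 * n <= k * n by rewrite leq_mul2r k1 orbT.
have hk2 : K2 <= k * K2 by rewrite leq_pmull.
pose A1 := [set y in A | [forall x in Low :|: XB, col y x == ~~ c]].
have hA1 : #|pA F Z| <= #|A1|.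
  have := common_nbr LXB (subxx A); rewrite -/A1.
  have : #|Low :|: XB| * D1 <= K2 * D1 + k * K2 * D1.
    rewrite -mulnDl leq_mul2r; apply/orP; right; apply: leq_trans (cardsU_le _ _) _.
    by rewrite leq_add // eXB (leq_trans hpB).
  have : K2 * D1 <= k * K2 * D1 by rewrite leq_mul2r hk2 orbT.
  move: hpA ZkK cardn cardA h2n.
  move: (#|Low :|: XB| * D1) (k * K2 * D1) (K2 * D1) (k * K2) (k * D1) => u1 u2 u3 u4 u5.
  by move: (#|Z| * k) (k * n) => u6 u7; plia.
have [XA XAA1 eXA] := subset_of_card hA1.
have XAA : XA \subset A by apply: subset_trans XAA1 _; apply/subsetP => y; rewrite inE => /andP[].
have jXA : joined (~~ c) XA (Low :|: XB).
  by move=> y x /(subsetP XAA1); rewrite inE => /andP[_ /forall_inP hy] /hy/eqP.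
have [|gA hA iA] := @inj_into _ _ t0 (pA F Z) XA; first by rewrite eXA.
have h1 : hc (~~ c) #|Z| (XA :|: (Low :|: XB)).
  apply: (@reembP _ F Finj Z t0 (~~ c) gA gB) => // i x y iZ xy.
  have := Fe i x y xy; rewrite /ext_col /reemb.
  have mA z : inA (F i z) -> (i, z) \in pA F Z by move=> hz; rewrite inE iZ hz.
  have mB z : inA (F i z) = false -> inL (F i z) = false -> (i, z) \in pB F Z.
    by move=> hz hz'; rewrite inE iZ hz hz'.
  have LB' z : inA (F i z) = false ->
      (if inL (F i z) then if F i z is inl t then t else t0 else gB (i, z)) \in Low :|: XB.
    move=> hz; rewrite inE; case: ifP => hz'; last by rewrite hB ?orbT //; apply: mB.
    by case: (F i z) hz' => //= t ->.
  case hx: (inA (F i x)); case hy: (inA (F i y)) => /=.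
  - by case: (c).
  - by move=> _; apply: jXA; [exact/hA/mA|exact: LB'].
  - by move=> _; rewrite col_sym; apply: jXA; [exact/hA/mA|exact: LB'].
  case lx: (inL (F i x)); case ly: (inL (F i y)) => /=.
  - by case: (F i x) lx => //= s _; case: (F i y) ly.
  - by case: (c).
  - by case: (c).
  - move=> _; have [j -> ej] := gBE i x iZ; have [j' -> ej'] := gBE i y iZ.
    have -> : j' = j by apply: enum_val_inj; rewrite ej ej'.
    apply: hcl; rewrite /= /neq_rel; apply: contraTneq xy => ->.
    by rewrite adj_irrefl.
have eZ : #|Z| + #|~: Z| = n.+1 by rewrite cardsC card_ord.
(* Each copy avoiding [Low] has at least [d] vertices in [B] or ['I_d], and the [d] new vertices
   account for just one copy. *)
have hcount : #|pB F Z| + #|~: Z| * d <= #|B :\: Low| + d.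
  pose PA := [set p : 'I_n.+1 * H | (p.1 \in ~: Z) && inA (F p.1 p.2)].
  pose PB := [set p : 'I_n.+1 * H | (p.1 \in ~: Z) && ~~ inA (F p.1 p.2)].
  have e1 : #|PA| <= #|~: Z| * a.
    rewrite -sum_nat_const -sum1_card.
    rewrite (eq_bigl (fun p : 'I_n.+1 * H => (p.1 \in ~: Z) && (p.2 \in [set x | inA (F p.1 x)]))); last first.
      by move=> p; rewrite !inE.
    rewrite -(pair_big_dep (mem (~: Z)) (fun i x => x \in [set x | inA (F i x)]) (fun _ _ => 1)) /=.
    by apply: leq_sum => i _; rewrite sum1_card; apply: indep.
  have e2 : #|~: Z| * k <= #|PA| + #|PB|.
    rewrite -card_fst; apply: leq_trans (cardsU_le _ _); apply: subset_leq_card.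
    by apply/subsetP => p; rewrite !inE => ->; rewrite /= orbN.
  have e3 : #|pB F Z| + #|PB| <= #|B :\: Low| + d.
    rewrite -card_inB -cardsU_disj; last first.
      by rewrite disjoints_subset; apply/subsetP => p; rewrite !inE => /andP[->].
    rewrite -(card_imset _ (F_inj2 Finj)); apply: subset_leq_card.
    apply/subsetP => u /imsetP[p /setUP[|] + ->]; rewrite inE; first by rewrite inE => /andP[].
    rewrite !inE negb_exists negb_or => /andP[/forallP/(_ p.2) -> ->] //.
  have : #|~: Z| * k = #|~: Z| * a + #|~: Z| * d by rewrite -mulnDr -kad.
  plia.
have [nZ|Zn] := leqP n #|Z|.
  by apply: (nh (b := ~~ c)); apply: hc_le nZ _; apply: hcS (subsetT _) h1.
have h2 := tileB XBS (leq_trans (eq_leq eXB) (leq_trans hpB ZkK)).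
have [|YB YBs pYB] := packs_le_n (q' := n - #|Z|) _ h2.
  rewrite leq_divRL // cardsD_sub; last first.
    rewrite subsetD XBB /= disjoint_sym -setI_eq0 setIC setI_eq0 disjoint_sym.
    by rewrite disjoint_sym; apply: disjointWl dSL.
  rewrite eXB; have : (n - #|Z|) * d + d = #|~: Z| * d by rewrite -mulSnr; congr (_ * _); plia.
  by plia.
have YBB : YB \subset B.
  by apply: subset_trans YBs (subset_trans (subsetDl _ _) (subsetDl _ _)).
have h3 : hc (~~ c) (n - #|Z|) (YB :|: A :\: XA).
  apply: tiles_hc => //; first exact: subsetDl.
  rewrite cardsD_sub // eXA.
  have : a * (n - #|Z|) <= a * n by rewrite leq_mul2l leq_subr orbT.
  have : k * n = a * n + d * n by rewrite -mulnDl -kad.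
  have : n <= d * n by rewrite leq_pmull.
  move: cardA cardn hpA ZkK; move: (a * (n - #|Z|)) (a * n) (k * n) (d * n) => u1 u2 u3 u4.
  by move: (k * D1) (k * K2 * D1) (k * K2) (#|Z| * k) => u5 u6 u7 u8; plia.
have dBA W W' : W \subset B -> W' \subset A -> [disjoint W & W'].
  move=> WB W'A; rewrite disjoints_subset; apply: subset_trans WB _.
  by rewrite setCS; apply: subset_trans W'A (subsetUl _ _).
apply: (nh (b := ~~ c)); rewrite -(subnKC (ltnW Zn)).
apply: hcS (subsetT _) (hc_cat h1 h3 _).
rewrite disjUr; apply/andP; split.
  rewrite disjUl disjoint_sym dBA //= disjoint_sym; apply: disjointWl YBs _.
  rewrite setDDl; exact: disjDl.
rewrite disjUl disjDr /=; apply: dBA => //; exact: subsetDl.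
Qed.

Lemma extension : exists (T' : finType) (col' : T' -> T' -> bool),
  [/\ symmetric col', #|T'| = #|T| + (k + d) & forall b, ~ @has_copies H T' col' b n.+1 setT].
Proof.
exists ext, ext_col; split; [exact: ext_col_sym|exact: card_ext|].
move=> b [F [Fi _ Fe]]; have [e|e] := eqVneq b c.
  by apply: (ext_red Fi) => i x y xy; rewrite (Fe i x y xy).
apply: (ext_blue Fi) => i x y xy; rewrite (Fe i x y xy).
by case: (b) (c) e => -[].
Qed.

End Extend.

(** * The lower step *)

Section Step.
Variable H : sgraph.
Local Notation k := #|H|.
Local Notation d := (#|H| - alpha H).
Hypothesis k1 : 1 < k.
Hypothesis noiso : no_isolated H.

Let k0 : 0 < k. Proof. exact: ltnW. Qed.
Let d0 : 0 < d. Proof. exact: d_gt0. Qed.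
Let dk : d <= k. Proof. exact: leq_subr. Qed.

(* All bounds are rounded up to powers of [2 ^ k]; the constant 60 is what this
   crude estimate yields. *)
Definition pw j := 2 ^ (j * k).

Lemma pwE i j : i = j * k -> 2 ^ i = pw j. Proof. by move->. Qed.
Lemma pw_le i j : i <= j -> pw i <= pw j.
Proof. by move=> ij; rewrite leq_exp2l // leq_mul2r ij orbT. Qed.
Lemma pw_gt0 j : 0 < pw j. Proof. by rewrite expn_gt0. Qed.
Lemma pwM i j : pw i * pw j = pw (i + j).
Proof. by rewrite /pw -expnD mulnDl. Qed.
Lemma pw4 j : 4 * pw j <= pw j.+1.
Proof.
have -> : pw j.+1 = pw 1 * pw j by rewrite pwM add1n.
rewrite leq_mul2r; apply/orP; right.
by rewrite /pw mul1n (leq_exp2l 2 _ (isT : 1 < 2)).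
Qed.
Lemma pwk j : k * pw j <= pw j.+1.
Proof.
have -> : pw j.+1 = pw 1 * pw j by rewrite pwM add1n.
rewrite leq_mul2r; apply/orP; right.
by rewrite /pw mul1n ltnW // ltn_expl.
Qed.
Lemma k_pw1 : k <= pw 1. Proof. by rewrite /pw mul1n ltnW // ltn_expl. Qed.
Lemma pwd : 2 ^ (k + d) <= pw 2.
Proof. by rewrite leq_exp2l // mul2n -addnn leq_add2l. Qed.

Section Colour.
Variables (T : finType) (col : T -> T -> bool).
Hypothesis col_sym : symmetric col.
Implicit Types (S X Y Z Q R A B V W : {set T}) (b : bool).
Local Notation joined := (@joined T col).
Local Notation kclique := (@kclique T col).
Local Notation cfree := (@cfree T col).
Local Notation nbr := (@nbr T col).
Local Notation hc := (@has_copies H T col).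
Local Notation packs := (@packs T col).

(** * The data of the extension around a near-clique *)

Section Core.
Variables (c : bool) (A : {set T}) (n : nat).
Hypothesis nh : forall b, ~ hc b n setT.
Hypothesis hn : pw 60 <= n.
Hypothesis hT : (k + d) * n <= #|T| + 2.
Hypothesis cardA : k * n <= #|A| + pw 19.
Hypothesis degA : {in A, forall x, #|A :&: nbr (~~ c) x| < pw 8}.

(** The threshold lets such a vertex be attached to a [c]-clique of [A] even after [k * pw 19]
    vertices are deleted; below it, [pw 22] serves as the degree bound [D1]. *)
Definition red_att := [set v | (v \notin A) && (pw 22 <= #|A :&: nbr c v|)].
Local Notation E := red_att.
Local Notation B := (~: (A :|: E)).

Lemma red_att_disj : [disjoint E & A].
Proof.
by rewrite disjoints_subset; apply/subsetP => v; rewrite !inE => /andP[].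
Qed.

Lemma card_A : pw 60 <= #|A| + pw 19.
Proof. by apply: leq_trans cardA; apply: leq_trans hn _; rewrite leq_pmull. Qed.

Lemma near_size : (k * (k * pw 8) + k + pw 8) * pw 8 <= pw 20.
Proof.
have h : k * (k * pw 8) + k + pw 8 <= pw 12.
  have := leq_trans (leq_mul (leqnn k) (pwk 8)) (pwk 9).
  have := k_pw1; have := pw_le (isT : 1 <= 10); have := pw_le (isT : 8 <= 10).
  by have := pw4 10; have := pw_le (isT : 11 <= 12); lia.
by apply: leq_trans (leq_mul h (leqnn _)) _; rewrite pwM.
Qed.

(** Stated for small [E'], because the bound on the whole of [E] in [card_att] is itself derived
    from this tiling. *)
Lemma tile_sub (E' X : {set T}) : E' \subset E -> #|E'| <= pw 19 -> X \subset A ->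
  #|X| <= k * pw 19 ->
  packs c k ((#|A :\: X| + #|E'|) %/ k) (A :\: X :|: E').
Proof.
move=> EE hE XA hX.
have p19 := pwk 19; have p20 := pw4 20; have p21 := pw4 21.
have hk : k * #|E'| <= k * pw 19 by rewrite leq_mul2l hE orbT.
apply: (@near_tiling _ _ col_sym c k (pw 8) A) => //.
- exact: pw_gt0.
- exact: subsetDl.
- exact: disjointWl red_att_disj.
- move=> v /(subsetP EE); rewrite inE => /andP[_ hv].
  have h : #|A :&: nbr c v| <= #|(A :\: X) :&: nbr c v| + #|X|.
    apply: leq_trans (cardsU_le _ _); apply: subset_leq_card.
    apply/subsetP => z; rewrite in_setI in_setU in_setI in_setD => /andP[-> ->].
    by rewrite !andbT orNb.
  have := pwk 8; have := pw_le (isT : 9 <= 20).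
  move: hk hX hv h p19 p20 p21; move: (k * #|E'|) (k * pw 19) (k * pw 8) => u v' w.
  by move: (pw 20) (pw 21) (pw 22) (pw 9) => *; plia.
- have h1 := near_size; have h2 := card_A.
  have h3 := pw_le (isT : 22 <= 60); have h4 := pw_le (isT : 19 <= 20).
  rewrite cardsD_sub //; move: hk hX h1 h2 h3 h4 p19 p20 p21.
  move: (k * #|E'|) (k * pw 19) ((k * (k * pw 8) + k + pw 8) * pw 8) => u v w.
  by move: (pw 20) (pw 21) (pw 22) (pw 60) (pw 19) => *; plia.
Qed.

(** [A] is at most [pw 19] vertices short of [k * n]; that many vertices of [E] would complete a
    tiling with [n] cliques. *)
Lemma card_att : #|E| <= pw 19.
Proof.
rewrite leqNgt; apply/negP => /ltnW/subset_of_card[E' EE eE'].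
have [||||] := @tile_sub E' set0; rewrite ?sub0set ?cards0 ?eE' //.
move=> X XA pX; apply: (nh (b := c)); apply: hcS (subsetT X) _.
have h := @packs_hc H k1 _ _ col_sym c _ _ (ex_intro2 _ _ X (subxx X) pX).
by apply: hc_le h; rewrite setD0 leq_divRL // mulnC.
Qed.

Lemma card_AE : #|A| + #|E| < k * n.
Proof.
rewrite ltnNge; apply/negP => h; apply: (nh (b := c)).
have := tile_sub (subxx E) card_att (sub0set A); rewrite cards0 setD0 => /(_ isT).
move/(@packs_hc H k1 _ _ col_sym c)=> h2.
by apply: hcS (subsetT _) (hc_le _ h2); rewrite leq_divRL // mulnC.
Qed.

Lemma red_in_B q X : X \subset B -> part (kclique c k) q X -> q < pw 19.
Proof.
move=> XB pX; rewrite ltnNge; apply/negP => h; apply: (nh (b := c)).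
have := @tile_sub set0 set0 (sub0set _); rewrite !cards0 !sub0set => /(_ isT isT isT).
rewrite setD0 setU0 addn0 => /(@packs_hc H k1 _ _ col_sym c) h2.
have h3 : hc c q X.
  by apply: (@packs_hc H k1 _ _ col_sym c); exists X.
apply: hcS (subsetT (A :|: X)) (hc_le _ (hc_cat h2 h3 _)); last first.
  rewrite disjoint_sym disjoints_subset; apply: subset_trans XB _.
  by rewrite setCS subsetUl.
have h4 : n - pw 19 <= #|A| %/ k.
  rewrite leq_divRL //; have : pw 19 <= k * pw 19 by rewrite leq_pmull.
  rewrite mulnBl mulnC (mulnC (pw 19)); move: cardA; move: (k * n) (k * pw 19) => u v.
  by plia.
by plia.
Qed.

Lemma B_large : exists S : {set T}, [/\ S \subset B, cfree c k S, pw 46 <= #|S| <= pw 50 &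
  {in S, forall x, 16 * #|S :&: nbr c x| <= #|S|}] /\
  (forall X, X \subset B -> pw 21 <= #|X| -> ~ (forall Y, Y \subset X -> ~ kclique (~~ c) d Y)).
Proof.
have [|q [R [RB pR mR]]] := @part_max _ (kclique c k) B.
  by move=> S [_ eS]; rewrite -card_gt0 eS.
have hq := red_in_B RB pR.
have cR : #|R| = q * k by apply: part_card pR => S [].
have hR : #|R| <= pw 20.
  by rewrite cR mulnC; apply: leq_trans (pwk 19); rewrite leq_mul2l (ltnW hq) orbT.
have fR : cfree c k (B :\: R) by [].
have hB : pw 50 <= #|B :\: R|.
  rewrite cardsD_sub // cardsCs setCK cardsU_disj 1?disjoint_sym ?red_att_disj //.
  have h1 := card_AE; have : n <= d * n by rewrite leq_pmull.
  have := pw4 50; have := pw_le (isT : 51 <= 60); have := pw_le (isT : 20 <= 50).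
  have := pw4 0; have := pw_le (isT : 1 <= 50); have := pw_gt0 0.
  move: hT; rewrite mulnDl; move: h1 hn hR; move: (k * n) (d * n) (pw 51) (pw 1) (pw 0) => *.
  by plia.
(* Cutting down to exactly [pw 50] vertices makes the number of absorber rounds at most
   [50 * k + 1], whatever [n] is. *)
have [B1 B1B eB1] := subset_of_card hB.
have [||S [SB1 hS dS]] := @dense_spot _ _ col_sym (~~ c) k (pw 46) B1.
- by rewrite negbK; apply: cfreeS fR.
- have -> : 16 ^ k = pw 4 by rewrite /pw expnM.
  by rewrite eB1 pwM.
exists S; rewrite negbK in dS; split; first split=> //.
- by apply: subset_trans SB1 (subset_trans B1B (subsetDl _ _)).
- by apply: cfreeS fR; apply: subset_trans SB1 B1B.
- by rewrite hS -eB1 subset_leq_card.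
move=> X XB hX nX.
have [||Y YX kY] := @ramsey_sub _ _ col_sym c k d (X :\: R).
- apply: leq_trans pwd _; rewrite cardsD; have := subset_leq_card (subsetIr X R).
  have := pw4 20; have := pw_le (isT : 2 <= 20).
  by move: hX hR; move: (pw 20) (pw 21) (pw 2) => *; plia.
- by apply: cfreeS fR; apply: setSD.
by apply: (nX Y) => //; apply: subset_trans YX (subsetDl _ _).
Qed.

Lemma near_clique_extension : exists (T' : finType) (col' : T' -> T' -> bool),
  [/\ symmetric col', #|T'| = #|T| + (k + d) & forall b, ~ @has_copies H T' col' b n.+1 setT].
Proof.
have [S [[SB fS /andP[S46 S50] dS] hB]] := B_large.
have [|q [P [PB pP mP]]] := @part_max _ (kclique (~~ c) d) (B :\: S).
  by move=> Y [_ eY]; rewrite -card_gt0 eY.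
set L := B :\: S :\: P in mP.
have LB : L \subset B by apply: subset_trans (subsetDl _ _) (subsetDl _ _).
have hL : #|L| <= pw 21.
  by rewrite leqNgt; apply/negP => /ltnW h; apply: (hB L).
(* These leftover vertices have too few [~~ c]-neighbours in the spot to be attached to tiles; the
   rest of [L] will be attached. *)
pose Lo := [set v in L | #|S :&: nbr (~~ c) v| < pw 24].
have LoL : Lo \subset L by apply/subsetP => v; rewrite inE => /andP[].
have LoB := subset_trans LoL LB.
have hLo : #|Lo| <= pw 21 by apply: leq_trans hL; apply: subset_leq_card.
have dLS : [disjoint L & S].
  by apply: disjointWl (subsetDl _ _) (disjDl _ _).
have dSLo : [disjoint S & Lo] by rewrite disjoint_sym; apply: disjointWl dLS.
pose Sred := S :\: \bigcup_(v in Lo) nbr (~~ c) v.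
have cSred : k * pw 19 <= #|Sred|.
  have : #|S| <= #|Sred| + #|Lo| * pw 24.
    rewrite -(cardsID (\bigcup_(v in Lo) nbr (~~ c) v) S) addnC leq_add2l.
    rewrite big_distrr /=.
    apply: (@leq_trans (\sum_(v in Lo) #|S :&: nbr (~~ c) v|)).
      elim/big_rec2: _ => [|v u Z _ h]; first by rewrite cards0.
      by apply: leq_trans (cardsU_le _ _) _; rewrite leq_add2l.
    rewrite -sum_nat_const; apply: leq_sum => v.
    by rewrite inE => /andP[_ /ltnW].
  have h1 : #|Lo| * pw 24 <= pw 45 by rewrite -(pwM 21 24) leq_mul2r hLo orbT.
  have := pwk 19; have := pw4 45; have := pw_le (isT : 20 <= 45).
  move: h1 S46; move: (#|Lo| * pw 24) (k * pw 19) (pw 45) (pw 46) (pw 20) => *.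
  by plia.
have jSred : joined c Lo Sred.
  move=> v s vL; rewrite inE => /andP[/negP ns sS].
  apply: contrapT => hvs; apply: ns; apply/bigcupP; exists v => //.
  rewrite mem_nbr; apply/andP; split; last by case: (col v s) (c) hvs => -[].
  by apply: contraTneq sS => ->; rewrite (disjointFr (disjointWl LoL dLS)).
have fS' : cfree (~~ ~~ c) k S by rewrite negbK.
have g0 : 0 < 50 * k + 1 by rewrite addn1.
have hSg : #|S| < 2 ^ (50 * k + 1).
  apply: leq_ltn_trans S50 _; rewrite /pw ltn_exp2l //; lia.
(* The allowance covers the deleted set [X] and the vertices of [S] spent on attaching the rest of
   [L]. *)
have PT := @perfect_tiling _ _ col_sym (~~ c) d d0 k S fS' _ (k * pw 21 + d * pw 21) _ hSg g0.
have {}PT : forall U : {set T}, U \subset S -> #|S :\: U| <= k * pw 21 + d * pw 21 ->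
   packs (~~ c) d (#|U| %/ d) U.
  apply: PT; first by rewrite negbK.
  have h1 : 50 * k + 1 <= pw 4.
    apply: (@leq_trans (64 * k)); first by lia.
    have -> : pw 4 = pw 3 * pw 1 by rewrite pwM.
    apply: leq_mul; last exact: k_pw1.
    by rewrite /pw (leq_exp2l 6 _ (isT : 1 < 2)); lia.
  have h2 : 2 ^ (k + (d + d)) <= pw 3 by rewrite leq_exp2l //; lia.
  have h3 : 2 ^ (k + (d + d)) * (50 * k + 1) <= pw 7 by rewrite -(pwM 3 4) leq_mul.
  have h4 : k * pw 21 + d * pw 21 <= 2 * pw 22.
    by rewrite mul2n -addnn leq_add ?pwk // (leq_trans _ (pwk 21)) // leq_mul2r dk orbT.
  have h5 : d + 2 * d * (50 * k + 1) <= pw 6.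
    apply: (@leq_trans (3 * (k * pw 4))).
      have : d * (50 * k + 1) <= k * pw 4 by apply: leq_mul.
      have : k <= k * pw 4 by rewrite leq_pmulr // pw_gt0.
      rewrite -mulnA; move: (d * (50 * k + 1)) (k * pw 4) => u v; lia.
    by have := pwk 4; have := pw4 5; lia.
  have h6 : (2 ^ (k + d)).+2 <= pw 3.
    by have := pwd; have := pw4 2; have := pw4 1; have := pw_gt0 1; lia.
  have h7 : (2 ^ (k + d)).+2 * (d + 2 * d * (50 * k + 1)) <= pw 9.
    by rewrite -(pwM 3 6) leq_mul.
  apply: leq_trans S46; have := pw4 22; have := pw4 23; have := pw4 24.
  have := pw_le (isT : 25 <= 46); have := pw_le (isT : 9 <= 22); have := pw_le (isT : 7 <= 22).
  move: h3 h4 h7; clear; move: (2 ^ (k + (d + d)) * (50 * k + 1)) => u1.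
  move: ((2 ^ (k + d)).+2 * (d + 2 * d * (50 * k + 1))) (k * pw 21 + d * pw 21) => u2 u3.
  by move: (pw 22) (pw 23) (pw 24) (pw 25) (pw 46) (pw 9) (pw 7) => *; lia.
have cards2 : forall X : {set T}, X \subset S -> #|X| <= k * pw 21 ->
    packs (~~ c) d (#|B :\: Lo :\: X| %/ d) (B :\: Lo :\: X).
  move=> X XS hX.
  pose La := L :\: Lo.
  have LaL : La \subset L := subsetDl _ _.
  have hLa : #|La| <= pw 21 by apply: leq_trans hL; apply: subset_leq_card.
  have dLaS : [disjoint La & S] by apply: disjointWl dLS.
  have [|||Z ZS [eZ pZ]] := @attach_cliques _ _ col_sym (~~ c) d (2 ^ (k + d)) La (S :\: X) d0.
  - by apply: disjointWr dLaS; apply: subsetDl.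
  - move=> Y YS hY; have [||Q QY kQ] := @ramsey_sub _ _ col_sym c k d.-1 Y.
    + by apply: leq_trans hY; rewrite leq_exp2l // leq_add2l leq_pred.
    + by apply: cfreeS fS; apply: subset_trans YS (subsetDl _ _).
    by exists Q.
  - move=> v /setDP[vL]; rewrite inE vL /= -leqNgt => hv.
    have h : #|S :&: nbr (~~ c) v| <= #|(S :\: X) :&: nbr (~~ c) v| + #|X|.
      apply: leq_trans (cardsU_le _ _); apply: subset_leq_card.
      apply/subsetP => z; rewrite in_setI in_setU in_setI in_setD => /andP[-> ->].
      by rewrite !andbT orNb.
    have h1 : d * #|La| <= pw 22.
      by apply: leq_trans (pwk 21); apply: leq_mul.
    have := pwd; have := pwk 21; have := pw4 22; have := pw4 23; have := pw_le (isT : 2 <= 22).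
    move: h1 h hv hX; clear; move: (d * #|La|) (2 ^ (k + d)) (k * pw 21) => u1 u2 u3.
    by move: (pw 22) (pw 23) (pw 24) (pw 2) => *; plia.
  have ZS' : Z \subset S := subset_trans ZS (subsetDl _ _).
  pose U := S :\: X :\: Z.
  have US : U \subset S := subset_trans (subsetDl _ _) (subsetDl _ _).
  have [|W WU pW] := PT U US.
    have -> : S :\: U = X :|: Z.
      by rewrite /U setDDl setDDr setDv set0U; apply/setIidPr; rewrite subUset XS.
    apply: leq_trans (cardsU_le _ _) _; rewrite leq_add // eZ.
    by apply: leq_mul; rewrite ?leq_pred.
  have dPS : [disjoint P & S] by apply: disjointWl PB (disjDl _ _).
  have dPL : [disjoint P & L] by apply: disjDr.
  have cW : #|W| = #|U| %/ d * d by apply: part_card pW => Y [].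
  have cP : #|P| = q * d by apply: part_card pP => Y [].
  have dUZ : [disjoint U & Z] := disjDl _ _.
  have eB : B :\: Lo :\: X = P :|: ((La :|: Z) :|: U).
    have ex := subsetP XS; have ez := subsetP ZS; have ep := subsetP PB.
    have esl t : t \in S -> t \notin L by move=> h; rewrite (disjointFl dLS).
    have esp t : t \in S -> t \notin P by move=> h; rewrite (disjointFl dPS).
    have esb := subsetP SB.
    have elo t : t \in Lo -> t \in L by apply: (subsetP LoL).
    apply/setP => t; rewrite [LHS]in_setD [X in _ && X]in_setD.
    rewrite [RHS]in_setU [X in _ || X]in_setU [X in _ || (X || _)]in_setU.
    have eU : (t \in U) = [&& t \notin Z, t \notin X & t \in S] by rewrite !in_setD.
    have eLa : (t \in La) = (t \notin Lo) && (t \in L) by rewrite in_setD.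
    have eL : (t \in L) = [&& t \notin P, t \notin S & t \in B] by rewrite !in_setD.
    move/implyP: (elo t); move/implyP: (esb t); move/implyP: (esp t); move/implyP: (esl t).
    move/implyP: (ep t); move/implyP: (ez t); move/implyP: (ex t).
    rewrite eU eLa eL !in_setD.
    by case: (t \in S); case: (t \in X); case: (t \in Z); case: (t \in P);
      case: (t \in Lo); case: (t \in B).
  have dBU : [disjoint La :|: Z & U].
    by rewrite disjUl [_ && _]andbC disjoint_sym dUZ; apply: disjointWr dLaS.
  have dPU : [disjoint P & (La :|: Z) :|: U].
    by rewrite !disjUr (disjointWr LaL dPL) (disjointWr ZS' dPS) (disjointWr US dPS).
  have dLaZ : [disjoint La & Z] by apply: disjointWr dLaS.
  (* [P] and [La :|: Z] are unions of whole tiles, so rounding takes place only in [U], where the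
     tiling is perfect. *)
  have -> : #|B :\: Lo :\: X| %/ d = q + (#|La| + #|U| %/ d).
    rewrite eB cardsU_disj // cardsU_disj // cardsU_disj // cP eZ.
    have -> : q * d + (#|La| + d.-1 * #|La| + #|U|) = (q + #|La|) * d + #|U|.
      have : d = d.-1.+1 by rewrite prednK.
      by clear; move: (d.-1) => e ->; rewrite !mulnDl mulnS; nia.
    by rewrite divnMDl // addnA.
  rewrite eB; exists (P :|: ((La :|: Z) :|: W)); first by rewrite !setUS.
  apply: part_cat => //; first apply: part_cat => //.
    exact: disjointWr dBU.
  by apply: disjointWr dPU; apply: setUS.
apply: (@extension H k1 noiso T col col_sym c A E S Lo n (pw 19) (pw 21) (pw 22) nh
  red_att_disj SB LoB dSLo cardA _ _ _ _ Sred (subsetDl _ _) cSred jSred hLo cards2 _ _ _).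
- by apply: leq_trans hn; apply: pw_le.
- by apply: leq_trans hn; apply: pw_gt0.
- by move=> X XA hX; apply: tile_sub => //; apply: card_att.
- move=> j hj; apply: (near_clique col_sym (pw_gt0 8) degA (subxx A)).
  apply: (@leq_trans (pw 28)).
    rewrite -(pwM 20 8) leq_mul2r; apply/orP; right; exact: leq_trans hj (pwk 19).
  have := card_A; have := pw4 28; have := pw_le (isT : 29 <= 60); have := pw_le (isT : 19 <= 28).
  by move: (pw 28) (pw 29) (pw 60) (pw 19) => *; plia.
- have [r [Y [YS pY lY]]] := greedy col_sym k0 fS.
  have cY : #|Y| = r * k by apply: part_card pY => M [].
  apply: (@packs_le_n _ col (~~ c) k r); last by exists Y.
  rewrite -(leq_pmul2r k0); rewrite (mulnC (pw 21)).
  move: lY; rewrite cardsD_sub // cY.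
  have : 2 ^ (k + k) = pw 2 by apply: pwE; lia.
  move=> ->; have := pwk 21; have := pw4 22; have := pw_le (isT : 23 <= 46).
  have := pw_le (isT : 2 <= 22).
  move: S46; move: (k * pw 21) (r * k) (pw 22) (pw 23) (pw 46) (pw 2) => *; plia.
- move=> v; rewrite !inE negb_or => /andP[vA]; rewrite vA /= -ltnNge.
  exact: ltnW.
- have h1 : k * pw 21 * pw 22 <= pw 44 by rewrite -(pwM 22 22) leq_mul2r pwk orbT.
  have := pwk 21; have := pwk 22; have := pw_le (isT : 19 <= 44); have := pw_le (isT : 22 <= 44).
  have := pw_le (isT : 23 <= 44); have := pw4 44; have := pw_le (isT : 45 <= 60).
  move: h1 hn; move: (k * pw 21 * pw 22) (k * pw 21) (k * pw 22) => u1 u2 u3.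
  by move: (pw 44) (pw 45) (pw 60) (pw 19) (pw 22) (pw 23) => *; plia.
Qed.

End Core.

Lemma extremal_extension n : pw 60 <= n -> (k + d) * n <= #|T| + 2 -> (forall b, ~ hc b n setT) ->
  exists (T' : finType) (col' : T' -> T' -> bool),
  [/\ symmetric col', #|T'| = #|T| + (k + d) & forall b, ~ @has_copies H T' col' b n.+1 setT].
Proof.
move=> hn hT nh.
have e3 : 2 ^ (3 * k) + 3 <= pw 4.
  by rewrite -/(pw 3); have := pw4 3; have := pw4 0; have := pw_le (isT : 1 <= 3); have := pw_gt0 0; lia.
have e5 : k * (2 ^ (3 * k) + 3) <= pw 5.
  by apply: leq_trans (pwk 4); rewrite leq_mul2l e3 orbT.
have [|V [nV hV]] := @economical_free H T col col_sym k0 noiso n nh _ hT.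
  by apply: leq_trans e5 (leq_trans (pw_le _) hn).
have e7 : 2 + (k + d) * (k * (2 ^ (3 * k) + 3)) <= pw 7.
  have : (k + d) * (k * (2 ^ (3 * k) + 3)) <= 2 * pw 6.
    apply: (@leq_trans ((k + k) * pw 5)); first by apply: leq_mul => //; rewrite leq_add2l.
    by have := pwk 5; rewrite mulnDl; lia.
  have := pw4 6; have := pw4 0; have := pw_le (isT : 1 <= 6); have := pw_gt0 0.
  by move: ((k + d) * _) (pw 6) (pw 7) (pw 0) (pw 1) => *; lia.
have [||c [A [cA dA]]] := @near_clique_structure H k1 noiso T col col_sym V nV n (pw 7) nh.
- rewrite (_ : 2 ^ (6 * (4 * k)) = pw 24); last by apply: pwE; lia.
  have : n <= d * n by rewrite leq_pmull.
  have := pw4 24; have := pw_le (isT : 25 <= 60); have := pw_le (isT : 7 <= 24).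
  move: hV e7 hn; rewrite mulnDl; move: (k * n) (d * n) ((k + d) * _) => u1 u2 u3.
  by move: (pw 24) (pw 25) (pw 60) (pw 7) => *; plia.
- by move: hV e7; move: ((k + d) * n) ((k + d) * _) => *; plia.
rewrite (_ : 2 ^ (2 * (4 * k)) = pw 8) in cA dA; last by apply: pwE; lia.
rewrite (_ : 2 ^ (4 * (4 * k)) = pw 16) in cA; last by apply: pwE; lia.
apply: (@near_clique_extension c A n nh hn hT _ dA).
apply: leq_trans cA _; rewrite -addnA leq_add2l.
have := pwk 17; have := pw4 16; have := pw4 18; have := pw_le (isT : 7 <= 16).
have := pw_le (isT : 8 <= 18).
have : k * (pw 7 + pw 16) <= k * pw 17.
  rewrite leq_mul2l; apply/orP; right.
  by have := pw4 16; have := pw_le (isT : 7 <= 16); lia.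
by move: (k * _) (k * pw 17) (pw 18) (pw 19) (pw 8) => *; plia.
Qed.

End Colour.
End Step.

(** * Ramsey numbers *)

Section Ramsey.
Variable H : sgraph.
Local Notation k := #|H|.
Local Notation a := (alpha H).
Local Notation d := (#|H| - alpha H).
Local Notation r n := (ramsey (copies n H)).

(** Passes from colourings of two-element sets of ordinals to symmetric relations on any finite
    type. *)
Lemma arrows_hc n N (T : finType) (col : T -> T -> bool) : symmetric col ->
  arrows N (copies n H) -> N <= #|T| -> exists b, has_copies H col b n setT.
Proof.
move=> col_sym hN NT; pose e (i : 'I_N) := enum_val (widen_ord NT i) : T.
have ei : injective e.
  by move=> i j /enum_val_inj/(congr1 val)/= ij; apply: val_inj.
pose c := [ffun X : {set 'I_N} => [exists x in X, exists y in X, (x != y) && col (e x) (e y)]].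
have cE x y : x != y -> c [set x; y] = col (e x) (e y).
  move=> xy; rewrite ffunE; apply/idP/idP.
    case/exists_inP => u; rewrite !inE => /orP[]/eqP-> /exists_inP[v];
      rewrite !inE => /orP[]/eqP->; rewrite ?eqxx //= => /andP[_] //.
    by rewrite col_sym.
  move=> h; apply/exists_inP; exists x; rewrite ?inE ?eqxx //.
  by apply/exists_inP; exists y; rewrite ?inE ?eqxx ?orbT // xy.
have /existsP[b /existsP[f /andP[/injectiveP fi /forallP hf]]] := forallP hN c.
exists b, (fun i x => e (f (i, x))); split.
- by move=> i j x y /ei/fi[-> ->].
- by move=> i x; rewrite inE.
- move=> i x y xy; rewrite -cE.
    have /forallP/(_ (i, y))/implyP h := hf (i, x).
    by apply/eqP/h; rewrite /= /copies_adj /= eqxx.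
  by apply/negP => /eqP/fi[exy]; move: xy; rewrite exy adj_irrefl.
Qed.

Lemma not_arrows n N : ~~ arrows N (copies n H) ->
  exists col : 'I_N -> 'I_N -> bool, symmetric col /\ forall b, ~ has_copies H col b n setT.
Proof.
rewrite negb_forall => /existsP[c nh]; exists (fun x y => c [set x; y]); split.
  by move=> x y; rewrite setUC.
move=> b [f [fi _ fe]]; move/negP: nh; apply; apply/existsP; exists b.
apply/existsP; exists [ffun u : copies n H => f u.1 u.2]; apply/andP; split.
  by apply/injectiveP => -[i x] [j y]; rewrite !ffunE => /fi[/= -> ->].
apply/forallP => -[i x]; apply/forallP => -[j y]; apply/implyP.
rewrite /= /copies_adj /= => /andP[/eqP-> xy]; rewrite !ffunE /=.
by rewrite fe.
Qed.

Lemma ramsey_arrows n : arrows (r n) (copies n H).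
Proof. by rewrite /ramsey; case: ex_minnP. Qed.

Lemma ramsey_le n N : arrows N (copies n H) -> r n <= N.
Proof. by rewrite /ramsey; case: ex_minnP => m _ h /h. Qed.

Lemma ramsey_gt n (T : finType) (col : T -> T -> bool) : symmetric col ->
  (forall b, ~ has_copies H col b n setT) -> #|T| < r n.
Proof.
move=> cs nh; rewrite ltnNge; apply/negP => h.
by have [b /nh] := arrows_hc cs (ramsey_arrows n) h.
Qed.

Lemma hc_ramsey n (T : finType) (col : T -> T -> bool) (X : {set T}) :
  symmetric col -> r n <= #|X| -> exists b, has_copies H col b n X.
Proof.
move=> cs hX; pose U : finType := {x : T | x \in X}.
have [|||b [f [fi _ fe]]] := @arrows_hc n (r n) U (fun x y => col (val x) (val y)).
- by move=> x y; apply: cs.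
- exact: ramsey_arrows.
- by rewrite card_sig.
exists b, (fun i x => val (f i x)); split=> //.
- by move=> i j x y /val_inj/fi.
- by move=> i x; apply: valP.
Qed.

Hypothesis k1 : 1 < k.
Hypothesis noiso : no_isolated H.

Let k0 : 0 < k. Proof. exact: ltnW. Qed.
Let d0 : 0 < d. Proof. exact: d_gt0. Qed.
Let kad : k = a + d. Proof. exact: kE. Qed.

(** Colour a clique on [k * n - 1] vertices [true] and all other edges, with [d * n - 1] more
    vertices, [false]. A [true] copy lies in the clique, as [H] has no isolated vertices; a [false]
    copy has at most [a] vertices there. *)
Lemma ramsey_lower n : 0 < n -> (k + d) * n <= (r n).+1.
Proof.
move=> n0; pose T : finType := ('I_(k * n).-1 + 'I_(d * n).-1)%type.
pose left (u : T) := if u is inl _ then true else false.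
pose col (u v : T) := left u && left v.
have cs : symmetric col by move=> u v; rewrite /col andbC.
have kn : 0 < k * n by rewrite muln_gt0 k0.
have dn : 0 < d * n by rewrite muln_gt0 d0.
have cl : #|[set u : T | left u]| = (k * n).-1.
  rewrite -sum1_card big_sumType /= [X in _ + X]big_pred0 ?addn0; last by move=> i; rewrite inE.
  rewrite (eq_bigl xpredT); last by move=> i; rewrite inE.
  by rewrite sum1_card card_ord.
have cr : #|[set u : T | ~~ left u]| = (d * n).-1.
  rewrite -sum1_card big_sumType /= [X in X + _]big_pred0 ?add0n; last by move=> i; rewrite inE.
  rewrite (eq_bigl xpredT); last by move=> i; rewrite inE.
  by rewrite sum1_card card_ord.
have nh b : ~ has_copies H col b n setT.
  move=> [f [fi _ fe]].
  have fi2 : injective (fun p : 'I_n * H => f p.1 p.2).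
    by move=> [i x] [j y] /= /fi[-> ->].
  case: b fe => fe.
    have : #|[set: 'I_n * H]| <= (k * n).-1; last first.
      by rewrite cardsT card_prod card_ord mulnC; lia.
    rewrite -cl -(card_imset _ fi2); apply: subset_leq_card.
    apply/subsetP => u /imsetP[[i x] _ ->]; rewrite inE /=.
    by have [y xy] := noiso x; have := fe i x y xy; rewrite /col => /andP[].
  pose P1 := [set p : 'I_n * H | left (f p.1 p.2)].
  have e1 : #|P1| <= n * a.
    rewrite -[X in _ <= X * _]card_ord -sum_nat_const -sum1_card.
    rewrite (eq_bigl (fun p : 'I_n * H => true && (p.2 \in [set x | left (f p.1 x)]))); last first.
      by move=> p; rewrite !inE.
    rewrite -(pair_big_dep xpredT (fun i x => x \in [set x | left (f i x)]) (fun _ _ => 1)) /=.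
    apply: leq_sum => i _; rewrite sum1_card; apply: alpha_max.
    apply/forall_inP => x; rewrite inE => hx; apply/forall_inP => y; rewrite inE => hy.
    by apply/negP => /(fe i); rewrite /col hx hy.
  have e2 : #|~: P1| <= (d * n).-1.
    rewrite -cr -(card_imset _ fi2); apply: subset_leq_card.
    by apply/subsetP => u /imsetP[p + ->]; rewrite !inE.
  have := cardsC P1; rewrite card_prod card_ord.
  have : n * k = n * a + d * n by rewrite (mulnC d) -mulnDr -kad.
  by lia.
have := ramsey_gt cs nh; rewrite card_sum !card_ord mulnDl.
by move: (k * n) (d * n) kn dn => u v; lia.
Qed.

Lemma pw_large n : pw H 60 <= n -> 0 < n.
Proof. by apply: leq_trans; rewrite expn_gt0. Qed.

Lemma ramsey_stepU n : pw H 60 <= n -> r n.+1 <= r n + (k + d).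
Proof.
move=> hn; apply: ramsey_le; apply: contraT => /not_arrows[col [cs nh]].
have rn := ramsey_lower (pw_large hn).
have [||[S [_ eS hS]]] := @copies_or_tie H _ col cs k0 noiso n.+1 setT.
- rewrite cardsT card_ord.
  have : n <= d * n by rewrite leq_pmull.
  have : 2 ^ (3 * k) <= pw H 60 by rewrite leq_exp2l // leq_mul2r orbT.
  move: rn hn; rewrite mulnDl mulnS; move: (k * n) (d * n) (pw H 60) => u v w.
  by move: (2 ^ (3 * k)) => x; move: d0; lia.
- by case=> b /nh.
have [|b hb] := @hc_ramsey n _ col (setT :\: S) cs.
  by rewrite cardsD_sub ?subsetT // cardsT card_ord eS addnK.
case: (nh b); rewrite -addn1.
by apply: (hc_add hb (hS b)); rewrite ?subsetT // disjDl.
Qed.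

(** An extremal colouring has [r n - 1] vertices, at least [(k + d) * n - 2] by [ramsey_lower];
    hence the 2 in [extremal_extension]. *)
Lemma ramsey_stepL n : pw H 60 <= n -> r n + (k + d) <= r n.+1.
Proof.
move=> hn; have rn := ramsey_lower (pw_large hn).
have r0 : 0 < r n.
  have : 2 * 1 <= (k + d) * n by apply: leq_mul; [lia|exact: pw_large].
  by lia.
have [|col [cs nh]] := @not_arrows n (r n).-1.
  by apply/negP => /ramsey_le; lia.
have [|T' [col' [cs' eT nh']]] := @extremal_extension H k1 noiso _ col cs n hn _ nh.
  by rewrite card_ord; lia.
by have := ramsey_gt cs' nh'; rewrite eT card_ord; lia.
Qed.

Lemma ramsey_linear n : pw H 60 <= n ->
  r n = r (pw H 60) + (k + d) * (n - pw H 60).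
Proof.
move=> hn; rewrite -(subnK hn) addnK addnC.
elim: (n - _) => [|e IH]; first by rewrite addn0 muln0 addn0.
have le : pw H 60 <= pw H 60 + e := leq_addr _ _.
rewrite addnS; apply/eqP; rewrite eqn_leq.
have h1 := ramsey_stepU le; have h2 := ramsey_stepL le.
by rewrite mulnS; move: h1 h2; rewrite IH => h1 h2; apply/andP; split; lia.
Qed.

End Ramsey.

Import Order.TTheory GRing.Theory Num.Theory.
Local Open Scope ring_scope.

Theorem theorem2 (R : realType) :
  exists C : R, 0 < C /\
    forall (k : nat) (H : sgraph), #|H| = k -> no_isolated H ->
      exists c : int, forall n : nat, 2 `^ (C * k%:R) <= n%:R ->
        (ramsey (copies n H))%:Z = (2 * #|H|%:Z - (alpha H)%:Z) * n%:Z + c.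
Proof.
exists 60%:R; split; first by rewrite ltr0n.
move=> k H eH noiso.
have ak : (alpha H <= #|H|)%N by have [I _ <-] := alpha_ex H; apply: max_card.
have [H0|H0] := posnP #|H|.
  (* For the empty graph the empty map is an embedding, so every Ramsey number is 0. *)
  exists 0 => n _.
  have -> : ramsey (copies n H) = 0%N.
    apply/eqP; rewrite -leqn0; apply: ramsey_le; apply/forallP => c.
    apply/existsP; exists true; apply/existsP.
    have e (u : copies n H) : False.
      by have := card0_eq H0 u.2; rewrite inE.
    exists [ffun u => False_rect _ (e u)]; apply/andP; split.
      by apply/injectiveP => u; case: (e u).
    by apply/forallP => u; case: (e u).
  by move: ak; rewrite H0 leqn0 => /eqP->; rewrite mulr0 subr0 mul0r.
have k1 : (1 < #|H|)%N.
  case/card_gt0P: H0 => x _; have [y xy] := noiso x.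
  rewrite (cardD1 x) (cardD1 y) !inE /=.
  by rewrite (_ : y != x) //; apply: contraTneq xy => ->; rewrite adj_irrefl.
(* The constant is the excess at [n = 2 ^ (60 * #|H|)], from where on the excess does not change. *)
exists ((ramsey (copies (pw H 60) H))%:Z - ((#|H| + (#|H| - alpha H)) * pw H 60)%N%:Z).
move=> n; rewrite -natrM powR_mulrn ?ler0n // -natrX ler_nat -eH => hn.
rewrite (ramsey_linear k1 noiso hn) PoszD.
have -> : 2 * #|H|%:Z - (alpha H)%:Z = (#|H| + (#|H| - alpha H))%N%:Z by lia.
rewrite mulnBr -subzn ?leq_mul2l ?hn ?orbT // !PoszM.
by rewrite addrCA addrA.
Qed.
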